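(* Let $k\ge 3$, let $y\sim N(\mu,I_{k\times k})$ with $\mu\in\mathbb{R}^k$, and let $\tilde\mu(y)=\left(1-\frac{k-2}{\|y\|^{2}}\right)y$ be the James–Stein statistic. For $t\in\mathbb{R}^k\setminus\{0\}$ let $y_1,y_2$ be the two preimages of $t$ under $\tilde\mu$, with $\|y_2\|<\sqrt{k-2}<\|y_1\|$. Then for every $\mu\in\mathbb{R}^k$: (a) the score (gradient in $\mu$ of the log-density) of the marginal model of $\tilde\mu$ at $t$ is $$s(t)=E\left(y-\mu\mid\tilde\mu=t\right)=\pi(t)\,(y_1-\mu)+\{1-\pi(t)\}\,(y_2-\mu),$$ where $\pi(t)$ is the conditional probability of the outer branch $\{\|y\|>\sqrt{k-2}\}$ given $\tilde\mu=t$, and $0<\pi(t)<1$ for every $t\ne 0$; (b) the $\Lambda$-information of $g_{\tilde\mu}$, the image of $\tilde\mu$ under the score map, is $$\Lambda(g_{\tilde\mu})=I_{\tilde\mu}=I_{k\times k}-E\left\{V\left(y\mid\tilde\mu\right)\right\};$$ (c) the deficit term $E\{V(y\mid\tilde\mu)\}$ is nonzero, and the efficiency of James–Stein is strictly below one: $\frac1k\mathrm{tr}\,\mathrm{Eff}^{\Lambda}(g_{\tilde\mu})<1$.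
   Context: The model is $M_k=\{m(y)=(2\pi)^{-k/2}\exp(-\tfrac12\|y-\mu\|^2):\mu\in\mathbb{R}^k\}$, with log-likelihood $\ell$, score $\nabla_\mu\ell=y-\mu$, and Fisher information $I=I_{k\times k}$ (the identity matrix). The version of the conditional probability used is explicit: for $t\neq 0$ put $c=\|t\|$, $r_1=\{c+\sqrt{c^2+4(k-2)}\}/2$, $r_2=\{-c+\sqrt{c^2+4(k-2)}\}/2$; then the two preimages of $t$ are $y_1=r_1t/c$ and $y_2=-r_2t/c$, and $\pi(t)=w_1/(w_1+w_2)$ with $w_i=m(y_i)/\{\rho'(r_i)(c/r_i)^{k-1}\}$, $\rho'(r)=1+(k-2)/r^2$. It depends on $\mu$ through $m$. $g_{\tilde\mu}(y,\mu)=s(\tilde\mu(y))$ is the gradient in $\mu$ of the log of the marginal density of $\tilde\mu$ (with respect to Lebesgue measure), evaluated at $\tilde\mu(y)$. $I_{\tilde\mu}=E(s\,s^{t})$, where the superscript $t$ denotes transpose, is the Fisher information matrix of the marginal model of $\tilde\mu$. $V(y\mid\tilde\mu)$ is the conditional covariance matrix of $y$ given $\tilde\mu$. All expectations are under $N(\mu,I_{k\times k})$. For an $\mathbb{R}^k$-valued generalized estimator $g$ (a function of $y$ and $\mu$ with mean zero and finite variance at each $\mu$, smooth in $\mu$), $\Lambda(g)=C^{t}V(g)^{-1}C$ with $C_{ij}=\mathrm{Cov}(g_i,\partial\ell/\partial\mu_j)$ and $V(g)$ its covariance matrix, and $\mathrm{Eff}^{\Lambda}(g)=I^{-1/2}\Lambda(g)I^{-1/2}$,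 here equal to $\Lambda(g)$. *)

(* Defs.v *)
From HB Require Import structures.
From mathcomp Require Import all_boot all_order all_algebra.
From mathcomp Require Import all_classical all_reals all_analysis.
From mathcomp Require Import measurable_realfun.
Set Implicit Arguments.
Unset Strict Implicit.
Unset Printing Implicit Defensive.
Import Order.TTheory GRing.Theory Num.Theory.
Import numFieldNormedType.Exports.
Local Open Scope classical_set_scope.
Local Open Scope ring_scope.

Definition measure_row_display : measure_display -> measure_display.
Proof. exact. Qed.

(* R^n is 'rV[R]_n with the product (equivalently Borel) sigma-algebra, the one
   generated by the coordinates. *)
Section measurable_row.
Variables (R : realType) (n : nat).

Definition row_coord (i : 'I_n) (x : 'rV[R]_n) : R := x ord0 i.

Let row_set0 : g_sigma_preimage row_coord set0.
Proof. exact: sigma_algebra0. Qed.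

Let row_setC A :
  g_sigma_preimage row_coord A -> g_sigma_preimage row_coord (~` A).
Proof. exact: sigma_algebraC. Qed.

Let row_bigcup (F : _^nat) : (forall i, g_sigma_preimage row_coord (F i)) ->
  g_sigma_preimage row_coord (\bigcup_i (F i)).
Proof. exact: sigma_algebra_bigcup. Qed.

HB.instance Definition _ :=
  @isMeasurable.Build (measure_row_display default_measure_display)
    'rV[R]_n (g_sigma_preimage row_coord) row_set0 row_setC row_bigcup.

Lemma measurable_row_coord (i : 'I_n) :
  measurable_fun [set: 'rV[R]_n] (row_coord i).
Proof.
move=> _ Y mY; rewrite setTI; apply: sub_sigma_algebra => /=.
rewrite -bigcup_seq/=; exists i => /=; first by rewrite mem_index_enum.
by exists Y => //; rewrite setTI.
Qed.

Lemma measurable_fun_rowP d (T : measurableType d) (f : T -> 'rV[R]_n) :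
  (forall i, measurable_fun [set: T] (row_coord i \o f)) ->
  measurable_fun [set: T] f.
Proof.
move=> mf.
suff : g_sigma_preimage (fun i => row_coord i \o f) `<=` measurable.
  rewrite g_sigma_preimage_comp => prefS _ A mA; apply: prefS; by exists A.
apply: smallest_sub; first exact: sigma_algebra_measurable.
rewrite -bigcup_seq/=; apply: bigcup_sub => i _ A [B mB <-]; exact: mf.
Qed.

End measurable_row.

Section lebesgue_row.
Variable R : realType.
Local Notation rT := (measurableTypeR R).

Definition row_cons n (p : rT * 'rV[R]_n) : 'rV[R]_n.+1 :=
  \row_i oapp (p.2 ord0) p.1 (unlift ord0 i).

Definition row_uncons n (x : 'rV[R]_n.+1) : rT * 'rV[R]_n :=
  (x ord0 ord0, \row_i x ord0 (lift ord0 i)).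

Lemma row_consK n : cancel (@row_cons n) (@row_uncons n).
Proof.
case=> a x; rewrite /row_uncons /row_cons; congr pair.
  by rewrite mxE unlift_none.
by apply/rowP => i; rewrite !mxE liftK.
Qed.

Lemma row_unconsK n : cancel (@row_uncons n) (@row_cons n).
Proof.
move=> x; apply/rowP => i; rewrite mxE.
by case: unliftP => [j ->|->] //=; rewrite mxE.
Qed.

Lemma measurable_row_cons n : measurable_fun [set: rT * 'rV[R]_n] (@row_cons n).
Proof.
apply: measurable_fun_rowP => i.
case: (unliftP ord0 i) => [j ->|->].
  rewrite (_ : _ \o _ = row_coord j \o snd).
    by apply: measurableT_comp; [exact: measurable_row_coord|].
  by apply/funext => x; rewrite /= /row_coord mxE liftK.
rewrite (_ : _ \o _ = fst) //.
by apply/funext => x; rewrite /= /row_coord mxE unlift_none.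
Qed.

Lemma measurable_row_uncons n : measurable_fun [set: 'rV[R]_n.+1] (@row_uncons n).
Proof.
apply/measurable_fun_pairP; split.
  exact: (@measurable_row_coord R n.+1 ord0).
apply: measurable_fun_rowP => i.
rewrite (_ : _ \o _ = row_coord (lift ord0 i)).
  exact: measurable_row_coord.
by apply/funext => x; rewrite /= /row_coord mxE.
Qed.

Section step.
Variables (n : nat) (mu : {sigma_finite_measure set 'rV[R]_n -> \bar R}).

Let prodm : {measure set (rT * 'rV[R]_n)%type -> \bar R} :=
  (lebesgue_measure \x mu)%E.

Definition lebesgue_row_step : set 'rV[R]_n.+1 -> \bar R :=
  pushforward (lebesgue_measure \x mu)%E (@row_cons n).

Let step0 : lebesgue_row_step set0 = 0%E.
Proof. by rewrite /lebesgue_row_step /pushforward preimage_set0 (measure0 prodm). Qed.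

Let step_ge0 A : (0 <= lebesgue_row_step A)%E.
Proof. exact: (measure_ge0 prodm). Qed.

Let step_sigma_additive : semi_sigma_additive lebesgue_row_step.
Proof.
move=> F mF tF mUF; rewrite /lebesgue_row_step /pushforward preimage_bigcup.
have mp A : measurable A -> measurable (@row_cons n @^-1` A).
  by move=> mA; rewrite -[X in measurable X]setTI; exact: measurable_row_cons.
apply: (@measure_semi_sigma_additive _ _ _ prodm).
- by move=> i; exact: mp.
- apply/trivIsetP => /= i j _ _ ij; rewrite -preimage_setI.
  by move/trivIsetP : tF => /(_ _ _ _ _ ij) ->//; rewrite preimage_set0.
- by rewrite -preimage_bigcup; exact: mp.
Qed.

HB.instance Definition _ := isMeasure.Build _ _ _ lebesgue_row_step
  step0 step_ge0 step_sigma_additive.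

Let step_sigma_finite : sigma_finite setT lebesgue_row_step.
Proof.
have [F TF Foo] : sigma_finite setT prodm.
  have /sigma_finiteP[F [TF ndF Foo]] :=
    sigma_finiteT (@lebesgue_measure R : {sigma_finite_measure set rT -> \bar R}).
  have /sigma_finiteP[G [TG ndG Goo]] := sigma_finiteT mu.
  exists (fun i => F i `*` G i).
    rewrite -setXTT TF TG predeqE => -[x y]; split.
      move=> [/= [i _ Fix] [j _ Gjy]]; exists (maxn i j) => //; split.
      - by move: x Fix; exact/subsetPset/ndF/leq_maxl.
      - by move: y Gjy; exact/subsetPset/ndG/leq_maxr.
    by move=> [i _ []/= ? ?]; split; exists i.
  move=> i; have [? ?] := Foo i; have [? ?] := Goo i.
  split; first exact: measurableX.
  by rewrite /= product_measure1E// lte_mul_pinfty// ge0_fin_numE.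
exists (fun i => @row_uncons n @^-1` F i).
  by rewrite -preimage_bigcup -TF preimage_setT.
move=> i; have [mF Fi] := Foo i; split.
  by rewrite -[X in measurable X]setTI; exact: measurable_row_uncons.
rewrite /lebesgue_row_step /pushforward -comp_preimage.
by rewrite (_ : _ \o _ = id) ?preimage_id//; apply/funext => x /=; rewrite row_consK.
Qed.

HB.instance Definition _ := Measure_isSigmaFinite.Build _ _ _ lebesgue_row_step
  step_sigma_finite.

End step.

(* n-fold product of the one-dimensional Lebesgue measure *)
Fixpoint lebesgue_row n : {sigma_finite_measure set 'rV[R]_n -> \bar R} :=
  match n with
  | 0 => dirac (0 : 'rV[R]_0)
  | m.+1 => lebesgue_row_step (lebesgue_row m)
  end.

Lemma lebesgue_row_box n (A : 'I_n -> set R) :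
  (forall i, measurable (A i : set rT)) ->
  lebesgue_row n [set x | forall i, A i (x ord0 i)] =
  (\prod_(i < n) lebesgue_measure (A i : set rT))%E.
Proof.
elim: n A => [|n IH] A mA.
  rewrite big_ord0 [LHS]diracE (_ : _ \in _) // inE /= => i; by case: i.
rewrite big_ord_recl -IH//.
rewrite -[LHS]/((lebesgue_measure \x lebesgue_row n)%E (@row_cons n @^-1` _)).
have -> : @row_cons n @^-1` [set x | forall i, A i (x ord0 i)] =
    A ord0 `*` [set x : 'rV[R]_n | forall i, A (lift ord0 i) (x ord0 i)].
  apply/seteqP; split=> -[a x] /=.
    move=> Aax; split; first by have := Aax ord0; rewrite mxE unlift_none.
    by move=> i; have := Aax (lift ord0 i); rewrite mxE liftK.
  move=> [Aa Ax] i; rewrite mxE.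
  by case: unliftP => [j ->|->] //=; exact: Ax.
rewrite product_measure1E//.
have -> : [set x : 'rV[R]_n | forall i, A (lift ord0 i) (x ord0 i)] =
    \bigcap_(i in [set: 'I_n]) (row_coord i @^-1` A (lift ord0 i)).
  by apply/seteqP; split=> [x Ax i _|x Ax i]; [exact: Ax|exact: (Ax i I)].
apply: fin_bigcap_measurable => // i _.
by rewrite -[X in measurable X]setTI; apply: measurable_row_coord => //; exact: mA.
Qed.

End lebesgue_row.

Section gauss_row.
Variable R : realType.

(* Euclidean norm; the canonical norm `|x| of 'rV[R]_n is the sup norm. *)
Definition enorm n (x : 'rV[R]_n) : R := Num.sqrt (\sum_i x ord0 i ^+ 2).

(* density of N(mu, I) with respect to Lebesgue measure *)
Definition gauss_pdf n (mu y : 'rV[R]_n) : R :=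
  (2 * pi) `^ (- (n%:R / 2)) * expR (- (enorm (y - mu) ^+ 2 / 2)).

Lemma gauss_pdfE n (mu y : 'rV[R]_n) :
  gauss_pdf mu y = \prod_i normal_pdf (mu ord0 i) 1 (y ord0 i).
Proof.
have pi2 : 0 <= 2 * pi :> R by rewrite mulr_ge0 ?pi_ge0.
rewrite /gauss_pdf /normal_pdf oner_eq0 /normal_fun big_split/=.
congr (_ * _).
  rewrite prodr_const card_ord /normal_peak expr1n mul1r -[pi *+ 2]mulr_natl exprVn.
  by rewrite powRN [n%:R / 2]mulrC powRrM powR12_sqrt// powR_mulrn.
rewrite sqr_sqrtr ?sumr_ge0// => [|i _]; last exact: sqr_ge0.
rewrite mulr_suml -sumrN expR_sum; apply: eq_bigr => i _.
by rewrite !mxE expr1n mulNr.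
Qed.

Lemma gauss_pdf_ge0 n (mu y : 'rV[R]_n) : 0 <= gauss_pdf mu y.
Proof. by rewrite mulr_ge0 ?powR_ge0 ?expR_ge0. Qed.

Lemma measurable_gauss_pdf n (mu : 'rV[R]_n) :
  measurable_fun [set: 'rV[R]_n] (gauss_pdf mu).
Proof.
rewrite (_ : gauss_pdf mu = fun y => \prod_i normal_pdf (mu ord0 i) 1 (y ord0 i)).
  apply: measurable_prod => i _.
  apply: (measurableT_comp (measurable_normal_pdf _ _)).
  exact: measurable_row_coord.
by apply/funext => y; rewrite gauss_pdfE.
Qed.

Lemma measurable_gauss_pdf_EFin n (mu : 'rV[R]_n) :
  measurable_fun [set: 'rV[R]_n] (fun y => (gauss_pdf mu y)%:E).
Proof. by apply/measurable_EFinP; exact: measurable_gauss_pdf. Qed.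

Lemma ge0_integral_lebesgue_rowS n (f : 'rV[R]_n.+1 -> \bar R) :
  measurable_fun [set: 'rV[R]_n.+1] f -> (forall x, 0 <= f x)%E ->
  (\int[lebesgue_row R n.+1]_x f x =
   \int[lebesgue_measure]_x \int[lebesgue_row R n]_y f (row_cons (x, y)))%E.
Proof.
move=> mf f0.
rewrite [LHS](@ge0_integral_pushforward _ _ _ _ R _ (@measurable_row_cons R n)
  (lebesgue_measure \x lebesgue_row R n)%E setT f)//.
rewrite preimage_setT fubini_tonelli1//.
  exact: measurableT_comp mf (@measurable_row_cons R n).
by move=> x; exact: f0.
Qed.

Lemma integral_gauss_pdf n (mu : 'rV[R]_n) :
  (\int[lebesgue_row R n]_y (gauss_pdf mu y)%:E = 1)%E.
Proof.
elim: n mu => [|n IH] mu.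
  rewrite [LHS]integral_dirac//.
    by rewrite diracT mul1e gauss_pdfE big_ord0.
  exact: measurable_gauss_pdf_EFin.
rewrite ge0_integral_lebesgue_rowS; first last.
- by move=> x; rewrite lee_fin gauss_pdf_ge0.
- exact: measurable_gauss_pdf_EFin.
rewrite -(integral_normal_pdf (mu ord0 ord0) 1).
apply: eq_integral => x _.
transitivity (\int[lebesgue_row R n]_y ((normal_pdf (mu ord0 ord0) 1 x)%:E *
    (gauss_pdf (\row_i mu ord0 (lift ord0 i)) y)%:E))%E.
  apply: eq_integral => y _; rewrite -EFinM; congr EFin.
  rewrite !gauss_pdfE big_ord_recl /row_cons !mxE unlift_none /=; congr (_ * _).
  by apply: eq_bigr => i _; rewrite !mxE liftK.
rewrite ge0_integralZl//; first by rewrite IH mule1.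
- exact: measurable_gauss_pdf_EFin.
- by move=> y _; rewrite lee_fin gauss_pdf_ge0.
- by rewrite lee_fin normal_pdf_ge0.
Qed.

(* the law N(mu, I) on R^n *)
Definition gauss_row n (mu : 'rV[R]_n) : set 'rV[R]_n -> \bar R :=
  fun A => (\int[lebesgue_row R n]_(y in A) (gauss_pdf mu y)%:E)%E.

Section measure.
Variables (n : nat) (mu : 'rV[R]_n).

Let gauss0 : gauss_row mu set0 = 0%E.
Proof. by rewrite /gauss_row integral_set0. Qed.

Let gauss_ge0 A : (0 <= gauss_row mu A)%E.
Proof. by apply: integral_ge0 => x _; rewrite lee_fin gauss_pdf_ge0. Qed.

Let gauss_sigma_additive : semi_sigma_additive (gauss_row mu).
Proof.
move=> /= A mA tA mUA.
rewrite /gauss_row ge0_integral_bigcup//=.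
- apply: is_cvg_ereal_nneg_natsum_cond => i _ _; exact: gauss_ge0.
- apply: measurable_funTS; exact: measurable_gauss_pdf_EFin.
- by move=> x _; rewrite lee_fin gauss_pdf_ge0.
Qed.

HB.instance Definition _ := isMeasure.Build _ _ _ (gauss_row mu)
  gauss0 gauss_ge0 gauss_sigma_additive.

Let gauss_setT : gauss_row mu [set: _] = 1%E.
Proof. exact: integral_gauss_pdf. Qed.

HB.instance Definition _ :=
  @Measure_isProbability.Build _ _ R (gauss_row mu) gauss_setT.

End measure.
End gauss_row.

Section statistics.
Variable R : realType.

Definition grad k (f : 'rV[R]_k -> R) (x : 'rV[R]_k) : 'rV[R]_k :=
  \row_j 'D_(delta_mx ord0 j) f x.

(* n times continuously differentiable *)
Fixpoint cont_diff k n (f : 'rV[R]_k -> R) : Prop :=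
  continuous f /\
  match n with
  | 0 => True
  | m.+1 => forall v, (forall x, derivable f x v) /\ cont_diff m ('D_v f)
  end.

Definition smooth k (f : 'rV[R]_k -> R) : Prop := forall n, cont_diff n f.

(* [score p mu y] is the gradient in the parameter of the log-density at y *)
Definition score k (p : 'rV[R]_k -> 'rV[R]_k -> R) (mu y : 'rV[R]_k) :
  'rV[R]_k := grad (fun nu => ln (p nu y)) mu.

Definition expect_mx d (T : measurableType d) (P : probability T R) m n
    (X : T -> 'M[R]_(m, n)) : 'M[R]_(m, n) :=
  \matrix_(i, j) fine 'E_P[fun w => X w i j].

Definition cov_mx d (T : measurableType d) (P : probability T R) k
    (X Y : T -> 'rV[R]_k) : 'M[R]_k :=
  \matrix_(i, j) fine (covariance P (fun w => X w ord0 i) (fun w => Y w ord0 j)).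

(* t |-> e t is a version of E(X | S = t) *)
Definition is_cond_exp d d' (T : measurableType d) (U : measurableType d')
    (P : probability T R) (S : T -> U) (X : T -> R) (e : U -> R) : Prop :=
  [/\ P.-integrable setT (EFin \o X),
      measurable_fun setT e,
      P.-integrable setT (EFin \o (e \o S)) &
      forall A, measurable A ->
        (\int[P]_(w in S @^-1` A) (X w)%:E =
         \int[P]_(w in S @^-1` A) (e (S w))%:E)%E].

(* t |-> V t is a version of the conditional covariance matrix V(X | S = t) *)
Definition is_cond_cov d d' (T : measurableType d) (U : measurableType d')
    (P : probability T R) (S : T -> U) k (X : T -> 'rV[R]_k)
    (V : U -> 'M[R]_k) : Prop :=
  exists m : U -> 'rV[R]_k,
    (forall i, is_cond_exp P S (fun w => X w ord0 i) (fun t => m t ord0 i)) /\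
    (forall i j, is_cond_exp P S
      (fun w => (X w ord0 i - m (S w) ord0 i) * (X w ord0 j - m (S w) ord0 j))
      (fun t => V t i j)).

(* p mu is a Lebesgue density of S under P mu for every mu, in the version that
   is continuous on D. A density is only determined up to null sets, which may
   vary with mu, so without continuity its gradient in mu has no meaning; for D
   open the continuous version is unique on D. *)
Definition marginal_density k (P : 'rV[R]_k -> set 'rV[R]_k -> \bar R)
    (S : 'rV[R]_k -> 'rV[R]_k) (D : set 'rV[R]_k)
    (p : 'rV[R]_k -> 'rV[R]_k -> R) : Prop :=
  forall mu,
    [/\ measurable_fun setT (p mu),
        forall t, 0 <= p mu t,
        forall A, measurable A ->
          (P mu (S @^-1` A) = \int[lebesgue_row R k]_(t in A) (p mu t)%:E)%E &
        forall t, D t -> {for t, continuous (p mu)}].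

(* the symmetric positive semidefinite inverse square root *)
Definition inv_sqrt_mx k (A : 'M[R]_k) : 'M[R]_k :=
  xget 0 [set J : 'M[R]_k |
    [/\ J^T = J, forall v : 'rV[R]_k, 0 <= (v *m J *m v^T) ord0 ord0 &
        J *m J *m A = 1%:M]].

(* Smoothness in mu is asked for almost every y only: an estimator obtained by
   pulling back a score is determined up to a null set of y. *)
Definition generalized_estimator k (g : 'rV[R]_k -> 'rV[R]_k -> 'rV[R]_k) :
  Prop :=
  [/\ forall mu i, (fun y => g y mu ord0 i) \in Lfun (gauss_row mu) 2%:E,
      forall mu i, ('E_(gauss_row mu)[fun y => g y mu ord0 i] = 0)%E &
      {ae lebesgue_row R k,
        forall y, forall i, smooth (fun mu => g y mu ord0 i)}].

Definition Lambda k (g : 'rV[R]_k -> 'rV[R]_k -> 'rV[R]_k) (mu : 'rV[R]_k) :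
  'M[R]_k :=
  let C := cov_mx (gauss_row mu) (g^~ mu) (score (@gauss_pdf R k) mu) in
  C^T *m invmx (cov_mx (gauss_row mu) (g^~ mu) (g^~ mu)) *m C.

(* vectors are rows, so s s^t is written s^T *m s *)
Definition fisher_info d (T : measurableType d) (P : probability T R) k
    (s : T -> 'rV[R]_k) : 'M[R]_k :=
  expect_mx P (fun w => (s w)^T *m s w).

Definition efficiency k (g : 'rV[R]_k -> 'rV[R]_k -> 'rV[R]_k)
    (mu : 'rV[R]_k) : 'M[R]_k :=
  let J := inv_sqrt_mx
    (fisher_info (gauss_row mu) (score (@gauss_pdf R k) mu)) in
  J *m Lambda g mu *m J.

End statistics.

Section james_stein.
Variables (R : realType) (k : nat).
Implicit Types (mu t y : 'rV[R]_k) (r : R).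

Definition james_stein y : 'rV[R]_k := (1 - (k%:R - 2) / enorm y ^+ 2) *: y.

Definition js_r1 t : R :=
  (enorm t + Num.sqrt (enorm t ^+ 2 + 4 * (k%:R - 2))) / 2.
Definition js_r2 t : R :=
  (- enorm t + Num.sqrt (enorm t ^+ 2 + 4 * (k%:R - 2))) / 2.

Definition js_y1 t : 'rV[R]_k := (js_r1 t / enorm t) *: t.
Definition js_y2 t : 'rV[R]_k := - (js_r2 t / enorm t) *: t.

(* derivative of the radial profile rho r = r - (k - 2) / r *)
Definition js_drho r : R := 1 + (k%:R - 2) / r ^+ 2.

Definition js_w1 mu t : R := gauss_pdf mu (js_y1 t) /
  (js_drho (js_r1 t) * (enorm t / js_r1 t) ^+ k.-1).
Definition js_w2 mu t : R := gauss_pdf mu (js_y2 t) /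
  (js_drho (js_r2 t) * (enorm t / js_r2 t) ^+ k.-1).

Definition js_pi mu t : R := js_w1 mu t / (js_w1 mu t + js_w2 mu t).

End james_stein.

(* Main.v *)
Require Import Defs.
From HB Require Import structures.
From mathcomp Require Import all_boot all_order all_algebra.
From mathcomp Require Import all_classical all_reals all_analysis.
From mathcomp Require Import measurable_realfun.
From mathcomp Require Import ring lra.
Set Implicit Arguments.
Unset Strict Implicit.
Unset Printing Implicit Defensive.
Import Order.TTheory GRing.Theory Num.Theory.
Import numFieldNormedType.Exports.
Local Open Scope classical_set_scope.
Local Open Scope ring_scope.

(** Radially, James-Stein is [rho r = r - (k - 2) / r], an increasing bijection
    from ]0, +oo[ onto R, negative inside the sphere of radius [sqrt (k - 2)].
    A vector [t != 0] of norm [c] thus has two preimages: along [t] at the radius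
    where [rho = c] and against [t] at the radius where [rho = - c]. In polar
    coordinates this gives the change of variables [ge0_integral_js_branches]: the
    law of the statistic has density [w1 + w2], continuous off the origin
    ([js_density_marginal]), and given the statistic the observation is at [y1]
    with probability [pi = w1 / (w1 + w2)] and at [y2] otherwise
    ([js_is_cond_exp]).

    Part (a) follows by differentiating the logarithm of [w1 + w2] in the parameter
    ([score_js_density]): the Jacobians are constant in it, so the score is the
    [pi]-average of the normal scores [y1 - mu] and [y2 - mu], which is also the
    conditional mean of [y - mu].

    For (b), the score of the statistic being a conditional mean of the full score,
    their covariance [C] equals the variance [V] of the former; if [V] is
    invertible, [Lambda] is [V], the Fisher information of the marginal model.
    Pythagoras ([rexp_residual]) identifies the identity minus [V] with the
    expected conditional covariance. Invertibility ([js_info_unit]) is the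
    non-degeneracy of the score: a vanishing component would force [w1 * r1 = w2 * r2]
    on a ray, hence an exponential of the radius to coincide with a power of it
    ([js_score_not_degenerate]).

    For (c), the conditional variance of the coordinate [i] is
    [pi * (1 - pi) * (y1_i - y2_i) ^ 2], which is positive near the [i]-th unit
    vector ([js_info_diag_lt1]). All diagonal entries of [V] are therefore below
    one, and so is their mean. *)

(** * Integration against a density, image measures *)

Section density.
Context d (T : measurableType d) (R : realType).
Implicit Types (mu nu : {measure set T -> \bar R}).
Import HBNNSimple.
Local Open Scope ereal_scope.

(** The identity is linear in [f] and passes to increasing limits, so it reduces
    to indicators, where it is the hypothesis on [nu]. *)
Lemma ge0_integral_density mu nu (g : T -> R) :
  measurable_fun setT g -> (forall x, 0 <= g x)%R ->
  (forall A, measurable A -> nu A = \int[mu]_(x in A) (g x)%:E) ->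
  forall f : T -> \bar R, measurable_fun setT f -> (forall x, 0 <= f x) ->
  \int[nu]_x f x = \int[mu]_x (f x * (g x)%:E).
Proof.
move=> mg g0 nuE f mf f0.
pose f_ := nnsfun_approx measurableT mf.
have ffE x : f x = limn (fun n => (f_ n x)%:E).
  by apply/esym/cvg_lim => //; exact: cvg_nnsfun_approx.
have simple (h : {nnsfun T >-> R}) :
    \int[nu]_x (h x)%:E = \int[mu]_x ((h x)%:E * (g x)%:E).
  under eq_integral do rewrite fimfunE -fsumEFin//.
  under [RHS]eq_integral.
    move=> x _; rewrite fimfunE -fsumEFin// ge0_mule_fsuml; last first.
      by move=> r; rewrite EFinM nnfun_muleindic_ge0.
    over.
  rewrite ge0_integral_fsum//; last 2 first.
  - by move=> r; exact/measurable_EFinP/measurable_funM.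
  - by move=> r x _; rewrite EFinM nnfun_muleindic_ge0.
  rewrite ge0_integral_fsum//; last 2 first.
  - move=> r; apply: emeasurable_funM; last exact/measurable_EFinP.
    exact/measurable_EFinP/measurable_funM.
  - move=> r x _; apply: mule_ge0; last by rewrite lee_fin.
    by rewrite EFinM nnfun_muleindic_ge0.
  apply: eq_fsbigr => r _.
  have [r0|r0] := ltP r 0%R.
    rewrite !integral0_eq// => x _; rewrite preimage_nnfun0// indicE in_set0 mulr0//.
    by rewrite mul0e.
  under eq_integral do rewrite EFinM.
  rewrite integralZl_indic_nnsfun//= integral_indic// setIT nuE//.
  rewrite [X in _ * X]integral_mkcond -ge0_integralZl//.
  - apply: eq_integral => x _; rewrite EFinM -muleA; congr (_ * _).
    by rewrite patchE indicE; case: ifPn => _; rewrite ?mul1e ?mul0e.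
  - apply/(measurable_restrictT _ _).1; first exact: measurable_sfunP.
    by apply: measurable_funTS; exact/measurable_EFinP.
  - by move=> x _; apply: erestrict_ge0 => ? _; rewrite lee_fin.
transitivity (limn (fun n => \int[nu]_x (f_ n x)%:E)).
  rewrite -monotone_convergence//=.
  - by apply: eq_integral => x _; exact: ffE.
  - by move=> n; exact/measurable_EFinP/measurable_funTS.
  - by move=> n x _; rewrite lee_fin.
  - by move=> x _ a b ab; rewrite lee_fin; exact/lefP/nd_nnsfun_approx.
transitivity (limn (fun n => \int[mu]_x ((f_ n x)%:E * (g x)%:E))).
  by apply: congr_lim; apply/funext => n; exact: simple.
rewrite -monotone_convergence//=.
- apply: eq_integral => x _; apply/cvg_lim => //.
  by apply: cvgeZr => //; exact: cvg_nnsfun_approx.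
- move=> n; apply: emeasurable_funM; last exact/measurable_EFinP.
  exact/measurable_EFinP/measurable_funTS.
- by move=> n x _; rewrite mule_ge0// lee_fin ?g0.
- move=> x _ a b ab; rewrite lee_wpmul2r ?lee_fin//; exact/lefP/nd_nnsfun_approx.
Qed.

(** The proofs about [g] are arguments so that the measure structure can be
    attached to the function. *)
Definition density_measure mu (g : T -> R) of measurable_fun setT g & (forall x, 0 <= g x)%R :=
  fun A : set T => \int[mu]_(x in A) (g x)%:E.

Section measure.
Variables (mu : {measure set T -> \bar R}) (g : T -> R).
Hypotheses (mg : measurable_fun setT g) (g0 : (forall x, 0 <= g x)%R).
Local Notation dm := (density_measure mu mg g0).

Let dm0 : dm set0 = 0. Proof. by rewrite /density_measure integral_set0. Qed.

Let dm_ge0 A : 0 <= dm A.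
Proof. by apply: integral_ge0 => x _; rewrite lee_fin. Qed.

Let dm_sigma_additive : semi_sigma_additive dm.
Proof.
move=> /= A mA tA mUA.
rewrite /density_measure ge0_integral_bigcup//=.
- by apply: is_cvg_ereal_nneg_natsum_cond => i _ _; exact: dm_ge0.
- by apply: measurable_funTS; exact/measurable_EFinP.
- by move=> x _; rewrite lee_fin.
Qed.

HB.instance Definition _ := isMeasure.Build _ _ _ dm dm0 dm_ge0 dm_sigma_additive.
End measure.
End density.

Lemma measurable_invr (R : realType) : measurable_fun [set: R] (@GRing.inv R).
Proof.
have cinv (D : set R) : open D -> (forall x, D x -> x != 0) -> measurable_fun D (@GRing.inv R).
  move=> oD D0; apply: open_continuous_measurable_fun => // x /set_mem Dx.
  by apply: inv_continuous; exact: D0.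
have -> : [set: R] = `]-oo, 0[ `|` ([set 0] `|` `]0, +oo[).
  apply/seteqP; split => // x _ /=; rewrite !in_itv/= andbT.
  by case: (ltgtP x 0); [left|right; right|right; left].
apply/measurable_funU => //; first exact: measurableU.
split; first by apply: cinv => // x; rewrite /= in_itv/= => /lt_eqF ->.
apply/measurable_funU => //; split; first exact: measurable_fun_set1.
by apply: cinv => // x; rewrite /= in_itv/= andbT => /gt_eqF ->.
Qed.

Lemma measurable_sqrt (R : realType) : measurable_fun [set: R] (@Num.sqrt R).
Proof. by apply: continuous_measurable_fun; exact: sqrt_continuous. Qed.

Definition image_measure d1 d2 (X : measurableType d1) (Y : measurableType d2)
  (R : realType) (m : {measure set X -> \bar R}) (f : X -> Y)
  (mf : measurable_fun setT f) : {measure set Y -> \bar R}.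
Proof.
pose n : {measure set Y -> \bar R} := pushforward m f.
exact: (n mf).
Defined.

Lemma ge0_integral_image_measure d1 d2 (X : measurableType d1)
    (Y : measurableType d2) (R : realType) (m : {measure set X -> \bar R})
    (f : X -> Y) (mf : measurable_fun setT f) (g : Y -> \bar R) :
  measurable_fun setT g -> (forall y, 0 <= g y)%E ->
  (\int[image_measure m mf]_y g y = \int[m]_x g (f x))%E.
Proof.
move=> mg g0; rewrite [LHS](ge0_integral_pushforward mf)//.
Qed.

(** Substitution [s = h u] in an integral over an interval [D], for an increasing
    differentiable bijection [h] from R onto [D] with inverse [theta]. *)
Section change_of_variables.
Context (R : realType).
Local Notation mu := (@lebesgue_measure R).
Local Notation rT := (measurableTypeR R).
Variables (h theta h' : R -> R) (D : set R).
Hypotheses (mD : measurable (D : set rT)) (iD : is_interval D).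
Hypotheses (hh' : forall u : R, is_derive u 1 h (h' u)) (ch' : continuous h').
Hypotheses (h'0 : forall u, 0 <= h' u) (lth : {mono h : x y / x < y}).
Hypotheses (mtheta : measurable_fun [set: rT] (theta : rT -> rT)).
Hypotheses (thetaK : forall s, D s -> h (theta s) = s).
Hypotheses (hK : cancel h theta) (hD : forall u, D (h u)).

Let mh' : measurable_fun [set: R] h'.
Proof. exact: continuous_measurable_fun. Qed.

Let cnth : continuous h.
Proof.
move=> u; apply: differentiable_continuous.
by apply/derivable1_diffP; have [] := hh' u.
Qed.

Let mh : measurable_fun [set: R] h.
Proof. exact: continuous_measurable_fun. Qed.

(** Both sides are measures in [A]; by the fundamental theorem of calculus they
    give ]x, y] the same finite mass [h y - h x], and such intervals determine a
    measure. *)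
Lemma lebesgue_measure_preimage_increasing (A : set rT) : measurable A ->
  mu (D `&` theta @^-1` A) = (\int[mu]_(u in A) (h' u)%:E)%E.
Proof.
pose m1 : {measure set rT -> \bar R} :=
  image_measure (mrestr mu mD) mtheta.
pose m2 : {measure set rT -> \bar R} := density_measure mu (mh' : measurable_fun [set: rT] h') h'0.
have m12 (x y : R) : x < y -> m1 `]x, y]%classic = (h y - h x)%:E.
  move=> xy.
  rewrite /m1/= /pushforward /mrestr/=.
  rewrite (_ : _ `&` _ = `]h x, h y]%classic); last first.
    apply/seteqP; split => s /=; rewrite !in_itv/=.
      move=> [/andP[xs sy] Ds]; rewrite -(thetaK Ds) lth xs/=.
      by rewrite leNgt lth -leNgt.
    move=> /andP[xs sy].
    have Ds : D s.
      by apply: (iD (hD x) (hD y)); rewrite (ltW xs).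
    split=> //; rewrite -lth thetaK// xs/= leNgt.
    by rewrite -lth thetaK// -leNgt.
  by rewrite lebesgue_measure_itv/= lte_fin lth xy.
have m21 (x y : R) : x < y -> m2 `]x, y]%classic = (h y - h x)%:E.
  move=> xy; rewrite /m2/= /density_measure.
  rewrite integral_itv_obnd_cbnd; last first.
    by apply: measurable_funTS; exact/measurable_EFinP.
  rewrite (@continuous_FTC2 _ h' h)//.
  - exact: continuous_subspaceT.
  - split; first by move=> u _; have [] := hh' u.
    + exact/cvg_at_right_filter/cnth.
    + exact/cvg_at_left_filter/cnth.
  - by move=> u _; rewrite derive1E; have [] := hh' u.
move=> mA; rewrite setIC; change (m1 A = m2 A); move: A mA.
apply: (@measure_unique _ R rT (@ocitv R) (fun n => `](- n%:R)%R, n%:R]%classic)).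
- by [].
- exact: ocitvI.
- by move=> i; exact: is_ocitv.
- apply/seteqP; split => // x _.
  have [n xn] : exists n, `|x : R| < n%:R by exists (Num.bound `|x : R|); exact: archi_boundP.
  exists n => //=; rewrite in_itv/=.
  by move: xn; rewrite ltr_norml => /andP[-> /ltW].
- move=> A /ocitvP[->|[[x y] /= xy ->]]; first by rewrite !measure0.
  by rewrite m12// m21.
- move=> n; case: (posnP n) => [->|n0]; first by rewrite oppr0 set_itv_ge ?bnd_simp ?ltxx// measure0.
  rewrite m12 ?ltry//.
  by rewrite (@lt_trans _ _ 0)// ?oppr_lt0 ltr0n.
Qed.

Lemma ge0_change_of_variables (f : R -> \bar R) :
  measurable_fun [set: R] f -> (forall x, 0 <= f x)%E ->
  (\int[mu]_(s in D) f s = \int[mu]_u (f (h u) * (h' u)%:E))%E.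
Proof.
move=> mf f0.
pose m1 : {measure set rT -> \bar R} :=
  image_measure (mrestr mu mD) mtheta.
rewrite -(@ge0_integral_density _ _ _ _ m1 h')//; last 2 first.
- by move=> A mA; rewrite -lebesgue_measure_preimage_increasing// setIC.
- exact: measurableT_comp.
rewrite ge0_integral_image_measure//; last exact: measurableT_comp.
rewrite (@ge0_integral_density _ _ _ mu (mrestr mu mD) \1_D)//; last 2 first.
- move=> A mA; rewrite integral_indic// setIC//.
- by apply: (measurableT_comp mf); exact: (measurableT_comp mh mtheta).
rewrite [LHS]integral_mkcond; apply: eq_integral => s _.
rewrite patchE indicE.
case: ifPn => [/set_mem Ds|_]; last by rewrite mule0.
by rewrite mule1/= thetaK.
Qed.

End change_of_variables.

Section scaling.
Context (R : realType).
Local Notation mu := (@lebesgue_measure R).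
Local Notation rT := (measurableTypeR R).
Local Open Scope ereal_scope.

Lemma ge0_integral_lebesgueN (f : R -> \bar R) :
  measurable_fun [set: R] f -> (forall x, 0 <= f x) ->
  \int[mu]_x f x = \int[mu]_x f (- x)%R.
Proof.
move=> mf f0.
have mN : measurable_fun [set: rT] (-%R : rT -> rT) by exact: measurable_funN.
rewrite -(ge0_integral_image_measure mu mN)//.
by apply: eq_measure_integral => //= A mA _; exact/esym/lebesgue_measureN.
Qed.

Lemma ge0_integral_lebesgueZ (s : R) (f : R -> \bar R) : s != 0%R ->
  measurable_fun [set: R] f -> (forall x, 0 <= f x) ->
  \int[mu]_x f x = `|s|%:E * \int[mu]_x f (s * x)%R.
Proof.
have pos (c : R) (g : R -> \bar R) : (0 < c)%R ->
    measurable_fun [set: R] g -> (forall x, 0 <= g x) ->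
    \int[mu]_x g x = c%:E * \int[mu]_x g (c * x)%R.
  move=> c0 mg g0.
  have dc (u : R) : is_derive u (1:R)%R ( *%R c) (cst c u).
    have := is_deriveZ c (is_derive_id u (1:R)%R).
    by move=> /is_derive_eq; apply; exact: mulr1.
  rewrite (ge0_change_of_variables (D := setT) (theta := ( *%R c^-1)) measurableT _ dc)//.
  - rewrite -ge0_integralZl//; last 2 first.
    + by apply: (measurableT_comp mg); exact: mulrl_measurable.
    + by rewrite lee_fin ltW.
    by apply: eq_integral => x _; rewrite muleC.
  - by move=> u; exact: cvg_cst.
  - by move=> u; rewrite ltW.
  - by move=> x y; rewrite ltr_pM2l.
  - by move=> x _; rewrite mulrA divff ?mul1r// gt_eqF.
move=> s0 mf f0; case: (ltrgt0P s) s0 => // s0 _; first exact: pos.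
rewrite (pos (- s)%R)//; last by rewrite oppr_gt0.
rewrite ge0_integral_lebesgueN//; last first.
  by apply: (measurableT_comp mf); exact: mulrl_measurable.
by under eq_integral do rewrite mulrNN.
Qed.

End scaling.

(** * Lebesgue measure on row vectors *)

Section rows.
Context (R : realType).
Local Notation mu := (@lebesgue_measure R).
Local Notation rT := (measurableTypeR R).

Section measurable_ops.
Context d (T : measurableType d) (n : nat).
Implicit Types (a : T -> R) (u v : T -> 'rV[R]_n).

Lemma measurable_coord v i :
  measurable_fun setT v -> measurable_fun setT (fun t => v t ord0 i).
Proof. by move=> mv; exact: (measurableT_comp (@measurable_row_coord R n i) mv). Qed.

Lemma measurable_rowZ a v : measurable_fun setT a -> measurable_fun setT v ->
  measurable_fun setT (fun t => a t *: v t).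
Proof.
move=> ma mv; apply: measurable_fun_rowP => i.
rewrite (_ : _ \o _ = fun t => a t * v t ord0 i).
  by apply: measurable_funM => //; exact: measurable_coord.
by apply/funext => t; rewrite /= /row_coord mxE.
Qed.

Lemma measurable_rowD u v : measurable_fun setT u -> measurable_fun setT v ->
  measurable_fun setT (fun t => u t + v t).
Proof.
move=> mu mv; apply: measurable_fun_rowP => i.
rewrite (_ : _ \o _ = fun t => u t ord0 i + v t ord0 i).
  by apply: measurable_funD; exact: measurable_coord.
by apply/funext => t; rewrite /= /row_coord mxE.
Qed.

Lemma measurable_enorm v : measurable_fun setT v ->
  measurable_fun setT (fun t => enorm (v t)).
Proof.
move=> mv; apply: (measurableT_comp (@measurable_sqrt R)).
apply: measurable_sum => i; apply: measurable_funX; exact: measurable_coord.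
Qed.
End measurable_ops.

Local Open Scope ereal_scope.

(** By induction on the dimension: each coordinate contributes one factor [s]. *)
Lemma ge0_integral_lebesgue_rowZ n (s : R) (f : 'rV[R]_n -> \bar R) :
  s != 0%R -> measurable_fun setT f -> (forall y, 0 <= f y) ->
  \int[lebesgue_row R n]_y f y =
  (`|s| ^+ n)%:E * \int[lebesgue_row R n]_y f (s *: y).
Proof.
move=> s0; elim: n f => [|n IH] f mf f0.
  rewrite expr0 mul1e; apply: eq_integral => y _; congr f.
  by apply/rowP => -[].
have mfs : measurable_fun setT (fun y : 'rV[R]_n.+1 => f (s *: y)).
  by apply: (measurableT_comp mf); apply: measurable_rowZ.
rewrite !ge0_integral_lebesgue_rowS//.
have consZ x y : (s *: row_cons (x, y) = row_cons (s * x, s *: y) :> 'rV[R]_n.+1)%R.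
  by apply/rowP => i; rewrite !mxE; case: (unlift ord0 i) => [j|] //=; rewrite mxE.
have mfc : measurable_fun [set: rT * 'rV[R]_n] (f \o @row_cons R n).
  exact: measurableT_comp mf (@measurable_row_cons R n).
pose F (x : R) := \int[lebesgue_row R n]_y f (row_cons (x : rT, y)).
have mF : measurable_fun [set: R] F.
  exact: (measurable_fun_fubini_tonelli_F (m2 := lebesgue_row R n) _ mfc (fun p => f0 (row_cons p))).
have F0 x : 0 <= F x by exact: integral_ge0.
rewrite (ge0_integral_lebesgueZ s0 mF F0).
rewrite exprS EFinM -muleA; congr (_ * _).
rewrite -ge0_integralZl//; last first.
- by move=> x _; exact: integral_ge0.
- have mfcs : measurable_fun [set: rT * 'rV[R]_n] ((fun y => f (s *: y)) \o @row_cons R n).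
    exact: measurableT_comp mfs (@measurable_row_cons R n).
  exact: (measurable_fun_fubini_tonelli_F (m2 := lebesgue_row R n) _ mfcs (fun p => f0 _)).
apply: eq_integral => x _.
rewrite /F IH//; last exact: (measurableT_comp mfc (measurable_pair1 _)).
by under [in RHS]eq_integral do rewrite consZ.
Qed.

End rows.

Section polar.
Context (R : realType).
Local Notation mu := (@lebesgue_measure R).
Local Notation rT := (measurableTypeR R).

Lemma measurable_natr_bool d (T : measurableType d) (b : T -> bool) :
  measurable_fun setT b -> measurable_fun setT (fun x => (b x)%:R : R).
Proof.
move=> mb; rewrite (_ : (fun _ => _) = fun x => if b x then 1 else 0 : R).
  exact: measurable_fun_ifT.
by apply/funext => x; case: (b x).
Qed.

Lemma enorm_ge0 n (x : 'rV[R]_n) : 0 <= enorm x.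
Proof. exact: sqrtr_ge0. Qed.

Lemma enormZ n (s : R) (x : 'rV[R]_n) : enorm (s *: x) = `|s| * enorm x.
Proof.
rewrite /enorm -sqrtr_sqr -sqrtrM ?sqr_ge0// mulr_sumr.
by congr Num.sqrt; apply: eq_bigr => i _; rewrite !mxE exprMn.
Qed.

Lemma enorm_eq0 n (x : 'rV[R]_n) : (enorm x == 0) = (x == 0).
Proof.
apply/eqP/eqP => [|->]; last first.
  by rewrite -(scale0r (0 : 'rV[R]_n)) enormZ normr0 mul0r.
move=> /eqP; rewrite sqrtr_eq0 => s0; apply/rowP => i; rewrite mxE.
have : \sum_i x ord0 i ^+ 2 == 0.
  by rewrite eq_le s0 sumr_ge0// => j _; exact: sqr_ge0.
rewrite psumr_eq0 => [/allP/(_ i)|j _]; last exact: sqr_ge0.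
by rewrite mem_index_enum => /(_ isT); rewrite sqrf_eq0 => /eqP.
Qed.

Lemma enorm_gt0 n (x : 'rV[R]_n) : (0 < enorm x) = (x != 0).
Proof. by rewrite lt_def enorm_ge0 andbT enorm_eq0. Qed.

Lemma sqr_enorm n (x : 'rV[R]_n) : enorm x ^+ 2 = \sum_i x ord0 i ^+ 2.
Proof. by rewrite sqr_sqrtr// sumr_ge0// => i _; exact: sqr_ge0. Qed.

Lemma measurable_row0 n : measurable [set (0 : 'rV[R]_n)].
Proof.
have -> : [set (0 : 'rV[R]_n)] = (@enorm R n) @^-1` [set 0].
  apply/seteqP; split => x /=; first by move=> ->; apply/eqP; rewrite enorm_eq0.
  by move=> /eqP; rewrite enorm_eq0 => /eqP.
rewrite -[X in measurable X]setTI.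
by apply: (@measurable_enorm R _ _ n id).
Qed.

Lemma lebesgue_row0 n : lebesgue_row R n.+1 [set 0] = 0%E.
Proof.
rewrite (_ : [set (0 : 'rV[R]_n.+1)] = [set x | forall i, [set (0:R)] (x ord0 i)]).
  by rewrite (@lebesgue_row_box R n.+1 (fun=> [set 0]))// big_ord_recl lebesgue_measure_set1 mul0e.
apply/seteqP; split => x /=; first by move=> -> i; rewrite mxE.
by move=> x0; apply/rowP => i; rewrite mxE.
Qed.

(** The James-Stein formulas are only meaningful away from the origin, which is
    Lebesgue-null in positive dimension. *)
Lemma ge0_integral_row_neq0 n (f g : 'rV[R]_n.+1 -> \bar R) :
  measurable_fun setT f -> measurable_fun setT g ->
  (forall x, 0 <= f x)%E -> (forall x, 0 <= g x)%E ->
  (forall x, x != 0 -> f x = g x) ->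
  (\int[lebesgue_row R n.+1]_x f x = \int[lebesgue_row R n.+1]_x g x)%E.
Proof.
move=> mf mg f0 g0 fg; apply: ge0_ae_eq_integral => //.
exists [set 0]; split; [exact: measurable_row0|exact: lebesgue_row0|].
move=> x /=; apply: contra_notP => /eqP x0 _; exact: fg.
Qed.

Local Open Scope ereal_scope.

(** A weight [w] with [\int_0^oo w (y / s) / s ds = 1] for [y != 0] turns an
    integral over the space into integrals over rays and replaces the surface
    measure of the sphere. With this one the integrand is
    [(s < enorm y) / enorm y]. *)
Definition polar_weight n (z : 'rV[R]_n) : R := ((1 < enorm z)%R%:R / enorm z)%R.

Lemma polar_weight_ge0 n (z : 'rV[R]_n) : (0 <= polar_weight z)%R.
Proof. by rewrite divr_ge0// enorm_ge0. Qed.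

Lemma measurable_polar_weight n : measurable_fun setT (@polar_weight n).
Proof.
apply: measurable_funM.
  apply: measurable_natr_bool; apply: measurable_fun_ltr => //.
  exact: (@measurable_enorm R _ _ n id).
apply: (measurableT_comp (@measurable_invr R)).
exact: (@measurable_enorm R _ _ n id).
Qed.

(** Insert [1 = (1 / enorm y) \int_0^(enorm y) ds], exchange the integrals and
    substitute [y = s *: z] for fixed [s]. The inner integral then runs along the
    ray of [z], where a radial map can be handled in one variable. *)
Lemma ge0_integral_polar n (F : 'rV[R]_n.+1 -> \bar R) :
  measurable_fun setT F -> (forall y, 0 <= F y) ->
  \int[lebesgue_row R n.+1]_y F y =
  \int[lebesgue_row R n.+1]_z \int[mu]_s
     ((polar_weight z * ((0 < s)%R%:R * s ^+ n))%:E * F (s *: z)).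
Proof.
move=> mF F0.
pose K (p : 'rV[R]_n.+1 * rT) : \bar R :=
  (((0 < (p.2 : R)) && ((p.2 : R) < enorm p.1))%R%:R / enorm p.1)%:E * F p.1.
have K0 p : 0 <= K p.
  by rewrite mule_ge0// lee_fin divr_ge0// enorm_ge0.
have mN : measurable_fun [set: 'rV[R]_n.+1 * rT] (fun p => enorm p.1).
  exact: measurable_enorm.
have m2 : measurable_fun [set: 'rV[R]_n.+1 * rT] (fun p => p.2 : R) by exact: measurable_snd.
have mF1 : measurable_fun [set: 'rV[R]_n.+1 * rT] (fun p => F p.1).
  exact: (measurableT_comp mF).
have mK : measurable_fun setT K.
  apply: emeasurable_funM => //; apply/measurable_EFinP; apply: measurable_funM.
    apply: measurable_natr_bool; apply: measurable_and; exact: measurable_fun_ltr.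
  exact: (measurableT_comp (@measurable_invr R)).
pose G (p : 'rV[R]_n.+1 * rT) : \bar R :=
  (polar_weight p.1 * ((0 < (p.2 : R))%R%:R * (p.2 : R) ^+ n))%:E * F ((p.2 : R) *: p.1).
have G0 p : 0 <= G p.
  rewrite mule_ge0// lee_fin; apply: mulr_ge0; first exact: polar_weight_ge0.
  by case: ltP => p2; rewrite ?mul0r// mul1r exprn_ge0// ltW.
have mG : measurable_fun setT G.
  apply: emeasurable_funM; last first.
    by apply: (measurableT_comp mF); apply: measurable_rowZ.
  apply/measurable_EFinP; apply: measurable_funM.
    exact: (measurableT_comp (@measurable_polar_weight n.+1)).
  apply: measurable_funM; last exact: measurable_funX.
  by apply: measurable_natr_bool; exact: measurable_fun_ltr.
transitivity (\int[lebesgue_row R n.+1]_y \int[mu]_s K (y, s)).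
  apply: ge0_integral_row_neq0 => //.
  - exact: (measurable_fun_fubini_tonelli_F (m2 := mu) _ mK K0).
  - by move=> x; exact: integral_ge0.
  move=> y; rewrite -enorm_gt0 => y0.
  rewrite /K/= ge0_integralZr//; last 2 first.
  - apply/measurable_EFinP; apply: measurable_funM => //.
    by apply: measurable_natr_bool; apply: measurable_and; exact: measurable_fun_ltr.
  - by move=> x _; rewrite lee_fin divr_ge0// enorm_ge0.
  rewrite (_ : \int[mu]_s _ = 1) ?mul1e//.
  under eq_integral do rewrite EFinM.
  rewrite ge0_integralZr//; last 2 first.
  - apply/measurable_EFinP.
    by apply: measurable_natr_bool; apply: measurable_and; exact: measurable_fun_ltr.
  - by rewrite lee_fin invr_ge0 ltW.
  rewrite (_ : \int[mu]_s _ = \int[mu]_s (\1_(`]0%R, (enorm y)[%classic : set rT) s)%:E); last first.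
    apply: eq_integral => s _; rewrite indicE.
    by rewrite mem_setE in_itv.
  rewrite integral_indic// setIT.
  have muI : lebesgue_measure [set` `]0%R, (enorm y)[] = (enorm y)%:E.
    by rewrite lebesgue_measure_itv/= lte_fin y0 oppr0 adde0.
  transitivity ((enorm y)%:E * (enorm y)^-1%:E).
    exact: (congr1 (fun z => z * (enorm y)^-1%:E) muI).
  by rewrite -EFinM divff// gt_eqF.
rewrite (fubini_tonelli (m1 := lebesgue_row R n.+1) (m2 := mu) K mK K0).
rewrite [RHS](fubini_tonelli (m1 := lebesgue_row R n.+1) (m2 := mu) G mG G0).
apply: eq_integral => s _.
have [s0|s0] := ltP (0:R)%R s; last first.
  rewrite !integral0_eq// => y _; rewrite /G/K/= (ltNge _ s) s0/= ?(mul0r,mulr0,mul0e)//.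
rewrite (ge0_integral_lebesgue_rowZ (lt0r_neq0 s0))//; last exact: measurable_fun_pair1.
rewrite -ge0_integralZl//; last first.
  apply: (measurableT_comp (measurable_fun_pair1 s mK)); exact: measurable_rowZ.
apply: eq_integral => z _; rewrite /G/K/= s0/= mul1r muleA -EFinM enormZ gtr0_norm//.
congr (_%:E * _); rewrite ltr_pMr// /polar_weight.
case: ltP => z1; last by rewrite !(mul0r, mulr0).
rewrite exprS invfM !mul1r; field.
by rewrite !gt_eqF// (lt_trans _ z1).
Qed.

End polar.

(** * The radial profile and its inverse branches *)

Section branch.
Context (R : realType) (b : R) (b0 : 0 < b).

Let S (c : R) : R := Num.sqrt (c ^+ 2 + 4 * b).
(** Positive solution [r] of [r - b / r = c]. For [c > 0] it is the radius of the
    outer preimage of a vector of norm [c], and at [- c] that of the inner one. *)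
Definition js_branch (c : R) : R := (c + S c) / 2.

Let Sarg (c : R) : 0 < c ^+ 2 + 4 * b.
Proof. by rewrite ltr_wpDl ?sqr_ge0// mulr_gt0. Qed.

Let S_gt0 c : 0 < S c. Proof. by rewrite sqrtr_gt0. Qed.

Let S_sqr c : S c ^+ 2 = c ^+ 2 + 4 * b. Proof. by rewrite sqr_sqrtr// ltW. Qed.

Lemma js_branch_mul c : js_branch c * js_branch (- c) = b.
Proof.
rewrite /js_branch.
have -> : S (- c) = S c by rewrite /S sqrrN.
by have := S_sqr c; lra.
Qed.

Lemma js_branch_sub c : js_branch c - js_branch (- c) = c.
Proof.
rewrite /js_branch; have -> : S (- c) = S c by rewrite /S sqrrN.
by lra.
Qed.

Let S_abs c : `|c| < S c.
Proof.
by rewrite -sqrtr_sqr ltr_sqrt// ltrDl mulr_gt0.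
Qed.

Lemma js_branch_gt0 c : 0 < js_branch c.
Proof. by have := S_abs c; rewrite ltr_norml /js_branch => /andP[]; lra. Qed.

(** From the two symmetric functions: the branches at [c] and [- c] have product
    [b] and difference [c]. *)
Lemma js_branchK c : js_branch c - b / js_branch c = c.
Proof.
rewrite -[X in X / _](js_branch_mul c) mulrAC divff ?mul1r ?gt_eqF ?js_branch_gt0//.
exact: js_branch_sub.
Qed.

Lemma js_branch_inv s : 0 < s -> js_branch (s - b / s) = s.
Proof.
move=> s0; rewrite /js_branch (_ : S _ = s + b / s); first by lra.
have sb : 0 <= s + b / s by rewrite addr_ge0// ?divr_ge0// ltW.
rewrite /S -[RHS](ger0_norm sb) -sqrtr_sqr; congr Num.sqrt; field; rewrite ?lt0r_neq0//.
Qed.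

(** It is a right inverse of the map [r |-> r - b / r], increasing on [r > 0]. *)
Lemma js_branch_mono : {mono js_branch : x y / x < y}.
Proof.
apply: leW_mono; apply: le_mono => x y xy.
rewrite ltNge; apply/negP => yx.
have := js_branchK x; have := js_branchK y; have := js_branch_gt0 y.
set r := js_branch x in yx *; set q := js_branch y in yx *; move=> q0 Eq Er.
have : b / r <= b / q by rewrite ler_pM2l// lef_pV2 ?posrE// js_branch_gt0.
by move=> ?; lra.
Qed.

Definition js_dbranch (c : R) : R := js_branch c / S c.

Lemma is_derive_js_branch (c : R) : is_derive c 1 js_branch (js_dbranch c).
Proof.
have dq : is_derive c 1 (fun x : R => x ^+ 2 + 4 * b) (2 * c).
  by apply: is_derive_eq; rewrite /GRing.scale/=; ring.
have dS : is_derive c 1 S (c / S c).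
  have := @is_derive1_comp _ Num.sqrt (fun x : R => x ^+ 2 + 4 * b) c _ _ (is_derive1_sqrt (Sarg c)) dq.
  move=> /is_derive_eq; apply.
  rewrite -/(S c); field; by rewrite gt_eqF.
have := is_deriveZ 2^-1 (is_deriveD (is_derive_id c 1) dS).
rewrite (_ : _ \*: _ = js_branch); last first.
  by apply/funext => x; rewrite /js_branch mulrC.
move=> /is_derive_eq; apply; rewrite /GRing.scale/= /js_dbranch /js_branch.
by field; rewrite gt_eqF.
Qed.

Lemma continuous_js_dbranch : continuous js_dbranch.
Proof.
move=> c.
have cb x : {for x, continuous js_branch}.
  apply: differentiable_continuous; apply/derivable1_diffP.
  by have [] := is_derive_js_branch x.
apply: continuousM; first exact: cb.
apply: continuousV; first by rewrite gt_eqF.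
apply: continuous_comp; last exact: sqrt_continuous.
apply: cvgD; last exact: cvg_cst.
by apply: exprn_continuous.
Qed.

(** The inverse function rule for [r |-> r - b / r], whose derivative is
    [1 + b / r ^ 2]. *)
Lemma js_dbranchE c : js_dbranch c = (1 + b / js_branch c ^+ 2)^-1.
Proof.
rewrite /js_dbranch.
have r0 := js_branch_gt0 c; have rE := js_branchK c.
have -> : S c = js_branch c + b / js_branch c.
  have E2 : js_branch c = (c + S c) / 2 by [].
  by lra.
set r := js_branch c in r0 *. field.
by rewrite gt_eqF// gt_eqF// addr_gt0// exprn_gt0.
Qed.

Lemma js_dbranch_ge0 c : 0 <= js_dbranch c.
Proof. by rewrite divr_ge0// ltW// js_branch_gt0. Qed.

End branch.

(** * Change of variables over the two branches *)

Lemma measurable_funVr (R : realType) d (T : measurableType d) (f : T -> R) :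
  measurable_fun setT f -> measurable_fun setT (fun x => (f x)^-1).
Proof. exact: (measurableT_comp (@measurable_invr R)). Qed.

Section js_change_of_variables.
Context (R : realType) (n : nat).
Hypothesis n2 : (2 <= n)%N.
Local Notation mu := (@lebesgue_measure R).
Local Notation rT := (measurableTypeR R).
Local Notation b := (n.+1%:R - 2 : R).
Local Notation r := (js_branch b).

Let b0 : 0 < b. Proof. by rewrite subr_gt0 ltr_nat. Qed.

(** The two inverse branches at once: [e = 1] gives the outer preimage and
    [e = -1] the inner one, because the radius [r2] at [c] is [r (- c)]. *)
Definition js_preim (e : R) (t : 'rV[R]_n.+1) : 'rV[R]_n.+1 :=
  (e * r (e * enorm t) / enorm t) *: t.

(** Absolute Jacobian determinant of [js_preim e]: James-Stein is radial, with
    derivative [js_drho] in the radial direction and dilation [c / r] in each of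
    the [n] tangential directions of R^(n+1). *)
Definition js_jac (e : R) (t : 'rV[R]_n.+1) : R :=
  (js_drho n.+1 (r (e * enorm t)) * (enorm t / r (e * enorm t)) ^+ n)^-1.

Lemma measurable_js_branch : measurable_fun [set: R] r.
Proof.
apply: continuous_measurable_fun => c.
apply: differentiable_continuous; apply/derivable1_diffP.
by have [] := is_derive_js_branch b0 c.
Qed.

Let measurable_r_enorm e d (T : measurableType d) (v : T -> 'rV[R]_n.+1) :
  measurable_fun setT v -> measurable_fun setT (fun x => r (e * enorm (v x))).
Proof.
move=> mv; apply: (measurableT_comp measurable_js_branch).
by apply: measurable_funM => //; exact: measurable_enorm.
Qed.

Lemma measurable_js_preim e : measurable_fun setT (js_preim e).
Proof.
apply: measurable_rowZ => //; apply: measurable_funM.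
  by apply: measurable_funM => //; exact: (@measurable_r_enorm _ _ _ id).
by apply: (measurableT_comp (@measurable_invr R)); exact: (@measurable_enorm R _ _ _ id).
Qed.

Lemma measurable_js_jac e : measurable_fun setT (js_jac e).
Proof.
have mr := @measurable_r_enorm e _ _ id (@measurable_id _ _ _).
apply: measurable_funVr; apply: measurable_funM.
  apply: measurable_funD => //; apply: measurable_funM => //.
  by apply: measurable_funVr; exact: measurable_funX.
apply: measurable_funX; apply: measurable_funM; last exact: measurable_funVr.
exact: (@measurable_enorm R _ _ _ id).
Qed.

Lemma js_jac_ge0 e t : 0 <= js_jac e t.
Proof.
have r0 := js_branch_gt0 b0 (e * enorm t).
rewrite invr_ge0 mulr_ge0//; last first.
  by rewrite exprn_ge0//; apply: divr_ge0; [exact: enorm_ge0|exact: ltW].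
by rewrite addr_ge0// divr_ge0 ?sqr_ge0// ltW.
Qed.

Local Open Scope ereal_scope.

(* After y = s *: z, the substitution s = phi e (z, u) with u > 0 makes the
   James-Stein image of y equal to (e * u) *: z. H collects the polar weight,
   the power s ^+ n and the derivative of s in u, up to the sign of e. *)
Let H (e : R) (p : 'rV[R]_n.+1 * rT) : R :=
  let c := (e * ((p.2 : R) * enorm p.1))%R in
  (polar_weight p.1 * ((r c / enorm p.1) ^+ n * js_dbranch b c))%R.

Let phi (e : R) (p : 'rV[R]_n.+1 * rT) : R :=
  (r (e * ((p.2 : R) * enorm p.1)) / enorm p.1)%R.

Let H0 e p : (0 <= H e p)%R.
Proof.
rewrite mulr_ge0 ?polar_weight_ge0// mulr_ge0 ?js_dbranch_ge0//.
rewrite exprn_ge0//; apply: divr_ge0; last exact: enorm_ge0.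
by rewrite ltW// js_branch_gt0.
Qed.

Let measurable_phi e : measurable_fun setT (phi e).
Proof.
apply: measurable_funM.
  apply: (measurableT_comp measurable_js_branch).
  do 2 apply: measurable_funM => //; exact: measurable_enorm.
by apply: (measurableT_comp (@measurable_invr R)); exact: measurable_enorm.
Qed.

Let measurable_H e : measurable_fun setT (H e).
Proof.
apply: measurable_funM.
  exact: (measurableT_comp (@measurable_polar_weight R n.+1)).
apply: measurable_funM; first by apply: measurable_funX; exact: measurable_phi.
have mc : measurable_fun [set: R] (js_dbranch b).
  by apply: continuous_measurable_fun; exact: continuous_js_dbranch.
apply: (measurableT_comp mc).
do 2 apply: measurable_funM => //; exact: measurable_enorm.
Qed.

Variable F : 'rV[R]_n.+1 -> \bar R.
Hypotheses (mF : measurable_fun setT F) (F0 : forall y, 0 <= F y).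

Let K (e : R) (p : 'rV[R]_n.+1 * rT) : \bar R :=
  ((0 < (p.2 : R))%R%:R * H e p)%:E * F (phi e p *: p.1).

Let K0 e p : 0 <= K e p.
Proof. by rewrite mule_ge0// lee_fin mulr_ge0. Qed.

Let mK e : measurable_fun setT (K e).
Proof.
apply: emeasurable_funM.
  apply/measurable_EFinP; apply: measurable_funM; last exact: measurable_H.
  by apply: measurable_natr_bool; exact: measurable_fun_ltr.
by apply: (measurableT_comp mF); apply: measurable_rowZ => //; exact: measurable_phi.
Qed.

Let mIK e : measurable_fun setT (fun z => \int[mu]_u K e (z, u)).
Proof.
exact: (measurable_fun_fubini_tonelli_F (m2 := mu) _ (mK e) (K0 e)).
Qed.

Let IK0 e z : 0 <= \int[mu]_u K e (z, u).
Proof. exact: integral_ge0. Qed.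

(** One branch in polar coordinates. The reflection [t |-> e *: t] is applied
    first so that both branches are parametrised by the ray of [z] itself. *)
Lemma ge0_integral_js_preim (e : R) : `|e|%R = 1%R ->
  \int[lebesgue_row R n.+1]_t (F (js_preim e t) * (js_jac e t)%:E) =
  \int[lebesgue_row R n.+1]_z \int[mu]_u K e (z, u).
Proof.
move=> e1.
have en0 : e != 0%R by rewrite -normr_eq0 e1 oner_eq0.
rewrite [RHS](ge0_integral_lebesgue_rowZ en0)// e1 expr1n mul1e.
rewrite ge0_integral_polar; last 2 first.
- apply: emeasurable_funM; last by apply/measurable_EFinP; exact: measurable_js_jac.
  exact: (measurableT_comp mF (measurable_js_preim e)).
- by move=> t; rewrite mule_ge0// lee_fin js_jac_ge0.
apply: eq_integral => z _; apply: eq_integral => u _.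
rewrite /K/H/phi/= /polar_weight (enormZ e) e1 mul1r scalerA [X in F (X *: z)]mulrC.
case: (ltP (0 : R)%R u) => u0; last by rewrite !(mul0r, mulr0) !mul0e.
rewrite !mul1r.
case: (ltP 1%R (enorm z)) => z1; last by rewrite !(mul0r, mulr0) !mul0e.
have z0 : (0 < enorm z)%R by rewrite (lt_trans _ z1).
rewrite /js_preim /js_jac enormZ gtr0_norm// scalerA.
set c := (e * (u * enorm z))%R.
have r0 := js_branch_gt0 b0 c.
rewrite (_ : (_ / (u * enorm z) * u = e * (r c / enorm z))%R); last first.
  by field; rewrite !gt_eqF.
rewrite [F _ * _]muleC muleA -EFinM; congr (_%:E * _).
rewrite (js_dbranchE b0) /js_drho -/c.
move: (r c) r0 => rc r0.
have d0 : (0 < 1 + b / rc ^+ 2)%R by rewrite addr_gt0// divr_gt0// exprn_gt0.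
move: (1 + _)%R d0 => d d0.
rewrite !expr_div_n !exprMn; field.
by rewrite ?expf_neq0 ?gt_eqF.
Qed.

(** Folding the line onto the half line: this is what splits the full range of the
    radial variable into the two branches. *)
Lemma ge0_integral_signs (G : R -> \bar R) :
  measurable_fun [set: R] G -> (forall u, 0 <= G u) ->
  \int[mu]_u G u =
  \int[mu]_u ((0 < u)%R%:R%:E * G u + (0 < u)%R%:R%:E * G (- u)%R).
Proof.
move=> mG G0.
have mpos : measurable_fun [set: R] (fun u => (0 < u)%R%:R%:E : \bar R).
  apply/measurable_EFinP; apply: measurable_natr_bool; exact: measurable_fun_ltr.
have mneg : measurable_fun [set: R] (fun u => (u < 0)%R%:R%:E : \bar R).
  apply/measurable_EFinP; apply: measurable_natr_bool; exact: measurable_fun_ltr.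
have mGN : measurable_fun [set: R] (fun u => G (- u)%R).
  by apply: (measurableT_comp mG); exact: measurable_funN.
have mGp := emeasurable_funM mpos mG.
have mGn := emeasurable_funM mneg mG.
have mGNp := emeasurable_funM mpos mGN.
have p0 (c : bool) x : 0 <= (c%:R)%:E * G x by rewrite mule_ge0// lee_fin.
rewrite ge0_integralD//.
have -> : \int[mu]_u ((0 < u)%R%:R%:E * G (- u)%R) = \int[mu]_u ((u < 0)%R%:R%:E * G u).
  rewrite [RHS]ge0_integral_lebesgueN//.
  by apply: eq_integral => u _; rewrite oppr_lt0.
rewrite -ge0_integralD//.
apply: ge0_ae_eq_integral => //.
- exact: emeasurable_funD.
- by move=> u _; rewrite adde_ge0.
exists [set 0%R]; split => //; first exact: lebesgue_measure_set1.
move=> u /=; apply: contra_notP => u0 _.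
by case: (ltgtP u 0%R) u0 => // _ _; rewrite ?mul0e mul1e ?add0e ?adde0.
Qed.

(** Substitute [s = r (u * N) / N], an increasing bijection from R onto the
    positive half line, and fold at [u = 0]: [u > 0] parametrises the part of the
    ray outside the critical sphere, [u < 0] the part inside. *)
Lemma radial_substitution (z : 'rV[R]_n.+1) : (0 < enorm z)%R ->
  \int[mu]_s ((polar_weight z * ((0 < s)%R%:R * s ^+ n))%:E * F (s *: z)) =
  \int[mu]_u (((0 < u)%R%:R * H 1 (z, u))%R%:E * F (phi 1 (z, u) *: z) +
              ((0 < u)%R%:R * H (- 1) (z, u))%R%:E * F (phi (- 1) (z, u) *: z)).
Proof.
move=> z0; have zn0 := lt0r_neq0 z0.
pose N := enorm z; pose h (u : R) : R := (r (u * N) / N)%R.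
pose theta (s : R) : R := ((s * N - b / (s * N)) / N)%R.
pose f (s : R) : \bar R := (polar_weight z * `|s| ^+ n)%:E * F (s *: z).
have f0 s : 0 <= f s.
  by rewrite mule_ge0// lee_fin mulr_ge0// ?exprn_ge0// polar_weight_ge0.
have mf : measurable_fun [set: R] f.
  apply: emeasurable_funM; last by apply: (measurableT_comp mF); exact: measurable_rowZ.
  apply/measurable_EFinP; apply: measurable_funM => //.
  by apply: measurable_funX; exact: (measurableT_comp (@normr_measurable R setT)).
transitivity (\int[mu]_(s in `]0%R, +oo[%classic) f s).
  rewrite [RHS]integral_mkcond; apply: eq_integral => s _; rewrite patchE.
  rewrite mem_setE in_itv/= andbT /f.
  case: ltP => s0; last by rewrite mul0r mulr0 mul0e.
  by rewrite mul1r ger0_norm// ltW.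
have h_gt0 u : (0 < h u)%R by rewrite divr_gt0// js_branch_gt0.
have dl (u : R) : is_derive u (1:R)%R (fun x : R => x * N)%R N.
  by apply: is_derive_eq; rewrite /GRing.scale/=; ring.
have dh (u : R) : is_derive u (1:R)%R h (js_dbranch b (u * N)).
  have := @is_derive1_comp _ r (fun x => x * N)%R u _ _ (is_derive_js_branch b0 (u * N)) (dl u).
  move=> /(is_deriveZ N^-1%R); rewrite (_ : _ \*: _ = h); last first.
    by apply/funext => x; rewrite /h mulrC.
  by move=> /is_derive_eq; apply; rewrite /GRing.scale/= mulrC mulfK.
have ch : continuous (fun u : R => js_dbranch b (u * N)).
  move=> u.
  change {for u, continuous (js_dbranch b \o (fun x : R => x * N)%R)}.
  apply: continuous_comp; last exact: continuous_js_dbranch.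
  apply: differentiable_continuous; apply/derivable1_diffP.
  by have [] := dl u.
have mh : {mono h : x y / x < y}%R.
  by move=> x y; rewrite /h ltr_pM2r ?invr_gt0// js_branch_mono// ltr_pM2r.
have mtheta : measurable_fun [set: R] theta.
  apply: measurable_funM => //; apply: measurable_funB.
    exact: measurable_funM.
  apply: measurable_funM => //; apply: measurable_funVr; exact: measurable_funM.
rewrite (ge0_change_of_variables (theta := theta) _ _ dh)//; last 4 first.
- exact: interval_is_interval.
- by move=> u; exact: js_dbranch_ge0.
- move=> s; rewrite /= in_itv/= andbT => s0.
  by rewrite /h /theta mulfVK// js_branch_inv ?mulr_gt0// mulfK.
- by move=> u; rewrite /= in_itv/= andbT.
rewrite (_ : \int[mu]_u _ = \int[mu]_u ((H 1 (z, u))%:E * F (phi 1 (z, u) *: z))); last first.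
  apply: eq_integral => u _; rewrite /f muleAC -EFinM /H /phi/= mul1r.
  by rewrite gtr0_norm// -mulrA.
rewrite ge0_integral_signs//; last 2 first.
- apply: emeasurable_funM.
    apply/measurable_EFinP; exact: (measurable_fun_pair2 z (measurable_H 1)).
  apply: (measurableT_comp mF); apply: measurable_rowZ => //.
  exact: (measurable_fun_pair2 z (measurable_phi 1)).
- by move=> u; rewrite mule_ge0// lee_fin.
apply: eq_integral => u _; rewrite !muleA -!EFinM /H /phi/=.
by rewrite !(mul1r, mulN1r, mulNr).
Qed.

(** The change of variables [y |-> js y], a two-to-one map off a null set: in polar
    coordinates both sides agree ray by ray, by [radial_substitution]. *)
Lemma ge0_integral_js_branches :
  \int[lebesgue_row R n.+1]_y F y =
  \int[lebesgue_row R n.+1]_t (F (js_preim 1 t) * (js_jac 1 t)%:E +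
                               F (js_preim (- 1) t) * (js_jac (- 1) t)%:E).
Proof.
have mpj e : measurable_fun setT (fun t => F (js_preim e t) * (js_jac e t)%:E).
  apply: emeasurable_funM; last by apply/measurable_EFinP; exact: measurable_js_jac.
  exact: (measurableT_comp mF (measurable_js_preim e)).
have pj0 e t : 0 <= F (js_preim e t) * (js_jac e t)%:E.
  by rewrite mule_ge0// lee_fin js_jac_ge0.
rewrite ge0_integralD//.
rewrite !ge0_integral_js_preim ?normrN ?normr1//.
rewrite ge0_integral_polar//.
rewrite -ge0_integralD//.
apply: eq_integral => z _.
have [z1|z1] := ltP 1%R (enorm z); last first.
  have w0 : polar_weight z = 0%R by rewrite /polar_weight ltNge z1 mul0r.
  by rewrite !integral0_eq ?adde0// => u _; rewrite ?/K/= ?/H/= w0 !(mul0r,mulr0)// mul0e.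
have z0 : (0 < enorm z)%R by rewrite (lt_trans _ z1).
rewrite radial_substitution// -ge0_integralD//.
- exact: measurable_fun_pair2 (mK 1).
- exact: measurable_fun_pair2 (mK (- 1)%R).
Qed.

End js_change_of_variables.

(** * Moments of the normal law *)

Section normal_moments.
Context (R : realType).
Local Notation mu := (@lebesgue_measure R).
Local Notation rT := (measurableTypeR R).
Local Notation p := (@normal_pdf R 0 1).

Let pE u : p u = normal_peak 1 * expR (- (u ^+ 2 / 2)).
Proof.
by rewrite normal_pdfE ?oner_eq0// /normal_fun subr0 expr1n mulNr.
Qed.

Let p_even u : p (- u) = p u. Proof. by rewrite !pE sqrrN. Qed.

Let mp : measurable_fun [set: R] p. Proof. exact: measurable_normal_pdf. Qed.

Let dp (u : R) : is_derive u 1 p (- (u * p u)).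
Proof.
have dq : is_derive u (1 : R) (fun x : R => - (x ^+ 2 / 2)) (- u).
  by apply: is_derive_eq; rewrite /GRing.scale/=; field.
have := @is_derive1_comp _ expR _ u _ _ (is_derive_expR _) dq.
move=> /(is_deriveZ (normal_peak 1)).
rewrite (_ : _ \*: _ = p); last by apply/funext => x; rewrite pE.
by move=> /is_derive_eq; apply; rewrite /GRing.scale/= pE; ring.
Qed.

Let cp : continuous p.
Proof. by apply: continuous_normal_pdf; rewrite oner_eq0. Qed.

Let p_cvg0 : p x @[x --> +oo%R] --> 0.
Proof.
have -> : p = fun x => normal_peak 1 * expR (- (x ^+ 2 / 2)).
  by apply/funext => x; rewrite pE.
suff : normal_peak 1 * expR (- (x ^+ 2 / 2)) @[x --> +oo%R] --> normal_peak 1 * (0 : R).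
  by rewrite mulr0.
apply: cvgM; first exact: cvg_cst.
apply: (@squeeze_cvgr _ _ _ _ (cst 0) (fun x => expR (- x))).
- near=> x; rewrite expR_ge0/= ler_expR lerN2.
  have x2 : 2 <= x by near: x; exact: nbhs_pinfty_ge.
  by nra.
- exact: cvg_cst.
- exact: cvgr_expR.
Unshelve. all: by end_near. Qed.

Local Open Scope ereal_scope.

Let tail (t : R) : (0 <= t)%R -> \int[mu]_(u in `[t, +oo[) (u * p u)%:E = (p t)%:E.
Proof.
move=> t0; rewrite (@ge0_continuous_FTC2y _ _ (fun u => - p u)%R _ 0%R).
- by rewrite -EFinB sub0r opprK.
- by move=> x tx; rewrite mulr_ge0 ?normal_pdf_ge0// (le_trans t0).
- apply: continuous_subspaceT => x; apply: continuousM; [exact: cvg_id|exact: cp].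
- have : (- p x)%R @[x --> +oo%R] --> (- (0 : R))%R by apply: cvgN; exact: p_cvg0.
  by rewrite oppr0.
- by move=> x _; apply: derivableN; have [] := dp x.
- by apply: cvgN; apply: cvg_at_right_filter; exact: cp.
- move=> x _; rewrite derive1E deriveN; last by have [] := dp x.
  by have [_ ->] := dp x; rewrite opprK.
Qed.

(** Write [u ^ 2 = u \int_0^u dt] for [u > 0] and exchange the integrals: the inner
    integral of [u * p u] over [u > t] is [p t], because [p] has derivative
    [- u * p u]; what is left is the total mass of [p]. *)
Lemma normal_pdf_second_moment : \int[mu]_u (u ^+ 2 * p u)%:E = 1.
Proof.
have mpos : measurable_fun [set: R] (fun u => (0 < u)%R%:R : R).
  by apply: measurable_natr_bool; exact: measurable_fun_ltr.
have half (G : R -> R) : measurable_fun setT G -> (forall u, 0 <= G u)%R ->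
    (forall u, G (- u)%R = G u) ->
    \int[mu]_u (G u)%:E = 2%:E * \int[mu]_u ((0 < u)%R%:R * G u)%:E.
  move=> mG G0 GN; rewrite ge0_integral_signs//; last exact/measurable_EFinP.
  rewrite -ge0_integralZl//; last 2 first.
  - by apply/measurable_EFinP; exact: measurable_funM.
  - by move=> u _; rewrite lee_fin mulr_ge0.
  apply: eq_integral => u _; rewrite GN -!EFinM -EFinD.
  by congr EFin; ring.
rewrite -(integral_normal_pdf 0 1) half//; last 3 first.
- by apply: measurable_funM => //; exact: measurable_funX.
- by move=> u; rewrite mulr_ge0 ?sqr_ge0 ?normal_pdf_ge0.
- by move=> u; rewrite sqrrN p_even.
rewrite [RHS](half p)//; last by move=> u; exact: normal_pdf_ge0.
congr (_ * _).
pose K (q : rT * rT) : \bar R :=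
  (((0 < (q.2 : R)) && ((q.2 : R) < (q.1 : R)))%R%:R * ((q.1 : R) * p (q.1 : R)))%:E.
have m1 : measurable_fun [set: rT * rT] (fun q => q.1 : R) by exact: measurable_fst.
have m2 : measurable_fun [set: rT * rT] (fun q => q.2 : R) by exact: measurable_snd.
have K0 q : 0 <= K q.
  rewrite lee_fin /K; case: ltP => //= q2; last by rewrite mul0r.
  case: ltP => //= q1; last by rewrite mul0r.
  by rewrite !mulr_ge0 ?normal_pdf_ge0// ltW// (lt_trans q2).
have mK : measurable_fun setT K.
  apply/measurable_EFinP; apply: measurable_funM.
    by apply: measurable_natr_bool; apply: measurable_and; exact: measurable_fun_ltr.
  by apply: measurable_funM => //; exact: (measurableT_comp mp m1).
have mup : measurable_fun [set: R] (fun u : R => (u * p u)%:E).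
  by apply/measurable_EFinP; exact: measurable_funM.
transitivity (\int[mu]_u \int[mu]_t K (u, t)).
  apply: eq_integral => u _.
  have [u0|u0] := ltP (0 : R)%R u; last first.
    rewrite mul0r integral0_eq// => t _; rewrite /K/=.
    by case: ltP => //= t0; rewrite ?mul0r// ltNge (le_trans u0 (ltW t0))/= mul0r.
  transitivity (\int[mu]_t ((\1_(`]0%R, (u : R)[%classic : set rT) t)%:E * (u * p u)%:E)).
    rewrite ge0_integralZr//; last 2 first.
    - apply/measurable_EFinP; exact: measurable_indic.
    - by rewrite lee_fin mulr_ge0 ?normal_pdf_ge0// ltW.
    rewrite integral_indic// setIT mul1r expr2 -mulrA EFinM.
    apply: esym; apply: (congr1 (fun z => z * (u * p u)%:E)).
    have -> : u%:E = lebesgue_measure [set` `]0%R, (u : R)[] :> \bar R.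
      by rewrite lebesgue_measure_itv/= lte_fin u0 oppr0 adde0.
    by [].
  apply: eq_integral => t _; rewrite -EFinM indicE /K/=.
  by rewrite mem_setE in_itv.
rewrite (fubini_tonelli (m1 := mu) (m2 := mu) K mK K0).
apply: eq_integral => t _.
have [t0|t0] := ltP (0 : R)%R t; last first.
  by rewrite mul0r integral0_eq// => u _; rewrite /K/= ltNge t0/= mul0r.
rewrite mul1r -(tail (ltW t0)) -integral_itv_obnd_cbnd; last exact: measurable_funTS.
rewrite [RHS]integral_mkcond; apply: eq_integral => u _.
rewrite /K/= t0/= patchE mem_setE in_itv/= andbT.
by case: ltP; rewrite ?mul1r ?mul0r.
Qed.

End normal_moments.

Section gauss_moments.
Context (R : realType).
Local Notation mu := (@lebesgue_measure R).
Local Notation rT := (measurableTypeR R).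
Local Notation p := (@normal_pdf R 0 1).
Local Open Scope ereal_scope.

Lemma ge0_integral_lebesgueD (m : R) (f : R -> \bar R) :
  measurable_fun [set: R] f -> (forall x, 0 <= f x) ->
  \int[mu]_x f x = \int[mu]_x f (x + m)%R.
Proof.
move=> mf f0.
have dm (u : R) : is_derive u (1:R)%R (fun x : R => x + m)%R (cst 1%R u).
  by apply: is_derive_eq; rewrite addr0.
rewrite (ge0_change_of_variables (D := setT) (theta := fun x => x - m)%R _ _ dm)//.
- by apply: eq_integral => x _; rewrite mule1.
- by move=> u; exact: cvg_cst.
- by move=> x y; rewrite ltrD2r.
- exact: measurable_funB.
- by move=> s _; rewrite subrK.
Qed.

Lemma ge0_integral_normal_pdf (m : R) (f : R -> R) :
  measurable_fun [set: R] f -> (forall x, 0 <= f x)%R ->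
  \int[mu]_x (f (x - m) * normal_pdf m 1 x)%:E = \int[mu]_u (f u * p u)%:E.
Proof.
move=> mf f0; rewrite (@ge0_integral_lebesgueD m).
- apply: eq_integral => u _; rewrite addrK; congr (_ * _)%:E.
  by rewrite !normal_pdfE ?oner_eq0// /normal_fun addrK subr0.
- apply/measurable_EFinP; apply: measurable_funM; last exact: measurable_normal_pdf.
  by apply: (measurableT_comp mf); exact: measurable_funB.
- by move=> x; rewrite lee_fin mulr_ge0 ?normal_pdf_ge0.
Qed.

Lemma ge0_integral_lebesgue_row_prod n (f : 'I_n -> R -> R) :
  (forall i, measurable_fun [set: R] (f i)) -> (forall i x, 0 <= f i x)%R ->
  \int[lebesgue_row R n]_y (\prod_i f i (y ord0 i))%:E =
  \prod_i \int[mu]_x (f i x)%:E.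
Proof.
elim: n f => [|n IH] f mf f0.
  rewrite big_ord0 [LHS]integral_dirac//.
    by rewrite diracT mul1e big_ord0.
  by apply/measurable_EFinP; rewrite (_ : (fun _ => _) = cst 1%R)//; apply/funext => y; rewrite big_ord0.
have mprod m (g : 'I_m -> R -> R) : (forall i, measurable_fun [set: R] (g i)) ->
    measurable_fun [set: 'rV[R]_m] (fun y => (\prod_i g i (y ord0 i))%:E).
  move=> mg; apply/measurable_EFinP; apply: measurable_prod => i _.
  by apply: (measurableT_comp (mg i)); exact: measurable_row_coord.
rewrite ge0_integral_lebesgue_rowS; last 2 first.
- exact: mprod.
- by move=> x; rewrite lee_fin prodr_ge0.
rewrite big_ord_recl -ge0_integralZr//; last 3 first.
- by apply/measurable_EFinP; exact: mf.
- by move=> x _; rewrite lee_fin.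
- by apply: prode_ge0 => i _; apply: integral_ge0 => x _; rewrite lee_fin.
apply: eq_integral => x _.
rewrite -IH// -ge0_integralZl//; last 3 first.
- exact: (mprod n (fun i => f (lift ord0 i)) (fun i => mf _)).
- by move=> y _; rewrite lee_fin prodr_ge0.
- by rewrite lee_fin.
apply: eq_integral => y _; rewrite -EFinM; congr EFin.
rewrite big_ord_recl /row_cons !mxE unlift_none/=; congr (_ * _)%R.
by apply: eq_bigr => i _; rewrite !mxE liftK.
Qed.

Lemma ge0_integral_gauss n (m : 'rV[R]_n) (F : 'rV[R]_n -> \bar R) :
  measurable_fun setT F -> (forall y, 0 <= F y) ->
  \int[gauss_row m]_y F y = \int[lebesgue_row R n]_y (F y * (gauss_pdf m y)%:E).
Proof.
apply: (@ge0_integral_density _ _ R (lebesgue_row R n) (gauss_row m) (gauss_pdf m)) => //.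
- exact: measurable_gauss_pdf.
- exact: gauss_pdf_ge0.
Qed.

(** Independence of the coordinates, in product form. *)
Lemma ge0_integral_gauss_prod n (m : 'rV[R]_n) (f : 'I_n -> R -> R) :
  (forall i, measurable_fun [set: R] (f i)) -> (forall i x, 0 <= f i x)%R ->
  \int[gauss_row m]_y (\prod_i f i ((y - m) ord0 i))%:E =
  \prod_i \int[mu]_u (f i u * p u)%:E.
Proof.
move=> mf f0; rewrite ge0_integral_gauss; last 2 first.
- apply/measurable_EFinP; apply: measurable_prod => i _.
  apply: (measurableT_comp (mf i)); apply: measurable_coord.
  exact: measurable_rowD.
- by move=> y; rewrite lee_fin prodr_ge0.
transitivity (\int[lebesgue_row R n]_y
    (\prod_i (f i (y ord0 i - m ord0 i) * normal_pdf (m ord0 i) 1 (y ord0 i)))%:E).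
  apply: eq_integral => y _; rewrite gauss_pdfE -EFinM -big_split/=.
  by congr EFin; apply: eq_bigr => i _; rewrite !mxE.
rewrite (ge0_integral_lebesgue_row_prod
  (f := fun i x => f i (x - m ord0 i) * normal_pdf (m ord0 i) 1 x)%R); last 2 first.
- move=> i; apply: measurable_funM; last exact: measurable_normal_pdf.
  by apply: (measurableT_comp (mf i)); exact: measurable_funB.
- by move=> i x; rewrite mulr_ge0 ?normal_pdf_ge0.
by apply: eq_bigr => i _; exact: ge0_integral_normal_pdf.
Qed.

End gauss_moments.

Section real_expectation.
Context d (T : measurableType d) (R : realType) (P : probability T R).
Implicit Types X Y : T -> R.

(** Meaningful on integrable variables: an infinite expectation is sent to zero. *)
Definition rexp X : R := fine 'E_P[X].

Lemma rexpE X : X \in Lfun P 1 -> 'E_P[X]%E = (rexp X)%:E.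
Proof. by move=> X1; rewrite /rexp fineK// expectation_fin_num. Qed.

Lemma rexpD X Y : X \in Lfun P 1 -> Y \in Lfun P 1 ->
  rexp (fun w => X w + Y w) = rexp X + rexp Y.
Proof.
move=> X1 Y1; apply: EFin_inj; rewrite EFinD -!rexpE//; last exact: rpredD.
exact: expectationD.
Qed.

Lemma rexpB X Y : X \in Lfun P 1 -> Y \in Lfun P 1 ->
  rexp (fun w => X w - Y w) = rexp X - rexp Y.
Proof.
move=> X1 Y1; apply: EFin_inj; rewrite EFinB -!rexpE//; last exact: rpredB.
exact: expectationB.
Qed.

Lemma Lfun2_Lfun1 X : X \in Lfun P 2%:E -> X \in Lfun P 1.
Proof. by apply: Lfun_subset12; exact: fin_num_measure. Qed.

Lemma Lfun2_mul X Y : X \in Lfun P 2%:E -> Y \in Lfun P 2%:E ->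
  (fun w => X w * Y w) \in Lfun P 1.
Proof. exact: Lfun2_mul_Lfun1. Qed.

Lemma Lfun1_le X Y : measurable_fun setT X -> Y \in Lfun P 1 ->
  (forall w, `|X w| <= `|Y w|) -> X \in Lfun P 1.
Proof.
move=> mX /Lfun1_integrable Y1 XY; apply/Lfun1_integrable.
apply: (le_integrable measurableT _ _ Y1); first exact/measurable_EFinP.
by move=> w _ /=; rewrite lee_fin.
Qed.

Lemma Lfun2_sqr X : measurable_fun setT X ->
  (fun w => X w ^+ 2) \in Lfun P 1 -> X \in Lfun P 2%:E.
Proof.
move=> mX /Lfun1_integrable /integrableP[_] XX.
rewrite inE; apply/andP; split; rewrite inE//=.
rewrite /finite_norm unlock /Lnorm poweR_lty//.
apply: le_lt_trans XX; apply: ge0_le_integral => //=.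
- apply/measurable_EFinP; apply: (measurableT_comp (measurable_powR _)).
  exact: measurableT_comp.
- do 2 apply: measurableT_comp => //; exact: measurable_funX.
- by move=> w _; rewrite lee_fin powR_mulrn// -normrX.
Qed.

Lemma Lfun2_measurable p X : X \in Lfun P p -> measurable_fun setT X.
Proof. by rewrite inE => /andP[/[!inE]]. Qed.

Lemma Lfun1_ge0_lty X : measurable_fun setT X -> (forall w, 0 <= X w) ->
  (\int[P]_w (X w)%:E < +oo)%E -> X \in Lfun P 1.
Proof.
move=> mX X0 Xoo; apply/Lfun1_integrable/integrableP; split.
  exact/measurable_EFinP.
by under eq_integral do rewrite gee0_abs ?lee_fin//.
Qed.

End real_expectation.

Section gauss_covariance.
Context (R : realType) (n : nat) (m : 'rV[R]_n).
Local Notation P := (gauss_row m).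
Local Notation mu := (@lebesgue_measure R).
Local Notation p := (@normal_pdf R 0 1).
Local Notation X i := (fun y : 'rV[R]_n => (y - m) ord0 i).

Lemma measurable_gauss_coord i : measurable_fun setT (X i).
Proof. by apply: measurable_coord; exact: measurable_rowD. Qed.

Lemma ge0_integral_gauss_coord (f : R -> R) i :
  measurable_fun setT f -> (forall x, 0 <= f x) ->
  (\int[P]_y (f (X i y))%:E = \int[mu]_u (f u * p u)%:E)%E.
Proof.
move=> mf f0.
pose F (j : 'I_n) (u : R) : R := if j == i then f u else 1.
transitivity (\int[P]_y (\prod_j F j (X j y))%:E)%E.
  apply: eq_integral => y _; congr EFin; rewrite (bigD1 i)//= /F eqxx big1 ?mulr1//.
  by move=> j /negbTE ->.
rewrite (@ge0_integral_gauss_prod R n m F); last 2 first.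
- by move=> j; rewrite /F; case: eqP.
- by move=> j x; rewrite /F; case: eqP.
rewrite (bigD1 i)//= {1}/F eqxx big1 ?mule1// => j /negbTE ji.
under eq_integral do rewrite /F ji mul1r.
exact: integral_normal_pdf.
Qed.

Lemma ge0_integral_gauss_coord2 (f g : R -> R) i j : i != j ->
  measurable_fun setT f -> (forall x, 0 <= f x) ->
  measurable_fun setT g -> (forall x, 0 <= g x) ->
  (\int[P]_y (f (X i y) * g (X j y))%:E =
   \int[mu]_u (f u * p u)%:E * \int[mu]_u (g u * p u)%:E)%E.
Proof.
move=> ij mf f0 mg g0.
have ji : j == i = false by rewrite eq_sym; exact/negbTE.
pose F (l : 'I_n) (u : R) : R := if l == i then f u else if l == j then g u else 1.
transitivity (\int[P]_y (\prod_l F l (X l y))%:E)%E.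
  apply: eq_integral => y _; congr EFin.
  rewrite (bigD1 i)//= (bigD1 j)/= 1?eq_sym// /F eqxx ji eqxx big1 ?mulr1//.
  by move=> l /andP[/negbTE -> /negbTE ->].
rewrite (@ge0_integral_gauss_prod R n m F); last 2 first.
- by move=> l; rewrite /F; case: eqP => // _; case: eqP.
- by move=> l x; rewrite /F; case: eqP => // _; case: eqP.
rewrite (bigD1 i)//= (bigD1 j)/= 1?eq_sym// {1 2}/F eqxx ji eqxx big1 ?mule1//.
move=> l /andP[/negbTE li /negbTE lj].
under eq_integral do rewrite /F li lj mul1r.
exact: integral_normal_pdf.
Qed.

Lemma gauss_coord_sqr i : (\int[P]_y (X i y ^+ 2)%:E = 1)%E.
Proof.
rewrite (ge0_integral_gauss_coord (f := fun x => x ^+ 2))//.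
- exact: normal_pdf_second_moment.
- by move=> x; exact: sqr_ge0.
Qed.

Lemma gauss_coord_Lfun2 i : X i \in Lfun P 2%:E.
Proof.
apply: Lfun2_sqr; first exact: measurable_gauss_coord.
apply: Lfun1_ge0_lty.
- by apply: measurable_funX; exact: measurable_gauss_coord.
- by move=> w; exact: sqr_ge0.
- by rewrite gauss_coord_sqr ltry.
Qed.

(* The integration formulas are for nonnegative functions, so signed moments go
   through positive and negative parts; these have equal integrals by symmetry. *)
Let pos (x : R) : R := Num.max x 0.
Let neg (x : R) : R := Num.max (- x) 0.

Let pos_ge0 x : 0 <= pos x. Proof. by rewrite le_max lexx orbT. Qed.
Let neg_ge0 x : 0 <= neg x. Proof. by rewrite le_max lexx orbT. Qed.
Let mpos : measurable_fun setT pos. Proof. exact: measurable_maxr. Qed.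
Let mneg : measurable_fun setT neg. Proof. exact: measurable_maxr. Qed.
Let pos_neg x : pos x - neg x = x.
Proof. by rewrite /pos /neg; case: (lerP x 0); case: (lerP (- x) 0) => ? ?; lra. Qed.

Let negE : (\int[mu]_u (neg u * p u)%:E = \int[mu]_u (pos u * p u)%:E)%E.
Proof.
rewrite ge0_integral_lebesgueN.
- apply: eq_integral => u _; rewrite /neg opprK; congr (_ * _)%:E.
  by rewrite !normal_pdfE ?oner_eq0// /normal_fun !subr0 sqrrN.
- apply/measurable_EFinP; apply: measurable_funM; first exact: mneg.
  exact: measurable_normal_pdf.
- by move=> u; rewrite lee_fin mulr_ge0// ?neg_ge0// normal_pdf_ge0.
Qed.

Let Lpos i : (fun y => pos (X i y)) \in Lfun P 2%:E.
Proof.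
have mpX : measurable_fun setT (fun y => pos (X i y)).
  by apply: (measurableT_comp mpos); exact: measurable_gauss_coord.
apply: Lfun2_sqr => //.
apply: (Lfun1_le _ (Lfun2_mul (gauss_coord_Lfun2 i) (gauss_coord_Lfun2 i))).
  exact: measurable_funX.
move=> w; rewrite -expr2 !normrX ler_pXn2r ?nnegrE//.
by rewrite /pos; case: (lerP (X i w) 0); rewrite ?normr0.
Qed.

Let Lneg i : (fun y => neg (X i y)) \in Lfun P 2%:E.
Proof.
have -> : (fun y => neg (X i y)) = (fun y => pos (X i y)) \- X i.
  by apply/funext => y /=; have := pos_neg (X i y); lra.
by rewrite rpredB ?lee1n//= => _; exact: gauss_coord_Lfun2.
Qed.

Lemma rexp_gauss_coord i : rexp P (X i) = 0.
Proof.
have -> : X i = fun y => pos (X i y) - neg (X i y) by apply/funext => y; rewrite pos_neg.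
rewrite rexpB; [|exact: Lfun2_Lfun1|exact: Lfun2_Lfun1].
rewrite /rexp unlock (ge0_integral_gauss_coord _ mpos)//.
by rewrite (ge0_integral_gauss_coord _ mneg)// negE subrr.
Qed.

Lemma rexp_gauss_coord2 i j : rexp P (fun y => X i y * X j y) = (i == j)%:R.
Proof.
have [<-|ij] := eqVneq i j.
  rewrite /rexp unlock; under eq_integral do rewrite -expr2.
  by rewrite gauss_coord_sqr.
have -> : (fun y => X i y * X j y) = fun y =>
    (pos (X i y) * pos (X j y) - neg (X i y) * pos (X j y)) -
    (pos (X i y) * neg (X j y) - neg (X i y) * neg (X j y)).
  by apply/funext => y; rewrite -mulrBl -mulrBl -mulrBr !pos_neg.
have L (a b : 'I_n -> 'rV[R]_n -> R) : (forall i, a i \in Lfun P 2%:E) ->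
    (forall i, b i \in Lfun P 2%:E) -> (fun y => a i y * b j y) \in Lfun P 1.
  by move=> La Lb; exact: Lfun2_mul.
have Lpp := L _ _ Lpos Lpos; have Lnp := L _ _ Lneg Lpos.
have Lpn := L _ _ Lpos Lneg; have Lnn := L _ _ Lneg Lneg.
rewrite rexpB; [|exact: rpredB|exact: rpredB].
rewrite !rexpB// /rexp unlock.
rewrite !(ge0_integral_gauss_coord2 ij)//.
by rewrite negE !subrr.
Qed.

End gauss_covariance.

(** * The two preimages of the James-Stein statistic *)

Section js_algebra.
Context (R : realType) (n : nat).
Hypothesis n2 : (2 <= n)%N.
Local Notation b := (n.+1%:R - 2 : R).
Local Notation r := (js_branch b).
Implicit Types (t y : 'rV[R]_n.+1) (e : R).

Lemma js_b_gt0 : 0 < b. Proof. by rewrite subr_gt0 ltr_nat. Qed.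

Let r_gt0 c : 0 < r c. Proof. exact: js_branch_gt0 js_b_gt0 c. Qed.

Lemma js_r2E t : js_r2 t = r (- enorm t).
Proof. by rewrite /js_r2 /js_branch sqrrN. Qed.

Lemma js_y1E t : js_y1 t = js_preim 1 t.
Proof. by rewrite /js_y1 /js_preim !mul1r. Qed.

Lemma js_y2E t : js_y2 t = js_preim (- 1) t.
Proof. by rewrite /js_y2 js_r2E /js_preim !mulN1r mulNr. Qed.

Lemma js_w1E mu t : js_w1 mu t = gauss_pdf mu (js_preim 1 t) * js_jac 1 t.
Proof. by rewrite /js_w1 js_y1E /js_jac mul1r. Qed.

Lemma js_w2E mu t : js_w2 mu t = gauss_pdf mu (js_preim (- 1) t) * js_jac (- 1) t.
Proof. by rewrite /js_w2 js_y2E js_r2E /js_jac mulN1r. Qed.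

Lemma enorm_js_preim e t : `|e| = 1 -> t != 0 ->
  enorm (js_preim e t) = r (e * enorm t).
Proof.
move=> e1 t0; have t1 : 0 < enorm t by rewrite enorm_gt0.
rewrite /js_preim enormZ normrM normfV (gtr0_norm t1).
rewrite normrM e1 mul1r (gtr0_norm (r_gt0 _)).
by rewrite divfK ?gt_eqF.
Qed.

Lemma james_steinE y : y != 0 ->
  james_stein y = ((enorm y - b / enorm y) / enorm y) *: y.
Proof.
rewrite -enorm_gt0 => y0; rewrite /james_stein; congr (_ *: _).
by field; rewrite gt_eqF.
Qed.

Lemma js_preimK e t : `|e| = 1 -> t != 0 -> james_stein (js_preim e t) = t.
Proof.
move=> e1 t0; have t1 : 0 < enorm t by rewrite enorm_gt0.
rewrite james_steinE; last by rewrite -enorm_gt0 enorm_js_preim.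
rewrite enorm_js_preim// js_branchK ?js_b_gt0//.
rewrite /js_preim scalerA -[RHS]scale1r; congr (_ *: _).
have ee : e * e = 1 by rewrite -expr2 -(real_normK (num_real e)) e1 expr1n.
rewrite mulrACA mulrA [_ / _ * _]mulrC.
transitivity (e * e * (r (e * enorm t) / r (e * enorm t)) * (enorm t / enorm t)).
  by ring.
by rewrite ee !divff ?gt_eqF// !mulr1.
Qed.

Lemma enorm_james_stein y : y != 0 ->
  enorm (james_stein y) = `|enorm y - b / enorm y|.
Proof.
move=> y0; have y1 : 0 < enorm y by rewrite enorm_gt0.
by rewrite james_steinE// enormZ normrM normfV (gtr0_norm y1) divfK ?gt_eqF.
Qed.

Lemma james_stein0 : james_stein (0 : 'rV[R]_n.+1) = 0.
Proof. by rewrite /james_stein scaler0. Qed.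

(** In norm the equation [js y = t] reads [`|rho (enorm y)| = enorm t]. The sign of
    [rho (enorm y)] tells whether [y] points along [t] or against it, hence which
    branch it is on. *)
Lemma js_preimage t : t != 0 ->
  @james_stein R n.+1 @^-1` [set t] = [set js_y1 t; js_y2 t].
Proof.
move=> t0; apply/seteqP; split => y /=; last first.
  by move=> [->|->]; rewrite (js_y1E, js_y2E) js_preimK// ?normrN normr1.
move=> yt; have y0 : y != 0.
  by apply: contra_neq t0 => y0; rewrite -yt y0 james_stein0.
have y1 : 0 < enorm y by rewrite enorm_gt0.
have ct := enorm_james_stein y0; rewrite yt in ct.
have tE : t = ((enorm y - b / enorm y) / enorm y) *: y by rewrite -yt james_steinE.
have rE := js_branch_inv js_b_gt0 y1.
have rho0 : enorm y - b / enorm y != 0.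
  by rewrite -normr_eq0 -ct enorm_eq0.
have yE : y = (enorm y / (enorm y - b / enorm y)) *: t.
  rewrite tE scalerA -[LHS]scale1r; congr (_ *: _).
  by rewrite mulrA divfK// divff// gt_eqF.
have [rp|rn|r0] := ltgtP 0 (enorm y - b / enorm y).
- by left; rewrite js_y1E /js_preim ct gtr0_norm// !mul1r rE -yE.
- right; rewrite js_y2E /js_preim ct ltr0_norm// !mulN1r opprK rE.
  by rewrite mulNr invrN mulrN opprK -yE.
- by rewrite -r0 eqxx in rho0.
Qed.

Lemma js_branch_sqr_lt c : 0 < c -> r (- c) ^+ 2 < b < r c ^+ 2.
Proof.
move=> c0; have := js_branch_mul js_b_gt0 c; have := js_branch_sub b c.
have := r_gt0 c; have := r_gt0 (- c).
move: (r c) (r (- c)) => x z z0 x0 xz {1 2}<-.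
by rewrite !expr2 !ltr_pM2r// ltr_pM2l//; lra.
Qed.

(** The two radii are positive with product [b], and the outer one is larger. *)
Lemma js_preim_norms t : t != 0 ->
  enorm (js_y2 t) < Num.sqrt b < enorm (js_y1 t).
Proof.
move=> t0; rewrite js_y1E js_y2E !enorm_js_preim// ?normrN ?normr1// mulN1r mul1r.
have t1 : 0 < enorm t by rewrite enorm_gt0.
have /andP[h1 h2] := js_branch_sqr_lt t1.
apply/andP; split.
  by rewrite -[ltLHS]ger0_norm ?ltW// -sqrtr_sqr ltr_sqrt// js_b_gt0.
rewrite -[ltRHS]ger0_norm ?ltW// -sqrtr_sqr ltr_sqrt// exprn_gt0//.
Qed.

Lemma js_jac_gt0 e t : t != 0 -> 0 < js_jac e t.
Proof.
rewrite -enorm_gt0 => t0; rewrite invr_gt0 mulr_gt0//.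
  by rewrite /js_drho addr_gt0// divr_gt0 ?js_b_gt0// exprn_gt0.
by rewrite exprn_gt0//; apply: divr_gt0.
Qed.

Lemma gauss_pdf_gt0 k (mu y : 'rV[R]_k) : 0 < gauss_pdf mu y.
Proof. by rewrite mulr_gt0 ?expR_gt0// powR_gt0// mulr_gt0// pi_gt0. Qed.

Lemma js_w1_gt0 mu t : t != 0 -> 0 < js_w1 mu t.
Proof. by move=> t0; rewrite js_w1E mulr_gt0 ?gauss_pdf_gt0 ?js_jac_gt0. Qed.

Lemma js_w2_gt0 mu t : t != 0 -> 0 < js_w2 mu t.
Proof. by move=> t0; rewrite js_w2E mulr_gt0 ?gauss_pdf_gt0 ?js_jac_gt0. Qed.

Lemma js_pi_lt01 mu t : t != 0 -> 0 < js_pi mu t < 1.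
Proof.
move=> t0; have w1 := js_w1_gt0 mu t0; have w2 := js_w2_gt0 mu t0.
rewrite /js_pi divr_gt0 ?addr_gt0//= ltr_pdivrMr ?addr_gt0//.
by rewrite mul1r ltrDl.
Qed.

(** At the origin the convention on division by zero makes the weights, and then
    [js_pi], vanish. *)
Lemma js_pi_ge0_le1 mu t : 0 <= js_pi mu t <= 1.
Proof.
have [->|t0] := eqVneq t 0; last first.
  by have /andP[/ltW -> /ltW ->] := js_pi_lt01 mu t0.
suff -> : js_pi mu (0 : 'rV[R]_n.+1) = 0 by rewrite lexx ler01.
have en0 : enorm (0 : 'rV[R]_n.+1) = 0 by apply/eqP; rewrite enorm_eq0.
by rewrite /js_pi js_w1E /js_jac en0 mul0r expr0n gtn_eqF ?mulr0 ?invr0 ?mulr0 ?mul0r// ltnW.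
Qed.

End js_algebra.

(** * Density of the statistic and conditional expectations given it *)

Section js_conditional.
Context (R : realType) (n : nat).
Hypothesis n2 : (2 <= n)%N.
Variable m : 'rV[R]_n.+1.
Local Notation P := (gauss_row m).
Local Notation js := (@james_stein R n.+1).
Implicit Types (t y : 'rV[R]_n.+1) (F : 'rV[R]_n.+1 -> R).

Lemma measurable_js : measurable_fun setT js.
Proof.
have mid := @measurable_id _ 'rV[R]_n.+1 setT.
apply: measurable_rowZ => //; apply: measurable_funB => //.
apply: measurable_funM => //; apply: measurable_funVr; apply: measurable_funX.
exact: measurable_enorm.
Qed.

Lemma measurable_js_y1 : measurable_fun setT (@js_y1 R n.+1).
Proof.
rewrite (_ : @js_y1 R n.+1 = js_preim 1); last by apply/funext => t; rewrite js_y1E.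
exact: measurable_js_preim.
Qed.

Lemma measurable_js_y2 : measurable_fun setT (@js_y2 R n.+1).
Proof.
rewrite (_ : @js_y2 R n.+1 = js_preim (- 1)); last by apply/funext => t; rewrite js_y2E.
exact: measurable_js_preim.
Qed.

Lemma measurable_js_w1 : measurable_fun setT (js_w1 m).
Proof.
rewrite (_ : js_w1 m = fun t => gauss_pdf m (js_y1 t) * js_jac 1 t); last first.
  by apply/funext => t; rewrite js_w1E js_y1E.
apply: measurable_funM; last exact: measurable_js_jac.
exact: (measurableT_comp (measurable_gauss_pdf m) measurable_js_y1).
Qed.

Lemma measurable_js_w2 : measurable_fun setT (js_w2 m).
Proof.
rewrite (_ : js_w2 m = fun t => gauss_pdf m (js_y2 t) * js_jac (- 1) t); last first.
  by apply/funext => t; rewrite js_w2E js_y2E.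
apply: measurable_funM; last exact: measurable_js_jac.
exact: (measurableT_comp (measurable_gauss_pdf m) measurable_js_y2).
Qed.

Lemma measurable_js_pi : measurable_fun setT (js_pi m).
Proof.
apply: measurable_funM; first exact: measurable_js_w1.
apply: measurable_funVr; apply: measurable_funD.
  exact: measurable_js_w1.
exact: measurable_js_w2.
Qed.

Lemma js_w1_ge0 t : 0 <= js_w1 m t.
Proof. by rewrite js_w1E; apply: mulr_ge0; [exact: gauss_pdf_ge0|exact: js_jac_ge0]. Qed.

Lemma js_w2_ge0 t : 0 <= js_w2 m t.
Proof. by rewrite js_w2E; apply: mulr_ge0; [exact: gauss_pdf_ge0|exact: js_jac_ge0]. Qed.

(** Change-of-variables formula for the density of the image law: the
    normal density at each preimage divided by the Jacobian there. *)
Definition js_density t : R := js_w1 m t + js_w2 m t.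

Lemma measurable_js_density : measurable_fun setT js_density.
Proof. by apply: measurable_funD; [exact: measurable_js_w1|exact: measurable_js_w2]. Qed.

Lemma js_density_ge0 t : 0 <= js_density t.
Proof. by apply: addr_ge0; [exact: js_w1_ge0|exact: js_w2_ge0]. Qed.

(** Given the statistic, [y] sits on one of the two preimages, with
    probabilities [js_pi] and [1 - js_pi]. *)
Definition js_mean F t : R :=
  js_pi m t * F (js_y1 t) + (1 - js_pi m t) * F (js_y2 t).

Lemma measurable_js_mean F : measurable_fun setT F -> measurable_fun setT (js_mean F).
Proof.
move=> mF; apply: measurable_funD; apply: measurable_funM.
- exact: measurable_js_pi.
- exact: (measurableT_comp mF measurable_js_y1).
- by apply: measurable_funB => //; exact: measurable_js_pi.
- exact: (measurableT_comp mF measurable_js_y2).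
Qed.

Lemma js_mean_ge0 F t : (forall y, 0 <= F y) -> 0 <= js_mean F t.
Proof.
move=> F0; have /andP[p0 p1] := js_pi_ge0_le1 n2 m t.
by rewrite addr_ge0// mulr_ge0// subr_ge0.
Qed.

Local Open Scope ereal_scope.

(** The change of variables for the normal law: the weights are the normal density
    times the Jacobian of the branch. *)
Lemma ge0_integral_gauss_js F : measurable_fun setT F -> (forall y, 0 <= F y)%R ->
  \int[P]_y (F y)%:E =
  \int[lebesgue_row R n.+1]_t (F (js_y1 t) * js_w1 m t + F (js_y2 t) * js_w2 m t)%:E.
Proof.
move=> mF F0; rewrite ge0_integral_gauss//; last exact/measurable_EFinP.
rewrite ge0_integral_js_branches//; last 2 first.
- apply: emeasurable_funM; first exact/measurable_EFinP.
  exact: measurable_gauss_pdf_EFin.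
- by move=> y; rewrite -EFinM lee_fin mulr_ge0// gauss_pdf_ge0.
apply: eq_integral => t _.
have -> : (F (js_y1 t) * js_w1 m t = F (js_preim 1 t) * gauss_pdf m (js_preim 1 t) * js_jac 1 t)%R.
  by rewrite js_y1E js_w1E mulrA.
have -> : (F (js_y2 t) * js_w2 m t =
    F (js_preim (- 1) t) * gauss_pdf m (js_preim (- 1) t) * js_jac (- 1) t)%R.
  by rewrite js_y2E js_w2E mulrA.
reflexivity.
Qed.

Lemma ge0_integral_js_density (h : 'rV[R]_n.+1 -> R) :
  measurable_fun setT h -> (forall t, 0 <= h t)%R ->
  \int[P]_y (h (js y))%:E = \int[lebesgue_row R n.+1]_t (h t * js_density t)%:E.
Proof.
move=> mh h0.
have mhj : measurable_fun setT (h \o js) by exact: (measurableT_comp mh measurable_js).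
rewrite (ge0_integral_gauss_js mhj (fun y => h0 (js y))).
apply: ge0_integral_row_neq0.
- apply/measurable_EFinP; apply: measurable_funD; apply: measurable_funM.
  + exact: (measurableT_comp mhj measurable_js_y1).
  + exact: measurable_js_w1.
  + exact: (measurableT_comp mhj measurable_js_y2).
  + exact: measurable_js_w2.
- by apply/measurable_EFinP; apply: measurable_funM => //; exact: measurable_js_density.
- move=> t; rewrite lee_fin.
  by apply: addr_ge0; apply: mulr_ge0; [exact: h0|exact: js_w1_ge0|exact: h0|exact: js_w2_ge0].
- by move=> t; rewrite lee_fin; apply: mulr_ge0; [exact: h0|exact: js_density_ge0].
move=> t t0 /=; rewrite js_y1E js_y2E !js_preimK// ?normrN ?normr1//.
by rewrite -mulrDr.
Qed.

Lemma js_densityP (A : set 'rV[R]_n.+1) : measurable A ->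
  P (js @^-1` A) = \int[lebesgue_row R n.+1]_(t in A) (js_density t)%:E.
Proof.
move=> mA.
have mjA : measurable (js @^-1` A).
  by rewrite -[X in measurable X]setTI; exact: measurable_js.
transitivity (\int[P]_y (\1_A (js y))%:E).
  rewrite -[LHS]mul1e -(@integral_cst _ _ _ P _ mjA 1) integral_mkcond.
  apply: eq_integral => y _; rewrite patchE indicE/=.
  have -> : (y \in js @^-1` A) = (js y \in A) by apply/idP/idP; rewrite !inE.
  by case: ifP.
have m1 : measurable_fun setT (\1_A : 'rV[R]_n.+1 -> R) by exact: measurable_indic.
have i0 t : (0 <= (\1_A : 'rV[R]_n.+1 -> R) t)%R by [].
rewrite (ge0_integral_js_density m1 i0).
rewrite [RHS]integral_mkcond; apply: eq_integral => t _.
by rewrite patchE indicE; case: ifP => _; rewrite ?mul1r ?mul0r.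
Qed.

(** After the change of variables both sides integrate
    [F y1 * w1 + F y2 * w2] over [A]: this is the density [w1 + w2] times the mean
    of [F] for the weights [w1 / (w1 + w2)] and [w2 / (w1 + w2)]. *)
Lemma ge0_integral_js_mean F (A : set 'rV[R]_n.+1) :
  measurable A -> measurable_fun setT F -> (forall y, 0 <= F y)%R ->
  \int[P]_(y in js @^-1` A) (F y)%:E = \int[P]_(y in js @^-1` A) (js_mean F (js y))%:E.
Proof.
move=> mA mF F0.
have m1 : measurable_fun setT (\1_A : 'rV[R]_n.+1 -> R) by exact: measurable_indic.
have cond (G : 'rV[R]_n.+1 -> R) : \int[P]_(y in js @^-1` A) (G y)%:E =
    \int[P]_y (\1_A (js y) * G y)%:E.
  rewrite integral_mkcond; apply: eq_integral => y _; rewrite patchE indicE.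
  have -> : (y \in js @^-1` A) = (js y \in A) by apply/idP/idP; rewrite !inE.
  by case: ifP; rewrite ?mul1r ?mul0r.
have mjs1 : measurable_fun setT (fun y => \1_A (js y) : R) by exact: (measurableT_comp m1 measurable_js).
have mMF : measurable_fun setT (fun t => \1_A t * js_mean F t)%R.
  by apply: measurable_funM => //; exact: measurable_js_mean.
have mIF : measurable_fun setT (fun y => \1_A (js y) * F y)%R by exact: measurable_funM.
have MF0 t : (0 <= \1_A t * js_mean F t)%R by rewrite mulr_ge0// js_mean_ge0.
have IF0 y : (0 <= \1_A (js y) * F y)%R by rewrite mulr_ge0.
rewrite !cond (ge0_integral_js_density mMF MF0) (ge0_integral_gauss_js mIF IF0).
apply: ge0_integral_row_neq0.
- apply/measurable_EFinP; apply: measurable_funD; apply: measurable_funM.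
  + exact: (measurableT_comp mIF measurable_js_y1).
  + exact: measurable_js_w1.
  + exact: (measurableT_comp mIF measurable_js_y2).
  + exact: measurable_js_w2.
- by apply/measurable_EFinP; apply: measurable_funM => //; exact: measurable_js_density.
- move=> t; rewrite lee_fin; apply: addr_ge0; apply: mulr_ge0.
  + exact: IF0.
  + exact: js_w1_ge0.
  + exact: IF0.
  + exact: js_w2_ge0.
- move=> t; rewrite lee_fin; apply: mulr_ge0; [exact: MF0|exact: js_density_ge0].
move=> t t0.
have -> : js (js_y1 t) = t by rewrite js_y1E js_preimK// normr1.
have -> : js (js_y2 t) = t by rewrite js_y2E js_preimK// normrN normr1.
have w1 := js_w1_gt0 n2 m t0; have w2 := js_w2_gt0 n2 m t0.
congr EFin; rewrite /js_mean /js_density /js_pi.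
move: (js_w1 m t) (js_w2 m t) (F _) (F _) (\1_A t) w1 w2 => x y f g i x0 y0.
by field; rewrite gt_eqF// addr_gt0.
Qed.

(** The nonnegative case [ge0_integral_js_mean], applied to positive and negative
    parts. *)
Lemma js_is_cond_exp F : F \in Lfun P 1 -> is_cond_exp P js F (js_mean F).
Proof.
move=> F1; have mF := Lfun2_measurable F1.
have iF := (Lfun1_integrable _ _).1 F1.
pose Fp y : R := Num.max (F y) 0%R; pose Fn y : R := Num.max (- F y)%R 0%R.
have mFp : measurable_fun setT Fp by exact: measurable_maxr.
have mFn : measurable_fun setT Fn by apply: measurable_maxr => //; exact: measurable_funN.
have Fp0 y : (0 <= Fp y)%R by rewrite le_max lexx orbT.
have Fn0 y : (0 <= Fn y)%R by rewrite le_max lexx orbT.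
have FE y : F y = (Fp y - Fn y)%R.
  by rewrite /Fp /Fn; case: (lerP (F y) 0%R); case: (lerP (- F y)%R 0%R) => ? ?; lra.
have Fp1 : Fp \in Lfun P 1.
  apply: (Lfun1_le _ F1) => // y; rewrite ger0_norm// ge_max normr_ge0 andbT.
  exact: ler_norm.
have Fn1 : Fn \in Lfun P 1.
  apply: (Lfun1_le _ F1) => // y; rewrite ger0_norm// ge_max normr_ge0 andbT.
  by rewrite -normrN; exact: ler_norm.
have meanE t : js_mean F t = (js_mean Fp t - js_mean Fn t)%R.
  by rewrite /js_mean !FE; ring.
have L1 (G : 'rV[R]_n.+1 -> R) : G \in Lfun P 1 -> (forall y, 0 <= G y)%R ->
    (js_mean G \o js) \in Lfun P 1.
  move=> G1 G0; have mG := Lfun2_measurable G1.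
  apply: Lfun1_ge0_lty.
  - exact: (measurableT_comp (measurable_js_mean mG) measurable_js).
  - by move=> y; exact: js_mean_ge0.
  - have := ge0_integral_js_mean measurableT mG G0; rewrite preimage_setT => <-.
    have /integrableP[_] := (Lfun1_integrable _ _).1 G1.
    by under eq_integral do rewrite gee0_abs ?lee_fin//.
have Mp := L1 _ Fp1 Fp0; have Mn := L1 _ Fn1 Fn0.
have ME : js_mean F \o js = (fun y => (js_mean Fp \o js) y - (js_mean Fn \o js) y)%R.
  by apply/funext => y /=; rewrite meanE.
split => //.
- exact: measurable_js_mean.
- apply/Lfun1_integrable; rewrite ME; exact: rpredB.
move=> A mA.
have mjA : measurable (js @^-1` A).
  by rewrite -[X in measurable X]setTI; exact: measurable_js.
have iA (G : 'rV[R]_n.+1 -> R) : G \in Lfun P 1 -> P.-integrable (js @^-1` A) (EFin \o G).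
  by move=> /Lfun1_integrable; exact: integrableS.
under eq_integral do rewrite FE EFinB.
under [RHS]eq_integral do rewrite meanE EFinB.
rewrite (integralB_EFin mjA (iA _ Fp1) (iA _ Fn1)).
rewrite (integralB_EFin mjA (iA _ Mp) (iA _ Mn)).
exact: (congr2 (fun a c : \bar R => a - c)
  (ge0_integral_js_mean mA mFp Fp0) (ge0_integral_js_mean mA mFn Fn0)).
Qed.

Lemma rexp_js_mean F : F \in Lfun P 1 ->
  ((js_mean F \o js) \in Lfun P 1) /\ rexp P (js_mean F \o js) = rexp P F.
Proof.
move=> /js_is_cond_exp[_ _ i /(_ _ measurableT)]; rewrite preimage_setT => E.
split; first exact/Lfun1_integrable.
by rewrite /rexp unlock E.
Qed.

End js_conditional.

(** * Continuous versions of densities *)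

Section continuous_density.
Context (R : realType) (n : nat).
Implicit Types (t y : 'rV[R]_n) (f g : 'rV[R]_n -> R).

Lemma continuous_enorm : continuous (@enorm R n).
Proof.
move=> x; rewrite /enorm.
apply: (@continuous_comp _ _ _ (fun x : 'rV[R]_n => \sum_(i <- index_enum _) x ord0 i ^+ 2) Num.sqrt); last exact: sqrt_continuous.
elim: (index_enum _) => [|i s IH].
  rewrite (_ : (fun _ => _) = cst 0); last by apply/funext => y; rewrite big_nil.
  exact: cst_continuous.
rewrite (_ : (fun _ => _) =
    fun y : 'rV[R]_n => y ord0 i ^+ 2 + \sum_(j <- s) y ord0 j ^+ 2); last first.
  by apply/funext => y; rewrite big_cons.
apply: (@continuousD _ _ _ (fun y : 'rV[R]_n => y ord0 i ^+ 2) _ _ _ IH).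
apply: (@continuous_comp _ _ _ (fun x : 'rV[R]_n => x ord0 i) (fun u : R => u ^+ 2)).
  exact: coord_continuous.
exact: exprn_continuous.
Qed.

Lemma continuous_gauss_pdf (m : 'rV[R]_n) : continuous (gauss_pdf m).
Proof.
move=> x.
pose phi (u : R) := (2 * pi) `^ (- (n%:R / 2)) * expR (- (u ^+ 2 / 2)).
have cphi : continuous phi.
  move=> u; apply: cvgM; first exact: cvg_cst.
  apply: (@continuous_comp _ _ _ (fun v : R => - (v ^+ 2 / 2)) expR); last exact: continuous_expR.
  apply: cvgN; apply: cvgM; last exact: cvg_cst.
  exact: exprn_continuous.
apply: (@continuous_comp _ _ _ (fun y : 'rV[R]_n => enorm (y - m)) phi); last exact: cphi.
apply: (@continuous_comp _ _ _ (fun y : 'rV[R]_n => y - m) (@enorm R n)); last exact: continuous_enorm.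
apply: (@continuousD _ _ _ id (cst (- m)) x); [exact: (@cvg_id _ (nbhs x))|exact: cst_continuous].
Qed.

Definition row_box t (e : R) : set 'rV[R]_n :=
  [set y | forall i, (`]t ord0 i - e, t ord0 i + e[%classic : set R) (y ord0 i)].

Lemma measurable_row_box t e : measurable (row_box t e).
Proof.
have -> : row_box t e = \bigcap_(i in [set: 'I_n])
    (row_coord i @^-1` `]t ord0 i - e, t ord0 i + e[%classic).
  by apply/seteqP; split=> [x Ax i _|x Ax i]; [exact: Ax|exact: (Ax i I)].
apply: fin_bigcap_measurable => // i _.
by rewrite -[X in measurable X]setTI; apply: measurable_row_coord.
Qed.

Lemma lebesgue_row_row_box t e : 0 < e ->
  lebesgue_row R n (row_box t e) = ((e *+ 2) ^+ n)%:E.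
Proof.
move=> e0; rewrite /row_box.
rewrite (@lebesgue_row_box R n (fun i => `]t ord0 i - e, t ord0 i + e[%classic)); last first.
  by move=> i; exact: measurable_itv.
transitivity (\prod_(i < n) (e *+ 2)%:E)%E.
  apply: eq_bigr => i _; rewrite lebesgue_measure_itv/= lte_fin.
  rewrite ifT; last by lra.
  by rewrite -EFinD; congr EFin; ring.
by rewrite prodEFin prodr_const card_ord.
Qed.

Lemma integral_row_box t e c : 0 < e ->
  (\int[lebesgue_row R n]_(y in row_box t e) c%:E = (c * (e *+ 2) ^+ n)%:E)%E.
Proof.
move=> e0; rewrite integral_cst; last exact: measurable_row_box.
by rewrite EFinM; exact: (congr1 (fun z => c%:E * z)%E (lebesgue_row_row_box t e0)).
Qed.

Lemma nbhs_row_box t (A : set 'rV[R]_n) : nbhs t A ->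
  exists2 e, 0 < e & row_box t e `<=` A.
Proof.
move=> /nbhs_ballP[e /= e0 eA]; exists e => // y yt; apply: eA.
split => // i j; rewrite (ord1 i) /ball/= ltr_distlC.
by have := yt j; rewrite /= in_itv.
Qed.

(** A continuous function that is positive at a point is bounded below on a box
    around it, and boxes have positive measure. *)
Lemma continuous_integral_gt0 f t : measurable_fun setT f ->
  (forall y, 0 <= f y) -> {for t, continuous f} -> 0 < f t ->
  (0 < \int[lebesgue_row R n]_y (f y)%:E)%E.
Proof.
move=> mf f0 cf ft0.
have [e e0 eA] : exists2 e, 0 < e & row_box t e `<=` [set y | f t / 2 < f y].
  apply: nbhs_row_box; apply: (cvgr_gt _ cf); lra.
have mB := measurable_row_box t e.
apply: (@lt_le_trans _ _ (\int[lebesgue_row R n]_(y in row_box t e) (f t / 2)%:E)%E).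
  rewrite integral_row_box// lte_fin.
  by rewrite mulr_gt0 ?exprn_gt0// ?divr_gt0// mulrn_wgt0.
apply: (@le_trans _ _ (\int[lebesgue_row R n]_(y in row_box t e) (f y)%:E)%E).
  apply: ge0_le_integral => //.
  - by move=> y _; rewrite lee_fin divr_ge0// ltW.
  - by apply: measurable_funTS; exact/measurable_EFinP.
  - by move=> y /eA /= fy; rewrite lee_fin ltW.
apply: ge0_subset_integral => //; first exact/measurable_EFinP.
by move=> y _; rewrite lee_fin.
Qed.

(** If [f t > g t], a small box around [t] separates [f] from [g] by two
    constants, and the integrals over it differ. *)
Lemma continuous_density_le f g t : measurable_fun setT f -> measurable_fun setT g ->
  (forall y, 0 <= f y) -> (forall y, 0 <= g y) ->
  (forall A, measurable A -> \int[lebesgue_row R n]_(y in A) (f y)%:E =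
                             \int[lebesgue_row R n]_(y in A) (g y)%:E)%E ->
  {for t, continuous f} -> {for t, continuous g} -> f t <= g t.
Proof.
move=> mf mg f0 g0 fg cf cg; rewrite leNgt; apply/negP => gf.
pose u := (f t + 2 * g t) / 3; pose v := (2 * f t + g t) / 3.
have u0 : 0 <= u by have := f0 t; have := g0 t; rewrite /u; lra.
have uv : u < v by rewrite /u /v; lra.
have [e e0 eA] : exists2 e, 0 < e & row_box t e `<=` [set y | g y < u /\ v < f y].
  apply: nbhs_row_box; apply: filterI.
    by apply: (cvgr_lt _ cg); rewrite /u; lra.
  by apply: (cvgr_gt _ cf); rewrite /v; lra.
have mB := measurable_row_box t e.
have gu : (\int[lebesgue_row R n]_(y in row_box t e) (g y)%:E <= (u * (e *+ 2) ^+ n)%:E)%E.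
  rewrite -(integral_row_box t _ e0).
  apply: ge0_le_integral => //.
  - by move=> y _; rewrite lee_fin.
  - by apply: measurable_funTS; exact/measurable_EFinP.
  - by move=> y /eA[/ltW ? _]; rewrite lee_fin.
have fv : ((v * (e *+ 2) ^+ n)%:E <= \int[lebesgue_row R n]_(y in row_box t e) (f y)%:E)%E.
  rewrite -(integral_row_box t _ e0).
  apply: ge0_le_integral => //.
  - by move=> y _; rewrite lee_fin (le_trans u0)// ltW.
  - by apply: measurable_funTS; exact/measurable_EFinP.
  - by move=> y /eA[_ /ltW ?]; rewrite lee_fin.
rewrite (fg _ mB) in fv; have := le_trans fv gu.
by rewrite lee_fin ler_pM2r ?exprn_gt0 ?mulrn_wgt0// leNgt uv.
Qed.

End continuous_density.

Section js_density_continuity.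
Context (R : realType) (n : nat).
Hypothesis n2 : (2 <= n)%N.
Local Notation b := (n.+1%:R - 2 : R).
Local Notation r := (js_branch b).
Implicit Types (t m : 'rV[R]_n.+1).

Let cr : continuous r.
Proof.
move=> c; apply: differentiable_continuous; apply/derivable1_diffP.
by have [] := is_derive_js_branch (js_b_gt0 R n2) c.
Qed.

Let cre (e : R) : continuous (fun c : R => r (e * c)).
Proof.
move=> c; apply: (@continuous_comp _ _ _ ( *%R e) r); last exact: cr.
exact: mulrl_continuous.
Qed.

Lemma continuous_js_preim e t : t != 0 -> {for t, continuous (js_preim e)}.
Proof.
move=> t0.
have ca : {for t, continuous (fun x : 'rV[R]_n.+1 => e * r (e * enorm x) / enorm x)}.
  apply: (@continuous_comp _ _ _ (@enorm R n.+1) (fun c : R => e * r (e * c) / c)).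
    exact: continuous_enorm.
  apply: continuousM.
    by apply: continuousM; [exact: cst_continuous|exact: cre].
  by apply: continuousV; [rewrite enorm_eq0|exact: cvg_id].
exact: (@cvgZ _ _ _ _ _ _ id _ t ca cvg_id).
Qed.

Lemma continuous_js_jac e t : t != 0 -> {for t, continuous (js_jac e)}.
Proof.
move=> t0.
have r0 c : r c != 0 by rewrite gt_eqF// js_branch_gt0// js_b_gt0.
apply: (@continuous_comp _ _ _ (@enorm R n.+1) (fun c : R =>
   (js_drho n.+1 (r (e * c)) * (c / r (e * c)) ^+ n)^-1)).
  exact: continuous_enorm.
apply: continuousV.
  by rewrite -[X in X != 0]invrK invr_eq0 gt_eqF// (js_jac_gt0 n2 e t0).
apply: continuousM.
  apply: continuousD; first exact: cst_continuous.
  apply: continuousM; first exact: cst_continuous.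
  apply: continuousV; first by rewrite expf_neq0.
  apply: (@continuous_comp _ _ _ (fun c : R => r (e * c)) (fun u : R => u ^+ 2)).
    exact: cre.
  exact: exprn_continuous.
apply: (@continuous_comp _ _ _ (fun c : R => c / r (e * c)) (fun u : R => u ^+ n)).
  apply: continuousM; first exact: cvg_id.
  by apply: continuousV; [exact: r0|exact: cre].
exact: exprn_continuous.
Qed.

Let continuous_w e m t : t != 0 ->
  {for t, continuous (fun t => gauss_pdf m (js_preim e t) * js_jac e t)}.
Proof.
move=> t0; apply: continuousM; last exact: continuous_js_jac.
apply: (@continuous_comp _ _ _ (js_preim e) (gauss_pdf m)).
  exact: continuous_js_preim.
exact: continuous_gauss_pdf.
Qed.

Lemma continuous_js_w1 m t : t != 0 -> {for t, continuous (js_w1 m)}.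
Proof.
rewrite (_ : js_w1 m = fun t => gauss_pdf m (js_preim 1 t) * js_jac 1 t).
  exact: continuous_w.
by apply/funext => x; rewrite js_w1E.
Qed.

Lemma continuous_js_w2 m t : t != 0 -> {for t, continuous (js_w2 m)}.
Proof.
rewrite (_ : js_w2 m = fun t => gauss_pdf m (js_preim (- 1) t) * js_jac (- 1) t).
  exact: continuous_w.
by apply/funext => x; rewrite js_w2E.
Qed.

Lemma continuous_js_density m t : t != 0 -> {for t, continuous (js_density m)}.
Proof.
by move=> t0; apply: continuousD; [exact: continuous_js_w1|exact: continuous_js_w2].
Qed.

Lemma js_density_gt0 m t : t != 0 -> 0 < js_density m t.
Proof. by move=> t0; apply: addr_gt0; [exact: js_w1_gt0|exact: js_w2_gt0]. Qed.

Lemma continuous_js_pi m t : t != 0 -> {for t, continuous (js_pi m)}.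
Proof.
move=> t0; apply: continuousM; first exact: continuous_js_w1.
apply: continuousV; last exact: continuous_js_density.
by rewrite gt_eqF// js_density_gt0.
Qed.

Lemma continuous_js_y1 t i : t != 0 -> {for t, continuous (fun t => js_y1 t ord0 i)}.
Proof.
move=> t0; rewrite (_ : (fun _ => _) = fun t => js_preim 1 t ord0 i); last first.
  by apply/funext => x; rewrite js_y1E.
apply: (@continuous_comp _ _ _ (@js_preim R n 1) (fun x => x ord0 i)).
  exact: continuous_js_preim.
exact: coord_continuous.
Qed.

Lemma continuous_js_y2 t i : t != 0 -> {for t, continuous (fun t => js_y2 t ord0 i)}.
Proof.
move=> t0; rewrite (_ : (fun _ => _) = fun t => js_preim (- 1) t ord0 i); last first.
  by apply/funext => x; rewrite js_y2E.
apply: (@continuous_comp _ _ _ (@js_preim R n (- 1)) (fun x => x ord0 i)).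
  exact: continuous_js_preim.
exact: coord_continuous.
Qed.

Lemma js_density_marginal :
  marginal_density (@gauss_row R n.+1) (@james_stein R n.+1) [set~ 0] (@js_density R n).
Proof.
move=> m; split.
- exact: measurable_js_density.
- by move=> t; exact: js_density_ge0.
- by move=> A mA; exact: js_densityP.
- by move=> t /eqP t0; exact: continuous_js_density.
Qed.

(** Two densities of the same law that are continuous at a point agree there. *)
Lemma js_density_unique p :
  marginal_density (@gauss_row R n.+1) (@james_stein R n.+1) [set~ 0] p ->
  forall m t, t != 0 -> p m t = js_density m t.
Proof.
move=> hp m t t0.
have [mp p0 pP cp] := hp m; have [mq q0 qP cq] := js_density_marginal m.
apply/eqP; rewrite eq_le; apply/andP; split; apply: continuous_density_le => //.
- by move=> A mA; rewrite -pP// qP.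
- by apply: cp; apply/eqP.
- by apply: cq; apply/eqP.
- by move=> A mA; rewrite -pP// qP.
- by apply: cq; apply/eqP.
- by apply: cp; apply/eqP.
Qed.

End js_density_continuity.

(** * Derivatives in the parameter and scores *)

Section row_calculus.
Context (R : realType) (n : nat).
Implicit Types (x v y : 'rV[R]_n) (f g : 'rV[R]_n -> R).

Lemma is_derive_coord x v i : is_derive x v (fun nu : 'rV[R]_n => nu ord0 i) (v ord0 i).
Proof.
have E : (h^-1 *: ((h *: v + x) ord0 i - x ord0 i)) @[h --> (0 : R)^'] --> v ord0 i.
  apply: cvg_near_cst; near=> h.
  have h0 : h != 0 by near: h; exact: nbhs_dnbhs_neq.
  by rewrite !mxE addrK /GRing.scale/= mulKf.
apply: DeriveDef; first exact: (cvgP _ E).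
exact: (cvg_lim (@Rhausdorff R) E).
Unshelve. all: by end_near. Qed.

Lemma derive_line f x v : 'D_v f x = 'D_1 (fun h : R => f (h *: v + x)) (0 : R).
Proof.
rewrite /derive.
suff -> : (fun h : R => h^-1 *: (((fun h : R => f (h *: v + x)) \o shift 0) h%:A -
    f (0 *: v + x))) = (fun h : R => h^-1 *: ((f \o shift x) (h *: v) - f x)) by [].
apply/funext => h /=.
by rewrite addr0 scale0r add0r /GRing.scale/= mulr1.
Qed.

(** A directional derivative only sees the line through [x], so the chain rule in
    one variable applies. *)
Lemma is_derive_row_comp (phi : R -> R) f x v a df :
  is_derive (f x) 1 phi a -> is_derive x v f df ->
  is_derive x v (phi \o f) (a * df).
Proof.
move=> hphi hf.
pose g (h : R) : R := f (h *: v + x).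
have g0 : g 0 = f x by rewrite /g scale0r add0r.
have dg : is_derive (0 : R) 1 g df.
  have [/derivable1P dv dfE] := hf.
  by apply: DeriveDef => //; rewrite -dfE derive_line.
have := @is_derive1_comp _ phi g 0 a df; rewrite g0 => /(_ hphi dg) [d1 d2].
apply: DeriveDef; first exact/derivable1P.
by rewrite -d2 derive_line.
Qed.

Definition row_dot x y : R := \sum_i x ord0 i * y ord0 i.

Lemma row_dot_delta x j : row_dot x (delta_mx ord0 j) = x ord0 j.
Proof.
rewrite /row_dot (bigD1 j)//= !mxE !eqxx mulr1 big1 ?addr0// => i ij.
by rewrite mxE (negbTE ij) mulr0.
Qed.

Lemma sqr_enormB_fctE y :
  (fun nu : 'rV[R]_n => enorm (y - nu) ^+ 2) =
  \sum_i (fun nu : 'rV[R]_n => y ord0 i - nu ord0 i) ^+ 2.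
Proof.
apply/funext => nu; rewrite sqr_enorm fct_sumE; apply: eq_bigr => i _.
by rewrite !mxE /= fctE.
Qed.

Lemma is_derive_sqr_enormB y x v :
  is_derive x v (fun nu : 'rV[R]_n => enorm (y - nu) ^+ 2) (- 2 * row_dot (y - x) v).
Proof.
rewrite sqr_enormB_fctE /row_dot mulr_sumr.
apply: is_derive_sum => i.
have dB : is_derive x v (fun nu : 'rV[R]_n => y ord0 i - nu ord0 i) (- v ord0 i).
  have := is_deriveB (is_derive_cst (y ord0 i) x v) (is_derive_coord x v i).
  by rewrite sub0r.
have := is_deriveX 2 dB; move=> /is_derive_eq; apply.
by rewrite /GRing.scale/= !mxE; ring.
Qed.

Lemma differentiable_sqr_enormB y x :
  differentiable (fun nu : 'rV[R]_n => enorm (y - nu) ^+ 2) x.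
Proof.
rewrite sqr_enormB_fctE; apply: differentiable_sum => i.
apply: differentiableX; apply: differentiableB; first exact: differentiable_cst.
exact: differentiable_coord.
Qed.

Let c0 : R := (2 * pi) `^ (- (n%:R / 2)).
Let phi (q : R) : R := c0 * expR (- (q / 2)).

Let dphi (q : R) : is_derive q 1 phi (- (phi q / 2)).
Proof.
have dq : is_derive q (1 : R) (fun u : R => - (u / 2)) (- 2^-1).
  by apply: is_derive_eq; rewrite /GRing.scale/=; ring.
have := @is_derive1_comp _ expR _ q _ _ (is_derive_expR _) dq.
move=> /(is_deriveZ c0) /is_derive_eq; apply.
by rewrite /GRing.scale/= /phi; ring.
Qed.

Lemma is_derive_gauss_pdf y x v :
  is_derive x v (fun nu : 'rV[R]_n => gauss_pdf nu y) (gauss_pdf x y * row_dot (y - x) v).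
Proof.
have := is_derive_row_comp (dphi (enorm (y - x) ^+ 2)) (is_derive_sqr_enormB y x v).
by move=> /is_derive_eq; apply; rewrite -[phi _]/(gauss_pdf x y); field.
Qed.

Lemma differentiable_gauss_pdf y x : differentiable (fun nu : 'rV[R]_n => gauss_pdf nu y) x.
Proof.
apply: (@differentiable_comp _ _ _ _ (fun nu : 'rV[R]_n => enorm (y - nu) ^+ 2) phi).
  exact: differentiable_sqr_enormB.
by apply/derivable1_diffP; have [] := dphi (enorm (y - x) ^+ 2).
Qed.

Lemma score_gauss_pdf (m y : 'rV[R]_n) : score (@gauss_pdf R n) m y = y - m.
Proof.
apply/rowP => j; rewrite mxE.
have := is_derive_row_comp (f := fun nu : 'rV[R]_n => gauss_pdf nu y) (x := m)
  (is_derive1_ln (gauss_pdf_gt0 m y))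
  (is_derive_gauss_pdf y m (delta_mx ord0 j)).
move=> [_ ->]; rewrite mulKf ?gt_eqF ?gauss_pdf_gt0//.
exact: row_dot_delta.
Qed.

End row_calculus.

Section js_score.
Context (R : realType) (n : nat).
Hypothesis n2 : (2 <= n)%N.
Variable t : 'rV[R]_n.+1.
Hypothesis t0 : t != 0.
Implicit Types (x v nu : 'rV[R]_n.+1).
Local Notation y1 := (js_y1 t).
Local Notation y2 := (js_y2 t).

Let w1 nu := js_w1 nu t.
Let w2 nu := js_w2 nu t.
Let p nu := js_density nu t.

Let w1E : w1 = fun nu => js_jac 1 t * gauss_pdf nu y1.
Proof. by apply/funext => nu; rewrite /w1 js_w1E js_y1E mulrC. Qed.

Let w2E : w2 = fun nu => js_jac (- 1) t * gauss_pdf nu y2.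
Proof. by apply/funext => nu; rewrite /w2 js_w2E js_y2E mulrC. Qed.

Let dw1 x v : is_derive x v w1 (w1 x * row_dot (y1 - x) v).
Proof.
rewrite w1E; have := is_deriveZ (js_jac 1 t) (is_derive_gauss_pdf y1 x v).
by move=> /is_derive_eq; apply; rewrite /GRing.scale/= mulrA.
Qed.

Let dw2 x v : is_derive x v w2 (w2 x * row_dot (y2 - x) v).
Proof.
rewrite w2E; have := is_deriveZ (js_jac (- 1) t) (is_derive_gauss_pdf y2 x v).
by move=> /is_derive_eq; apply; rewrite /GRing.scale/= mulrA.
Qed.

Let dp x v : is_derive x v p (w1 x * row_dot (y1 - x) v + w2 x * row_dot (y2 - x) v).
Proof. exact: (is_deriveD (dw1 x v) (dw2 x v)). Qed.

Let diffw1 x : differentiable w1 x.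
Proof.
rewrite w1E; apply: (@differentiableZ _ _ _ (fun nu => gauss_pdf nu y1)).
exact: differentiable_gauss_pdf.
Qed.

Let diffw2 x : differentiable w2 x.
Proof.
rewrite w2E; apply: (@differentiableZ _ _ _ (fun nu => gauss_pdf nu y2)).
exact: differentiable_gauss_pdf.
Qed.

Let diffp x : differentiable p x.
Proof. exact: (differentiableD (diffw1 x) (diffw2 x)). Qed.

Let p_gt0 x : 0 < p x. Proof. exact: js_density_gt0. Qed.

Lemma differentiable_ln_js_density x :
  differentiable (fun nu => ln (js_density nu t)) x.
Proof.
apply: (@differentiable_comp _ _ _ _ p (@ln R)); first exact: diffp.
by apply/derivable1_diffP; have [] := is_derive1_ln (p_gt0 x).
Qed.

Definition js_score m : 'rV[R]_n.+1 :=
  js_pi m t *: (y1 - m) + (1 - js_pi m t) *: (y2 - m).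

(** The log-derivative of [w1 + w2] is the average of those of [w1] and [w2], with
    weights proportional to [w1] and [w2]; each is that of a normal density, since
    the Jacobians do not involve the parameter. *)
Lemma score_js_density m : score (@js_density R n) m t = js_score m.
Proof.
apply/rowP => j; rewrite mxE -[RHS]/(js_score m ord0 j).
have := is_derive_row_comp (f := p) (x := m) (is_derive1_ln (p_gt0 m)) (dp m (delta_mx ord0 j)).
move=> [_ ->]; rewrite !row_dot_delta /js_score !mxE /js_pi.
have := p_gt0 m; rewrite /p /js_density -/(w1 m) -/(w2 m).
have e0 : enorm t != 0 by rewrite enorm_eq0.
by move: (w1 m) (w2 m) => a c ac; field; rewrite e0 gt_eqF.
Qed.

(* As a function of the parameter, the branch probability solves a logistic
   equation along every direction. *)
Let pi x := js_pi x t.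

Let dpi x v : is_derive x v pi (pi x * (1 - pi x) * row_dot (y1 - y2) v).
Proof.
have pn0 : p x != 0 by rewrite gt_eqF.
have dV : is_derive x v (fun nu => (p nu)^-1)
    (- (p x) ^- 2 * (w1 x * row_dot (y1 - x) v + w2 x * row_dot (y2 - x) v)).
  have [dpx Dpx] := dp x v.
  apply: DeriveDef; first exact: (derivableV pn0 dpx).
  by rewrite -Dpx; exact: (deriveV pn0 dpx).
have := is_deriveM (dw1 x v) dV; move=> /is_derive_eq; apply.
rewrite /GRing.scale/= /pi /js_pi -/(w1 x) -/(w2 x).
have -> : row_dot (y1 - y2) v = row_dot (y1 - x) v - row_dot (y2 - x) v.
  by rewrite /row_dot -sumrB; apply: eq_bigr => i _; rewrite !mxE; ring.
move: pn0; rewrite /p /js_density -/(w1 x) -/(w2 x).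
by move: (w1 x) (w2 x) => a c ac; field.
Qed.

Let cpi : continuous pi.
Proof.
move=> x; apply: (@continuousM _ _ w1 (fun nu => (p nu)^-1) x).
  exact/differentiable_continuous/diffw1.
apply: (@continuousV _ _ p x); last exact/differentiable_continuous/diffp.
by rewrite gt_eqF// p_gt0.
Qed.

(* Functions P.[pi nu] + c * nu_i, with P a polynomial, are closed under
   directional derivatives: the logistic equation turns P into a multiple of
   P' * (X - X ^ 2) and the linear term into a constant. *)
Let cont_diff_pi N (P : {poly R}) (c : R) i :
  cont_diff N (fun nu => P.[pi nu] + c * nu ord0 i).
Proof.
have cP (Q : {poly R}) (d : R) : continuous (fun nu => Q.[pi nu] + d * nu ord0 i).
  move=> x; apply: (@continuousD _ _ _ (fun nu => Q.[pi nu]) (fun nu => d * nu ord0 i) x).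
    by apply: (@continuous_comp _ _ _ pi (horner Q)); [exact: cpi|exact: continuous_horner].
  apply: (@continuousM _ _ (cst d) (fun nu : 'rV[R]_n.+1 => nu ord0 i) x).
    exact: cst_continuous.
  exact: coord_continuous.
elim: N P c => [|N IH] P c; first by split.
split=> // v.
pose Q := (row_dot (y1 - y2) v) *: (P^`() * ('X - 'X ^+ 2)) + (c * v ord0 i)%:P.
have dP x : is_derive x v (fun nu => P.[pi nu] + c * nu ord0 i) (Q.[pi x] + 0 * x ord0 i).
  have d1 := is_derive_row_comp (is_derive_poly P (pi x)) (dpi x v).
  have d2 := is_deriveZ c (is_derive_coord x v i).
  have := is_deriveD d1 d2; move=> /is_derive_eq; apply.
  have -> : Q.[pi x] = row_dot (y1 - y2) v * (P^`().[pi x] * (pi x - pi x ^+ 2)) + c * v ord0 i.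
    by rewrite /Q hornerD hornerZ hornerM hornerC hornerD hornerN hornerX hornerXn.
  by rewrite -[c *: v ord0 i]/(c * v ord0 i); ring.
split; first by move=> x; have [] := dP x.
have -> : 'D_v (fun nu => P.[pi nu] + c * nu ord0 i) = fun x => Q.[pi x] + 0 * x ord0 i.
  by apply/funext => x; have [] := dP x.
exact: IH.
Qed.

Lemma smooth_js_score i : smooth (fun m => js_score m ord0 i).
Proof.
move=> N.
rewrite (_ : (fun _ => _) = fun nu =>
  ((y2 ord0 i)%:P + (y1 ord0 i - y2 ord0 i) *: 'X).[pi nu] + (- 1) * nu ord0 i).
  exact: cont_diff_pi.
by apply/funext => nu; rewrite /js_score -/(pi nu) !mxE hornerD hornerC hornerZ hornerX; ring.
Qed.

End js_score.

(** * The score is not degenerate *)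

(** Rearrangement of [w1 * r1 = w2 * r2] for radii [s] and [B / s], with [K * e1] and
    [K * e2] for the normal densities at the two preimages. The only factor besides
    [e1] and [e2] is a power of the ratio of the radii. *)
Lemma branch_weights_eq (R : realType) n (K e1 e2 s c B : R) :
  K != 0 -> 0 < s -> 0 < B -> 0 < c -> e1 != 0 ->
  K * e1 / ((1 + B / s ^+ 2) * (c / s) ^+ n) * s =
  K * e2 / ((1 + B / (B / s) ^+ 2) * (c / (B / s)) ^+ n) * (B / s) ->
  e2 / e1 = (s ^+ 2 / B) ^+ n.+2.
Proof.
move=> K0 s0 B0 c0 e10.
have sb : s ^+ 2 + B != 0 by rewrite gt_eqF// addr_gt0// exprn_gt0.
have sn0 : s != 0 by rewrite gt_eqF.
have bn0 : B != 0 by rewrite gt_eqF.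
have cn0 : c != 0 by rewrite gt_eqF.
pose Z := K / (c ^+ n * (s ^+ 2 + B)).
have Z0 : Z != 0 by rewrite !mulf_neq0 ?invr_eq0 ?mulf_neq0 ?expf_neq0.
have -> : K * e1 / ((1 + B / s ^+ 2) * (c / s) ^+ n) * s = Z * (e1 * s ^+ n.+3).
  rewrite /Z !expr_div_n !exprS; field.
  by rewrite -?expr2 sb sn0 !expf_neq0.
have -> : K * e2 / ((1 + B / (B / s) ^+ 2) * (c / (B / s)) ^+ n) * (B / s) =
    Z * (e2 * (B / s) ^+ n.+1 * B).
  rewrite /Z !expr_div_n !exprS; field.
  by rewrite -?expr2 sb sn0 bn0 !expf_neq0.
move=> /(mulfI Z0) E.
apply: (mulIf e10); rewrite divfK//.
have F0 : (B / s) ^+ n.+1 * B != 0 by rewrite mulf_neq0// expf_neq0// mulf_neq0// invr_eq0.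
apply: (mulIf F0); rewrite mulrA -E !expr_div_n !exprS expr0 !mulr1 !exprMn.
by field; rewrite sn0 bn0 !expf_neq0.
Qed.

(** Suppose the component of the score along some [v != 0] vanishes for all [t].
    Taking [t] orthogonal to [v] gives [m] orthogonal to [v]. Taking [t] along [v]
    then forces [w1 * r1 = w2 * r2] at every outer radius, an identity between an
    exponential and a power of the radius that cannot hold. *)
Section nondegenerate.
Context (R : realType) (n : nat).
Hypothesis n2 : (2 <= n)%N.
Local Notation b := (n.+1%:R - 2 : R).
Local Notation r := (js_branch b).
Variables (m v : 'rV[R]_n.+1).
Hypothesis v0 : v != 0.
Implicit Types t : 'rV[R]_n.+1.

Let b0 : 0 < b. Proof. exact: js_b_gt0. Qed.

Let dotZ (c : R) (x y : 'rV[R]_n.+1) : row_dot x (c *: y) = c * row_dot x y.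
Proof. by rewrite /row_dot mulr_sumr; apply: eq_bigr => i _; rewrite !mxE; ring. Qed.

Let dotB (x y z : 'rV[R]_n.+1) : row_dot x (y - z) = row_dot x y - row_dot x z.
Proof. by rewrite /row_dot -sumrB; apply: eq_bigr => i _; rewrite !mxE; ring. Qed.

Let dotD (x y z : 'rV[R]_n.+1) : row_dot x (y + z) = row_dot x y + row_dot x z.
Proof. by rewrite /row_dot -big_split/=; apply: eq_bigr => i _; rewrite !mxE; ring. Qed.

Let dot_score t : row_dot v (js_score t m) =
  (js_pi m t * js_r1 t - (1 - js_pi m t) * js_r2 t) / enorm t * row_dot v t - row_dot v m.
Proof. by rewrite /js_score dotD !dotZ !dotB !dotZ; ring. Qed.

Let orthogonal : exists2 t, t != 0 & row_dot v t = 0.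
Proof.
have [a va] : exists a, v ord0 a != 0.
  apply/existsP; rewrite -negb_forall; apply: contra_neqN v0 => /forallP h.
  by apply/rowP => i; rewrite mxE; apply/eqP.
have [c ca] : exists c : 'I_n.+1, c != a.
  have [->|a0] := eqVneq a ord0; last by exists ord0; rewrite eq_sym.
  by exists ord_max; rewrite -val_eqE/= -lt0n ltnW.
(* rotate the pair of coordinates a and c of v by a right angle *)
exists (v ord0 c *: delta_mx ord0 a - v ord0 a *: delta_mx ord0 c).
  apply/eqP => /rowP /(_ c); rewrite !mxE !eqxx (negbTE ca) !mulr0 mulr1 sub0r.
  by move/eqP; rewrite oppr_eq0 (negbTE va).
by rewrite dotB !dotZ !row_dot_delta mulrC subrr.
Qed.

Hypothesis degenerate : forall t, t != 0 -> row_dot v (js_score t m) = 0.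

Let vm0 : row_dot v m = 0.
Proof.
have [t t0 vt] := orthogonal.
by have := degenerate t0; rewrite dot_score vt mulr0 sub0r => /eqP; rewrite oppr_eq0 => /eqP.
Qed.

Let sqr_dist (c : R) : enorm (c *: v - m) ^+ 2 = enorm (c *: v) ^+ 2 + enorm m ^+ 2.
Proof.
have : row_dot v m * c * 2 = 0 by rewrite vm0 !mul0r.
rewrite !sqr_enorm -big_split/= /row_dot !mulr_suml => vm.
transitivity (\sum_i ((c *: v) ord0 i ^+ 2 + m ord0 i ^+ 2) -
    \sum_i v ord0 i * m ord0 i * c * 2); last by rewrite vm subr0.
by rewrite -sumrB; apply: eq_bigr => i _; rewrite !mxE; ring.
Qed.

(* t along v, scaled so that its outer preimage has norm s *)
Let branch_eq s : Num.sqrt b < s ->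
  expR ((s ^+ 2 - (b / s) ^+ 2) / 2) = (s ^+ 2 / b) ^+ n.+2.
Proof.
move=> bs.
have s0 : 0 < s by rewrite (le_lt_trans _ bs)// sqrtr_ge0.
have bs2 : b < s ^+ 2.
  by rewrite -(sqr_sqrtr (ltW b0)) ltr_pXn2r// ?nnegrE ?sqrtr_ge0// ltW.
pose c := s - b / s.
have c0 : 0 < c by rewrite subr_gt0 ltr_pdivrMr// -expr2.
have v1 : 0 < enorm v by rewrite enorm_gt0.
pose t := (c / enorm v) *: v.
have tc : enorm t = c by rewrite /t enormZ gtr0_norm ?divr_gt0// divfK ?gt_eqF.
have t0 : t != 0 by rewrite -enorm_gt0 tc.
have r1 : js_r1 t = s by rewrite -[LHS]/(r (enorm t)) tc js_branch_inv.
have r2 : js_r2 t = b / s.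
  rewrite js_r2E tc; apply: (mulfI (lt0r_neq0 s0)).
  rewrite -[X in X * _](js_branch_inv b0 s0) js_branch_mul//.
  by rewrite mulrCA divff ?mulr1// gt_eqF.
have vt : row_dot v t != 0.
  have -> : row_dot v t = c / enorm v * enorm v ^+ 2.
    by rewrite dotZ sqr_enorm; congr (_ * _); apply: eq_bigr => i _; rewrite expr2.
  by rewrite !mulf_neq0 ?expf_neq0 ?invr_eq0// gt_eqF.
have := degenerate t0; rewrite dot_score vm0 subr0 => /eqP.
rewrite !mulf_eq0 (negbTE vt) orbF invr_eq0 enorm_eq0 (negbTE t0) orbF subr_eq0 => /eqP.
rewrite r1 r2 /js_pi.
have w1 := js_w1_gt0 n2 m t0; have w2 := js_w2_gt0 n2 m t0.
move=> piE.
have {piE} wE : js_w1 m t * s = js_w2 m t * (b / s).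
  have w12 : js_w1 m t + js_w2 m t != 0 by rewrite gt_eqF// addr_gt0.
  move: piE; move: (js_w1 m t) (js_w2 m t) w12 => x y xy E.
  transitivity ((x + y) * (x / (x + y) * s)); first by field.
  by rewrite E; field; rewrite xy gt_eqF.
have gauss_t (q : R) : gauss_pdf m (q *: t) =
    (2 * pi) `^ (- (n.+1%:R / 2)) * expR (- (enorm m ^+ 2 / 2)) * expR (- ((q * c) ^+ 2 / 2)).
  rewrite /gauss_pdf -mulrA -expRD; congr (_ * expR _).
  rewrite /t scalerA sqr_dist -scalerA enormZ -/t tc exprMn real_normK ?num_real//.
  by rewrite exprMn; ring.
move: wE; rewrite /js_w1 /js_w2 /js_y1 /js_y2 !gauss_t r1 r2 tc /js_drho.
set K := _ * expR (- (enorm m ^+ 2 / 2)).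
have K0 : 0 < K by rewrite mulr_gt0 ?expR_gt0// powR_gt0// mulr_gt0// pi_gt0.
rewrite mulNr divfK ?gt_eqF// divfK ?gt_eqF// sqrrN.
have -> : (s ^+ 2 - (b / s) ^+ 2) / 2 = - ((b / s) ^+ 2 / 2) - - (s ^+ 2 / 2) by ring.
rewrite expRB.
move=> E; apply: (branch_weights_eq (lt0r_neq0 K0) s0 b0 c0 (lt0r_neq0 (expR_gt0 _))).
exact: E.
Qed.

(** Test the identity of [branch_eq] at [2 * sqrt b] and [4 * sqrt b]: the
    right-hand side gets squared, since 16 is the square of 4, so the exponent on
    the left would have to double, from [b * (15 / 8)] to [b * (15 / 4)]; it is
    [b * (255 / 32)]. *)
Lemma js_score_not_degenerate : False.
Proof.
have a0 : 0 < Num.sqrt b by rewrite sqrtr_gt0.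
have aa : Num.sqrt b ^+ 2 = b by rewrite sqr_sqrtr// ltW.
have l2 : Num.sqrt b < 2 * Num.sqrt b by lra.
have l4 : Num.sqrt b < 4 * Num.sqrt b by lra.
have E2 := branch_eq l2; have E4 := branch_eq l4.
have x2 : (2 * Num.sqrt b) ^+ 2 / b = 4.
  by rewrite exprMn aa mulfK ?gt_eqF// -natrX.
have x4 : (4 * Num.sqrt b) ^+ 2 / b = 4 ^+ 2.
  by rewrite exprMn aa mulfK ?gt_eqF.
have y2 : ((2 * Num.sqrt b) ^+ 2 - (b / (2 * Num.sqrt b)) ^+ 2) / 2 = b * (15 / 8).
  rewrite -[X in X / (_ * _)]aa; rewrite -[in RHS]aa; field; exact: lt0r_neq0.
have y4 : ((4 * Num.sqrt b) ^+ 2 - (b / (4 * Num.sqrt b)) ^+ 2) / 2 = b * (255 / 32).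
  rewrite -[X in X / (_ * _)]aa; rewrite -[in RHS]aa; field; exact: lt0r_neq0.
rewrite x2 y2 in E2; rewrite x4 y4 exprAC -E2 expr2 -expRD in E4.
by have := expR_inj E4; nra.
Qed.

End nondegenerate.

(** * Conditional expectations up to null sets *)

Lemma integrable_ae_eq d (T : measurableType d) (R : realType)
    (P : {measure set T -> \bar R}) (f g : T -> \bar R) :
  measurable_fun setT g -> ae_eq P setT f g ->
  P.-integrable setT f -> P.-integrable setT g.
Proof.
move=> mg [N [mN N0 subN]] /integrableP[mf fi]; apply/integrableP; split => //.
rewrite -(_ : \int[P]_x `|f x| = \int[P]_x `|g x|)%E//.
apply: ge0_ae_eq_integral => //; [exact: measurableT_comp|exact: measurableT_comp|].
exists N; split => // x /= H; apply: subN => /= H'; apply: H => _.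
by rewrite H'.
Qed.

Section cond_exp_unique.
Context d d' (T : measurableType d) (U : measurableType d') (R : realType).
Context (P : probability T R) (S : T -> U).
Hypothesis mS : measurable_fun setT S.

(** On the law of [S], both versions have the same integral over every measurable
    set. *)
Lemma is_cond_exp_ae_unique (X : T -> R) (e e' : U -> R) :
  is_cond_exp P S X e -> is_cond_exp P S X e' ->
  ae_eq P setT (EFin \o (e \o S)) (EFin \o (e' \o S)).
Proof.
move=> [_ me ie eP] [_ me' ie' e'P].
have int (f : U -> R) A : measurable_fun setT f -> P.-integrable setT (EFin \o (f \o S)) ->
    measurable A ->
    (\int[image_measure P mS]_(u in A) (f u)%:E = \int[P]_(w in S @^-1` A) (f (S w))%:E)%E.
  move=> mf i_f mA.
  apply: (@integral_pushforward _ _ _ _ R S mS P A (EFin \o f)) => //; first exact/measurable_EFinP.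
  apply: integrableS i_f => //.
  by rewrite -[X in measurable X]setTI; exact: mS.
have ii : (image_measure P mS).-integrable setT (EFin \o e).
  apply: (@integrable_pushforward _ _ _ _ R S mS P setT (EFin \o e)) => //; exact/measurable_EFinP.
have [N [mN N0 subN]] : ae_eq (image_measure P mS) setT (EFin \o e) (EFin \o e').
  apply: integral_ae_eq => //; first exact/measurable_EFinP.
  by move=> A _ mA; rewrite !int// -eP// e'P.
exists (S @^-1` N); split => //.
  by rewrite -[X in measurable X]setTI; exact: mS.
by move=> w /= H; apply: subN => /= H'; apply: H => _; exact: H'.
Qed.

(** A version may be changed on a set that [S] almost surely avoids. This passes
    from [js_mean] to the score or to [js_pi], which agree with it off the origin. *)
Lemma is_cond_exp_modify (X : T -> R) (e e' : U -> R) (N : set U) :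
  measurable N -> P (S @^-1` N) = 0%E -> measurable_fun setT e' ->
  (forall u, ~ N u -> e' u = e u) ->
  is_cond_exp P S X e -> is_cond_exp P S X e'.
Proof.
move=> mN N0 me' ee' [iX me ie eP].
have mSN : measurable (S @^-1` N) by rewrite -[X in measurable X]setTI; exact: mS.
have ae A : ae_eq P A (EFin \o (e \o S)) (EFin \o (e' \o S)).
  exists (S @^-1` N); split => // w /=; apply: contra_notP => Nw _.
  by rewrite ee'.
have meS' : measurable_fun setT (EFin \o (e' \o S)).
  by apply/measurable_EFinP; exact: (measurableT_comp me' mS).
have meS : measurable_fun setT (EFin \o (e \o S)).
  by apply/measurable_EFinP; exact: (measurableT_comp me mS).
split => //.
  by apply: (integrable_ae_eq meS' _ ie); exact: ae.
move=> A mA; rewrite eP//.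
have mSA : measurable (S @^-1` A) by rewrite -[X in measurable X]setTI; exact: mS.
by apply: ae_eq_integral => //; exact: measurable_funTS.
Qed.

Lemma Lfun1_ae (X Y : T -> R) : measurable_fun setT Y ->
  ae_eq P setT (EFin \o X) (EFin \o Y) -> X \in Lfun P 1 ->
  Y \in Lfun P 1 /\ rexp P Y = rexp P X.
Proof.
move=> mY XY X1; have mX := Lfun2_measurable X1.
have mEX : measurable_fun setT (EFin \o X) by exact/measurable_EFinP.
have mEY : measurable_fun setT (EFin \o Y) by exact/measurable_EFinP.
split.
  apply/Lfun1_integrable; apply: (integrable_ae_eq mEY XY).
  exact/Lfun1_integrable.
rewrite /rexp unlock; congr fine; apply: ae_eq_integral => //.
exact: ae_eq_sym.
Qed.

End cond_exp_unique.

(** * Moments of the score *)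

Section js_moments.
Context (R : realType) (n : nat).
Hypothesis n2 : (2 <= n)%N.
Variables (p : 'rV[R]_n.+1 -> 'rV[R]_n.+1 -> R) (m : 'rV[R]_n.+1).
Hypothesis hp :
  marginal_density (@gauss_row R n.+1) (@james_stein R n.+1) [set~ 0] p.
Local Notation P := (gauss_row m).
Local Notation js := (@james_stein R n.+1).
Local Notation Xc i := (fun y : 'rV[R]_n.+1 => (y - m) ord0 i).
Local Notation M i := (js_mean m (Xc i)).
Local Notation s i := (fun t : 'rV[R]_n.+1 => score p m t ord0 i).

Lemma js_scoreE i t : js_score t m ord0 i = M i t.
Proof. by rewrite /js_score mxE [X in X + _]mxE [X in _ + X]mxE. Qed.

(** The continuous version of the density is determined off the origin for every
    parameter, hence so is its gradient. *)
Lemma score_marginal t : t != 0 -> score p m t = js_score t m.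
Proof.
move=> t0; rewrite -(score_js_density n2 t0) /score.
have -> : (fun nu => ln (p nu t)) = (fun nu => ln (js_density nu t)) => //.
by apply/funext => nu; rewrite (js_density_unique n2 hp nu t0).
Qed.

Let scoreE i t : t != 0 -> s i t = M i t.
Proof. by move=> t0 /=; rewrite score_marginal// js_scoreE. Qed.

Let m0 : measurable (js @^-1` [set 0]).
Proof.
by rewrite -[X in measurable X]setTI; apply: measurable_js => //; exact: measurable_row0.
Qed.

(** By the change of variables: the preimages of [t != 0] are never mapped to the
    origin. *)
Lemma lebesgue_js_eq0 : lebesgue_row R n.+1 (js @^-1` [set 0]) = 0%E.
Proof.
transitivity (\int[lebesgue_row R n.+1]_y (\1_(js @^-1` [set 0]) y)%:E)%E.
  by rewrite integral_indic// setIT.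
rewrite ge0_integral_js_branches//; last first.
  by apply/measurable_EFinP; exact: measurable_indic.
have mI : measurable_fun setT (fun y => (\1_(js @^-1` [set 0]) y)%:E : \bar R).
  by apply/measurable_EFinP; exact: measurable_indic.
have mpj e : measurable_fun setT (fun t => (\1_(js @^-1` [set 0]) (js_preim e t))%:E * (js_jac e t)%:E)%E.
  apply: emeasurable_funM; last by apply/measurable_EFinP; exact: measurable_js_jac.
  exact: (measurableT_comp mI (measurable_js_preim n2 e)).
have pj0 e t : (0 <= ((\1_(js @^-1` [set 0]) (js_preim e t))%:E : \bar R) * (js_jac e t)%:E)%E.
  by rewrite mule_ge0// lee_fin js_jac_ge0.
rewrite (@ge0_integral_row_neq0 R n _ (cst 0%E)).
- by rewrite integral0.
- by apply: emeasurable_funD; exact: mpj.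
- exact: measurable_cst.
- by move=> t; apply: adde_ge0; exact: pj0.
- by [].
move=> t t0.
have z e : `|e| = 1 -> (\1_(js @^-1` [set 0]) (js_preim e t) : R) = 0.
  move=> e1; rewrite indicE memNset//= js_preimK//; exact/eqP.
by rewrite !z ?normrN ?normr1// !mul0e adde0.
Qed.

Lemma gauss_js_eq0 : P (js @^-1` [set 0]) = 0%E.
Proof. by apply: null_set_integral => //; [exact: measurable_funTS (measurable_gauss_pdf_EFin m)|exact: lebesgue_js_eq0]. Qed.

Let mX i : measurable_fun setT (Xc i). Proof. exact: measurable_gauss_coord. Qed.
Let mM i : measurable_fun setT (M i).
Proof. exact: measurable_js_mean. Qed.

Lemma measurable_score i : measurable_fun setT (s i).
Proof.
pose I0 t : R := \1_[set (0 : 'rV[R]_n.+1)] t.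
have mI0 : measurable_fun setT I0 by apply: measurable_indic; exact: measurable_row0.
rewrite (_ : s i = fun t => I0 t * s i 0 + (1 - I0 t) * M i t).
  apply: measurable_funD; apply: measurable_funM => //.
  exact: measurable_funB.
apply/funext => t; rewrite /I0 indicE.
have [->|t0] := eqVneq t 0; first by rewrite mem_set// mul1r subrr mul0r addr0.
by rewrite memNset ?mul0r ?add0r ?subr0 ?mul1r ?scoreE//; exact/eqP.
Qed.

Let X2 i : Xc i \in Lfun P 2%:E. Proof. exact: gauss_coord_Lfun2. Qed.
Let X1 i : Xc i \in Lfun P 1. Proof. exact: Lfun2_Lfun1. Qed.

Lemma js_score_is_cond_exp i : is_cond_exp P js (Xc i) (s i).
Proof.
apply: (@is_cond_exp_modify _ _ _ _ R P js (@measurable_js R n) (Xc i) (M i) (s i) [set 0]).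
- exact: measurable_row0.
- exact: gauss_js_eq0.
- exact: measurable_score.
- by move=> t /eqP t0; rewrite scoreE.
- exact: js_is_cond_exp.
Qed.

Let mMj i : measurable_fun setT (fun y => M i (js y)).
Proof. exact: (measurableT_comp (mM i) (@measurable_js R n)). Qed.

Let msj i : measurable_fun setT (fun y => s i (js y)).
Proof. exact: (measurableT_comp (@measurable_score i) (@measurable_js R n)). Qed.

Let js_ae (F G : 'rV[R]_n.+1 -> R) : (forall y, js y != 0 -> F y = G y) ->
  ae_eq P setT (EFin \o F) (EFin \o G).
Proof.
move=> FG; exists (js @^-1` [set 0]); split => //; first exact: gauss_js_eq0.
by move=> y /=; apply: contra_notP => /eqP y0 _; rewrite FG.
Qed.

(* Conditional Jensen: the square of the mean of two values is at most the mean
   of their squares, the difference being q * (1 - q) * (a - c) ^ 2. *)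
Let M2 i : (fun y => M i (js y)) \in Lfun P 2%:E.
Proof.
apply: Lfun2_sqr => //.
have [L _] := rexp_js_mean n2 (Lfun2_mul (X2 i) (X2 i)).
apply: (Lfun1_le _ L); first exact: measurable_funX.
move=> y /=; rewrite ger0_norm ?sqr_ge0// ger0_norm; last first.
  by apply: js_mean_ge0 => // z; rewrite -expr2 sqr_ge0.
rewrite /js_mean; have /andP[q0 q1] := js_pi_ge0_le1 n2 m (js y).
move: (Xc i _) (Xc i _) (js_pi m (js y)) q0 q1 => a c q q0 q1.
have : 0 <= q * (1 - q) * (a - c) ^+ 2.
  by rewrite mulr_ge0 ?sqr_ge0// mulr_ge0// subr_ge0.
by nra.
Qed.

Lemma js_mean_mul_Lfun1 i j : (fun y => M i (js y) * M j (js y)) \in Lfun P 1.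
Proof. exact: Lfun2_mul. Qed.

Lemma score_js_Lfun2 i : (fun y => s i (js y)) \in Lfun P 2%:E.
Proof.
apply: Lfun2_sqr => //.
have L : (fun y => M i (js y) ^+ 2) \in Lfun P 1.
  by have := Lfun2_mul (M2 i) (M2 i); under eq_fun do rewrite -expr2.
apply: (Lfun1_ae _ _ L).1; first exact: measurable_funX.
by apply: js_ae => y y0; rewrite scoreE.
Qed.

(** Entries of the Fisher information of the marginal model, expressed with the
    conditional mean of the full score. *)
Definition js_info i j : R := rexp P (fun y => M i (js y) * M j (js y)).

Lemma rexp_score_js i : rexp P (fun y => s i (js y)) = 0.
Proof.
have [M1 ME] := rexp_js_mean n2 (X1 i).
rewrite -(rexp_gauss_coord m i) -ME.
apply: (Lfun1_ae _ _ M1).2 => //.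
by apply: js_ae => y y0; rewrite scoreE.
Qed.

Lemma rexp_score_js2 i j : rexp P (fun y => s i (js y) * s j (js y)) = js_info i j.
Proof.
apply: (Lfun1_ae _ _ (Lfun2_mul (M2 i) (M2 j))).2; first exact: measurable_funM.
by apply: js_ae => y y0; rewrite !scoreE.
Qed.

(* Tower property: a function of the statistic factors out of [js_mean]. *)
Let rexp_coord_mean i j : rexp P (fun y => Xc i y * M j (js y)) = js_info i j.
Proof.
have [L <-] := rexp_js_mean n2 (Lfun2_mul (X2 i) (M2 j)).
apply: (Lfun1_ae _ _ (Lfun2_mul (M2 i) (M2 j))).2.
  exact: (measurableT_comp (measurable_js_mean n2 m (measurable_funM (mX i) (mMj j))) (@measurable_js R n)).
apply: js_ae => y y0 /=; rewrite [in RHS]/js_mean.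
have -> : js (js_y1 (js y)) = js y by rewrite js_y1E js_preimK// normr1.
have -> : js (js_y2 (js y)) = js y by rewrite js_y2E js_preimK// normrN normr1.
by rewrite [M i]lock /js_mean -lock mulrDl !mulrA.
Qed.

Lemma rexp_score_js_coord i j : rexp P (fun y => s i (js y) * Xc j y) = js_info i j.
Proof.
transitivity (rexp P (fun y => M i (js y) * Xc j y)).
  apply: (Lfun1_ae _ _ (Lfun2_mul (M2 i) (X2 j))).2; first exact: measurable_funM.
  by apply: js_ae => y y0; rewrite scoreE.
transitivity (rexp P (fun y => Xc j y * M i (js y))).
  by congr rexp; apply/funext => y; rewrite mulrC.
rewrite rexp_coord_mean /js_info.
by congr rexp; apply/funext => y; rewrite mulrC.
Qed.

(** Pythagoras: the residual of the conditional mean is orthogonal to functions of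
    the statistic, so its covariance is the identity minus that of the conditional
    mean. *)
Lemma rexp_residual i j :
  (fun y => (Xc i y - M i (js y)) * (Xc j y - M j (js y))) \in Lfun P 1 /\
  rexp P (fun y => (Xc i y - M i (js y)) * (Xc j y - M j (js y))) =
  (i == j)%:R - js_info i j.
Proof.
have D2 l : (fun y => Xc l y - M l (js y)) \in Lfun P 2%:E.
  by rewrite rpredB ?lee1n//= => _; exact: M2.
split; first exact: Lfun2_mul.
have -> : (fun y => (Xc i y - M i (js y)) * (Xc j y - M j (js y))) = fun y =>
    (Xc i y * Xc j y - Xc i y * M j (js y)) - (Xc j y * M i (js y) - M i (js y) * M j (js y)).
  by apply/funext => y; ring.
have XX := Lfun2_mul (X2 i) (X2 j); have XM := Lfun2_mul (X2 i) (M2 j).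
have MX := Lfun2_mul (X2 j) (M2 i); have MM := Lfun2_mul (M2 i) (M2 j).
rewrite rexpB; [|exact: rpredB|exact: rpredB].
rewrite !rexpB// rexp_gauss_coord2 !rexp_coord_mean.
have -> : js_info j i = js_info i j.
  by rewrite /js_info; congr rexp; apply/funext => y; rewrite mulrC.
by rewrite -/(js_info i j) subrr subr0.
Qed.

(** In integral form against [js_density], positive off the origin, positivity
    near one point is enough. *)
Lemma rexp_js_gt0 (h : 'rV[R]_n.+1 -> R) t : measurable_fun setT h ->
  (forall u, 0 <= h u) -> (fun y => h (js y)) \in Lfun P 1 ->
  t != 0 -> {for t, continuous h} -> 0 < h t ->
  0 < rexp P (fun y => h (js y)).
Proof.
move=> mh h0 L t0 ct ht; rewrite -lte_fin -rexpE// unlock.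
rewrite (ge0_integral_js_density n2 m mh h0).
apply: (@continuous_integral_gt0 R n.+1 (fun t => h t * js_density m t) t).
- apply: measurable_funM => //; exact: measurable_js_density.
- by move=> u; rewrite mulr_ge0// js_density_ge0.
- apply: (@continuousM _ _ h (js_density m) t) => //; exact: continuous_js_density.
- by rewrite mulr_gt0// js_density_gt0.
Qed.

(** The deficit is the mean of the conditional variance of a two-point law,
    [pi * (1 - pi) * (y1_i - y2_i) ^ 2], which is positive at the [i]-th unit vector:
    the two preimages lie on opposite sides of the origin. *)
Lemma js_info_diag_lt1 i : js_info i i < 1.
Proof.
have [L E] := rexp_residual i i.
rewrite eqxx in E; rewrite -subr_gt0 -[X in X - _]/(true%:R) -E.
pose kap t := js_pi m t * (1 - js_pi m t) * (js_y1 t ord0 i - js_y2 t ord0 i) ^+ 2.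
have mkap : measurable_fun setT kap.
  have mpi := measurable_js_pi n2 m.
  apply: measurable_funM; first by apply: measurable_funM => //; exact: measurable_funB.
  apply: measurable_funX; apply: measurable_funB; apply: measurable_coord.
    exact: measurable_js_y1.
  exact: measurable_js_y2.
have kap0 t : 0 <= kap t.
  have /andP[q0 q1] := js_pi_ge0_le1 n2 m t.
  by rewrite mulr_ge0 ?sqr_ge0// mulr_ge0// subr_ge0.
have [L' E'] := rexp_js_mean n2 L.
have [K1 KE] : (fun y => kap (js y)) \in Lfun P 1 /\ rexp P (fun y => kap (js y)) =
    rexp P (fun y => (Xc i y - M i (js y)) * (Xc i y - M i (js y))).
  rewrite -E'; apply: (Lfun1_ae _ _ L').
    exact: (measurableT_comp mkap (@measurable_js R n)).
  apply: js_ae => y y0 /=; rewrite [LHS]/js_mean.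
  have -> : js (js_y1 (js y)) = js y by rewrite js_y1E js_preimK// normr1.
  have -> : js (js_y2 (js y)) = js y by rewrite js_y2E js_preimK// normrN normr1.
  have XE (z : 'rV[R]_n.+1) : Xc i z = z ord0 i - m ord0 i by rewrite !mxE.
  rewrite /js_mean !XE /kap.
  by move: (js_y1 _ _ _) (js_y2 _ _ _) (js_pi _ _) => a c q; ring.
rewrite -KE.
pose t : 'rV[R]_n.+1 := delta_mx ord0 i.
have t0 : t != 0.
  by apply/eqP => /rowP /(_ i) /eqP; rewrite !mxE !eqxx oner_eq0.
apply: (rexp_js_gt0 mkap kap0 K1 t0).
- have cpi := continuous_js_pi n2 (m := m) t0.
  apply: (@continuousM _ _ (fun t => js_pi m t * (1 - js_pi m t))
    (fun t => (js_y1 t ord0 i - js_y2 t ord0 i) ^+ 2) t).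
    apply: (@continuousM _ _ (js_pi m) (fun t => 1 - js_pi m t) t) => //.
    apply: (@continuous_comp _ _ _ (js_pi m) (fun q : R => 1 - q)) => //.
    by apply: continuousB; [exact: cst_continuous|exact: cvg_id].
  have cB := @continuousB R R^o _ _ _ t (continuous_js_y1 n2 (i := i) t0) (continuous_js_y2 n2 (i := i) t0).
  exact: (@continuousM _ _ _ _ t cB cB).
- have /andP[q0 q1] := js_pi_lt01 n2 m t0.
  rewrite /kap mulr_gt0//; first by rewrite mulr_gt0// subr_gt0.
  have -> : js_y1 t ord0 i - js_y2 t ord0 i = (js_r1 t + js_r2 t) / enorm t.
    have tE : t ord0 i = 1 by rewrite mxE !eqxx.
    rewrite /js_y1 /js_y2 [X in X - _]mxE [X in _ - X]mxE tE; ring.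
  rewrite exprn_gt0// divr_gt0 ?enorm_gt0// addr_gt0//.
    exact: (js_branch_gt0 (@js_b_gt0 R n n2) (enorm t)).
  rewrite js_r2E; exact: (js_branch_gt0 (@js_b_gt0 R n n2)).
Qed.

End js_moments.

Section rexp_sum.
Context d (T : measurableType d) (R : realType) (P : probability T R).

Lemma rexpZ (c : R) X : X \in Lfun P 1 ->
  (fun w => c * X w) \in Lfun P 1 /\ rexp P (fun w => c * X w) = c * rexp P X.
Proof.
move=> X1; have cX1 : (fun w => c * X w) \in Lfun P 1 by exact: (rpredZ c X1).
split => //; apply: EFin_inj; rewrite EFinM -!rexpE//.
rewrite -expectationZl//; congr ('E_P[_])%E.
by apply/funext => w; rewrite /= mulrC.
Qed.

Lemma rexp_sum (I : Type) (r : seq I) (F : I -> T -> R) :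
  (forall i, F i \in Lfun P 1) ->
  (fun w => \sum_(i <- r) F i w) \in Lfun P 1 /\
  rexp P (fun w => \sum_(i <- r) F i w) = \sum_(i <- r) rexp P (F i).
Proof.
move=> F1; elim: r => [|i r [IH1 IH2]].
  rewrite (_ : (fun _ => _) = cst 0); last by apply/funext => w; rewrite big_nil.
  split; first exact: Lfun_cst.
  by rewrite big_nil /rexp expectation_cst.
rewrite (_ : (fun _ => _) = fun w => F i w + \sum_(j <- r) F j w); last first.
  by apply/funext => w; rewrite big_cons.
split; first exact: rpredD.
by rewrite rexpD// IH2 big_cons.
Qed.

End rexp_sum.

Section js_info_posdef.
Context (R : realType) (n : nat).
Hypothesis n2 : (2 <= n)%N.
Variable m : 'rV[R]_n.+1.
Local Notation P := (gauss_row m).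
Local Notation js := (@james_stein R n.+1).

Lemma js_info_sym i j : js_info m i j = js_info m j i.
Proof. by rewrite /js_info; congr rexp; apply/funext => y; rewrite mulrC. Qed.

Lemma continuous_js_mean_coord i t : t != 0 ->
  {for t, continuous (js_mean m (fun y : 'rV[R]_n.+1 => (y - m) ord0 i))}.
Proof.
move=> t0; have cpi := continuous_js_pi n2 (m := m) t0.
rewrite (_ : js_mean m _ = fun t => js_pi m t * (js_y1 t ord0 i - m ord0 i) +
    (1 - js_pi m t) * (js_y2 t ord0 i - m ord0 i)); last first.
  have XE (z : 'rV[R]_n.+1) : (z - m) ord0 i = z ord0 i - m ord0 i by rewrite !mxE.
  by apply/funext => u; rewrite /js_mean !XE.
apply: (@continuousD R R^o _ (fun t => js_pi m t * (js_y1 t ord0 i - m ord0 i))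
  (fun t => (1 - js_pi m t) * (js_y2 t ord0 i - m ord0 i)) t).
  apply: (@continuousM _ _ (js_pi m) (fun t => js_y1 t ord0 i - m ord0 i) t) => //.
  apply: (@continuousB R R^o _ _ _ t); last exact: cst_continuous.
  exact: continuous_js_y1.
apply: (@continuousM _ _ (fun t => 1 - js_pi m t) (fun t => js_y2 t ord0 i - m ord0 i) t).
  by apply: (@continuousB R R^o _ _ _ t) => //; exact: cst_continuous.
apply: (@continuousB R R^o _ _ _ t); last exact: cst_continuous.
exact: continuous_js_y2.
Qed.

(** A vector [v] in the kernel has [E (v . s) ^ 2 = 0], and by continuity the
    component of the score along [v] vanishes off the origin, which
    [js_score_not_degenerate] excludes. *)
Lemma js_info_unit : (\matrix_(i, j) js_info m i j) \in unitmx.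
Proof.
set A := \matrix_(i, j) _.
rewrite -[_ \in _]negbK; apply/negP; rewrite unitmxE unitfE negbK => /det0P[v v0 vA].
apply: (@js_score_not_degenerate _ _ n2 m v v0) => t t0; apply/eqP/contraT => d0.
pose M i := js_mean m (fun y : 'rV[R]_n.+1 => (y - m) ord0 i).
pose h t := row_dot v (js_score t m) ^+ 2.
have hE u : h u = \sum_i \sum_j (v ord0 i * v ord0 j) * (M i u * M j u).
  rewrite /h /row_dot expr2 mulr_suml; apply: eq_bigr => i _.
  rewrite mulr_sumr; apply: eq_bigr => j _.
  by rewrite !js_scoreE mulrACA.
have MM i j : (fun y => M i (js y) * M j (js y)) \in Lfun P 1 by exact: js_mean_mul_Lfun1.
have MZ i j := rexpZ (v ord0 i * v ord0 j) (MM i j).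
have MS i := @rexp_sum _ _ _ P _ (index_enum 'I_n.+1) _ (fun j => (MZ i j).1).
have [L E] := @rexp_sum _ _ _ P _ (index_enum 'I_n.+1) _ (fun i => (MS i).1).
have hjs : (fun y => h (js y)) =
    fun y => \sum_i \sum_j (v ord0 i * v ord0 j) * (M i (js y) * M j (js y)).
  by apply/funext => y; rewrite hE.
have mM i : measurable_fun setT (M i) by exact: measurable_js_mean (measurable_gauss_coord _ _).
have hS : h = fun u => (\sum_i v ord0 i * M i u) ^+ 2.
  by apply/funext => u; rewrite /h; congr (_ ^+ 2); apply: eq_bigr => i _; rewrite js_scoreE.
have : 0 < rexp P (fun y => h (js y)).
  apply: (@rexp_js_gt0 _ _ n2 m h t) => //.
  - by rewrite hS; apply: measurable_funX; apply: measurable_sum => i; exact: measurable_funM.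
  - by move=> u; rewrite sqr_ge0.
  - by rewrite hjs.
  - rewrite hS; apply: (@continuous_comp _ _ _ (fun u => \sum_i v ord0 i * M i u) (fun x : R => x ^+ 2)).
      apply: (@cvg_big R^o _ +%R 0 xpredT _ _ (nbhs t)) => [|i _]; first exact: add_continuous.
      apply: (@continuousM _ _ (cst (v ord0 i)) (M i) t); first exact: cst_continuous.
      exact: continuous_js_mean_coord.
    exact: exprn_continuous.
  - by rewrite exprn_even_gt0.
rewrite hjs E => /lt0r_neq0/eqP; case.
under eq_bigr do rewrite (MS _).2.
rewrite exchange_big/= big1// => j _.
transitivity (v ord0 j * (v *m A) ord0 j); last by rewrite vA mxE mulr0.
rewrite [in RHS]mxE mulr_sumr; apply: eq_bigr => i _.
by rewrite (MZ i j).2 mxE mulrAC mulrC mulrA.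
Qed.

End js_info_posdef.

(** * Conditional covariance and moment matrices *)

Section conditional_covariance.
Context (R : realType) (n : nat).
Hypothesis n2 : (2 <= n)%N.
Variable m : 'rV[R]_n.+1.
Local Notation P := (gauss_row m).
Local Notation js := (@james_stein R n.+1).
Local Notation Xc i := (fun y : 'rV[R]_n.+1 => (y - m) ord0 i).
Local Notation M i := (js_mean m (Xc i)).

Let XE i (y : 'rV[R]_n.+1) : (y - m) ord0 i = y ord0 i - m ord0 i.
Proof. by rewrite /= !mxE. Qed.

Lemma coord_is_cond_exp i :
  is_cond_exp P js (fun y => y ord0 i) (fun t => m ord0 i + M i t).
Proof.
have Y1 : (fun y : 'rV[R]_n.+1 => y ord0 i) \in Lfun P 1.
  rewrite (_ : (fun _ => _) = Xc i \+ cst (m ord0 i)); last first.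
    by apply/funext => y /=; rewrite XE subrK.
  rewrite rpredD//; last exact: Lfun_cst.
  exact/Lfun2_Lfun1/gauss_coord_Lfun2.
have := js_is_cond_exp n2 Y1; congr (is_cond_exp _ _ _ _).
by apply/funext => t; rewrite /js_mean !XE; ring.
Qed.

Lemma exists_js_cond_cov : exists V, is_cond_cov P js (@id 'rV[R]_n.+1) V.
Proof.
exists (fun t => \matrix_(i, j)
  js_mean m (fun y => (Xc i y - M i (js y)) * (Xc j y - M j (js y))) t).
exists (fun t => \row_i (m ord0 i + M i t)); split => [i|i j].
  have := coord_is_cond_exp i; congr (is_cond_exp _ _ _ _).
  by apply/funext => t; rewrite mxE.
have := js_is_cond_exp n2 (rexp_residual n2 m i j).1.
congr (is_cond_exp _ _ _ _); apply/funext => y; last by rewrite mxE.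
by rewrite !XE !mxE !opprD !addrA.
Qed.

(** Any version of the conditional mean agrees almost surely with [m + M], so the
    expectation of a version of the conditional covariance is that of the products
    of residuals. *)
Lemma js_cond_cov_expect V i j : is_cond_cov P js (@id 'rV[R]_n.+1) V ->
  expect_mx P (fun y => V (js y)) i j = (i == j)%:R - js_info m i j.
Proof.
move=> [mh [mh1 VP]]; have [iX mV iV EV] := VP i j.
rewrite mxE; have [L <-] := rexp_residual n2 m i j.
have -> : fine 'E_P[fun y => V (js y) i j] =
    rexp P (fun y => (y ord0 i - mh (js y) ord0 i) * (y ord0 j - mh (js y) ord0 j)).
  rewrite /rexp unlock; congr fine.
  by have := EV _ measurableT; rewrite preimage_setT.
have mX := Lfun2_measurable ((Lfun1_integrable _ _).2 iX).
apply: (Lfun1_ae mX _ L).2.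
have ae l := is_cond_exp_ae_unique (@measurable_js R n) (coord_is_cond_exp l) (mh1 l).
move: (ae i) (ae j); apply: filterS2 => y /= /(_ I) [nA] /(_ I) [nB] _.
by rewrite -nA -nB !XE !opprD !addrA.
Qed.

(** The indicator of the outer region is 1 at the outer preimage and 0 at the inner
    one, so its [js_mean] is [js_pi]. *)
Lemma js_pi_is_cond_exp :
  is_cond_exp P js (\1_[set y | Num.sqrt (n.+1%:R - 2) < enorm y]) (js_pi m).
Proof.
set O := [set y | _].
have mO : measurable O.
  rewrite -[X in measurable X]setTI.
  by apply: measurable_fun_ltr => //; exact: measurable_enorm.
have O1 : (\1_O : 'rV[R]_n.+1 -> R) \in Lfun P 1.
  apply: Lfun1_le (Lfun_cst P 1 1) _; first exact: measurable_indic.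
  by move=> y; rewrite /= normr1 indicE ger0_norm ?ler0n//; case: (_ \in _).
apply: (@is_cond_exp_modify _ _ _ _ R P js (@measurable_js R n) \1_O
  (js_mean m \1_O) (js_pi m) [set 0]).
- exact: measurable_row0.
- exact: gauss_js_eq0.
- exact: measurable_js_pi.
- move=> t /eqP t0; have /andP[h2 h1] := js_pi_lt01 n2 m t0.
  have /andP[l2 l1] := js_preim_norms n2 t0.
  rewrite /js_mean !indicE mem_set// memNset ?mulr0 ?addr0 ?mulr1//.
  by apply/negP; rewrite -leNgt ltW.
- exact: js_is_cond_exp.
Qed.

End conditional_covariance.

Section moment_matrices.
Context d (T : measurableType d) (R : realType) (P : probability T R) (k : nat).
Implicit Types X Y : T -> 'rV[R]_k.

Lemma cov_mx_rexp X Y i j :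
  (forall i, (fun w => X w ord0 i) \in Lfun P 2%:E) ->
  (forall i, (fun w => Y w ord0 i) \in Lfun P 2%:E) ->
  (forall i, rexp P (fun w => X w ord0 i) = 0) ->
  cov_mx P X Y i j = rexp P (fun w => X w ord0 i * Y w ord0 j).
Proof.
move=> X2 Y2 X0; rewrite mxE covarianceE.
- by rewrite [X in (_ - X * _)%E]rexpE ?X0 ?mul0e ?sube0//; exact: Lfun2_Lfun1.
- exact: Lfun2_Lfun1.
- exact: Lfun2_Lfun1.
- exact: Lfun2_mul.
Qed.

Lemma fisher_info_rexp X i j :
  fisher_info P X i j = rexp P (fun w => X w ord0 i * X w ord0 j).
Proof.
rewrite mxE /rexp; congr (fine 'E_P[_]).
by apply/funext => w; rewrite mxE big_ord1 mxE.
Qed.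

End moment_matrices.

(** The identity is a root of itself, so the chosen root is a genuine one and its
    square is the identity. *)
Lemma inv_sqrt_mx1 (R : realType) k :
  inv_sqrt_mx (1%:M : 'M[R]_k) *m inv_sqrt_mx 1%:M = 1%:M.
Proof.
rewrite /inv_sqrt_mx; case: xgetP => [J _ []|/(_ 1%:M)]; first by rewrite mulmx1.
case; split; [exact: trmx1| |by rewrite !mulmx1].
move=> v; rewrite mulmx1 mxE sumr_ge0// => i _.
by rewrite mxE -expr2 sqr_ge0.
Qed.

(** * Information and efficiency *)

Section js_efficiency.
Context (R : realType) (n : nat).
Hypothesis n2 : (2 <= n)%N.
Variable p : 'rV[R]_n.+1 -> 'rV[R]_n.+1 -> R.
Hypothesis hp :
  marginal_density (@gauss_row R n.+1) (@james_stein R n.+1) [set~ 0] p.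
Local Notation js := (@james_stein R n.+1).
Local Notation g := (fun y mu : 'rV[R]_n.+1 => score p mu (js y)).
Implicit Types m : 'rV[R]_n.+1.

Lemma js_generalized_estimator : generalized_estimator g.
Proof.
split.
- by move=> m i; exact: score_js_Lfun2.
- move=> m i; rewrite rexpE ?rexp_score_js//.
  exact/Lfun2_Lfun1/score_js_Lfun2.
- exists (js @^-1` [set 0]); split.
  + rewrite -[X in measurable X]setTI.
    by apply: (@measurable_js R n) => //; exact: measurable_row0.
  + exact: lebesgue_js_eq0.
  + move=> y /=; apply: contra_notP => /eqP y0 i.
    rewrite (_ : (fun mu => _) = fun mu => js_score (js y) mu ord0 i).
      exact: smooth_js_score.
    by apply/funext => mu; rewrite (score_marginal n2 _ hp).
Qed.

Let info m : 'M[R]_n.+1 := \matrix_(i, j) js_info m i j.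

Lemma js_fisher_info m : fisher_info (gauss_row m) (g^~ m) = info m.
Proof. by apply/matrixP => i j; rewrite fisher_info_rexp rexp_score_js2// [RHS]mxE. Qed.

Lemma js_cov_score m : cov_mx (gauss_row m) (g^~ m) (g^~ m) = info m.
Proof.
apply/matrixP => i j; rewrite cov_mx_rexp.
- by rewrite rexp_score_js2// [RHS]mxE.
- by move=> l; exact: score_js_Lfun2.
- by move=> l; exact: score_js_Lfun2.
- by move=> l; exact: rexp_score_js.
Qed.

(** The score of [y] has conditional mean the score of the statistic, so their
    covariance is the variance of the latter. *)
Lemma js_cov_full_score m :
  cov_mx (gauss_row m) (g^~ m) (score (@gauss_pdf R n.+1) m) = info m.
Proof.
rewrite (_ : score _ m = fun y => y - m); last first.
  by apply/funext => y; rewrite score_gauss_pdf.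
apply/matrixP => i j; rewrite cov_mx_rexp.
- by rewrite rexp_score_js_coord// [RHS]mxE.
- by move=> l; exact: score_js_Lfun2.
- by move=> l; exact: gauss_coord_Lfun2.
- by move=> l; exact: rexp_score_js.
Qed.

(** Here [C = V], so [C^T V^-1 C] collapses to [V]. *)
Lemma js_Lambda m : Lambda g m = info m.
Proof.
rewrite /Lambda js_cov_score js_cov_full_score.
have -> : (info m)^T = info m.
  by apply/matrixP => i j; rewrite !mxE js_info_sym.
by rewrite mulmxV ?mul1mx//; exact: js_info_unit.
Qed.

Lemma gauss_fisher_info m :
  fisher_info (gauss_row m) (score (@gauss_pdf R n.+1) m) = 1%:M.
Proof.
apply/matrixP => i j; rewrite fisher_info_rexp.
transitivity (rexp (gauss_row m) (fun y => (y - m) ord0 i * (y - m) ord0 j)).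
  by congr rexp; apply/funext => y; rewrite score_gauss_pdf.
by rewrite rexp_gauss_coord2 [RHS]mxE.
Qed.

(** With [J *m J = 1], the trace of [J *m Lambda *m J] is that of [Lambda], a sum of
    diagonal entries below one. *)
Lemma js_efficiency_lt1 m : n.+1%:R^-1 * \tr (efficiency g m) < 1.
Proof.
rewrite /efficiency gauss_fisher_info js_Lambda mxtrace_mulC mulmxA.
rewrite inv_sqrt_mx1 mul1mx ltr_pdivrMl ?ltr0n// mulr1.
have -> : n.+1%:R = \sum_(i < n.+1) (1 : R) by rewrite sumr_const card_ord.
rewrite /mxtrace; apply: ltr_sum => [|i _]; last by rewrite mxE js_info_diag_lt1.
by apply/hasP; exists ord0 => //; rewrite mem_index_enum.
Qed.

End js_efficiency.

Theorem mainTheorem6 (R : realType) (k : nat) (hk : (3 <= k)%N) :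
  let js := @james_stein R k in
  let is_js_density := marginal_density (@gauss_row R k) js [set~ 0] in
  (exists p, is_js_density p) /\
  forall p : 'rV[R]_k -> 'rV[R]_k -> R, is_js_density p ->
  let g := fun y mu : 'rV[R]_k => score p mu (js y) in
  generalized_estimator g /\
  forall mu : 'rV[R]_k,
  let P := gauss_row mu in
  let I_js := fisher_info P (g^~ mu) in
  let EV := fun V : 'rV[R]_k -> 'M[R]_k => expect_mx P (fun y => V (js y)) in
  (* (a) *)
  [/\ forall t, t != 0 ->
        [/\ js @^-1` [set t] = [set js_y1 t; js_y2 t],
            enorm (js_y2 t) < Num.sqrt (k%:R - 2) < enorm (js_y1 t),
            0 < p mu t /\ differentiable (fun nu => ln (p nu t)) mu,
            score p mu t = js_pi mu t *: (js_y1 t - mu) +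
                           (1 - js_pi mu t) *: (js_y2 t - mu) &
            0 < js_pi mu t < 1],
      forall i, is_cond_exp P js
        (fun y => (y - mu) ord0 i) (fun t => score p mu t ord0 i) &
      is_cond_exp P js
        (\1_[set y | Num.sqrt (k%:R - 2) < enorm y]) (js_pi mu)]
  /\
  (* (b) *)
  [/\ cov_mx P (g^~ mu) (g^~ mu) \in unitmx,
      Lambda g mu = I_js,
      exists V, is_cond_cov P js id V &
      forall V, is_cond_cov P js id V -> I_js = 1%:M - EV V]
  /\
  (* (c) *)
  (forall V, is_cond_cov P js id V -> EV V != 0) /\
  k%:R^-1 * \tr (efficiency g mu) < 1.
Proof.
case: k hk => // n n2; move=> js is_js_density; split.
  by exists (@js_density R n); exact: js_density_marginal.
move=> p hp g; split; first exact: js_generalized_estimator.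
move=> mu P I_js EV; split; last split; last split.
- split.
  + move=> t t0; split.
    * exact: js_preimage.
    * exact: js_preim_norms.
    * rewrite (js_density_unique n2 hp mu t0) js_density_gt0//; split => //.
      rewrite (_ : (fun nu => _) = fun nu => ln (js_density nu t)).
        exact: differentiable_ln_js_density.
      by apply/funext => nu; rewrite (js_density_unique n2 hp nu t0).
    * exact: score_marginal.
    * exact: js_pi_lt01.
  + by move=> i; exact: js_score_is_cond_exp.
  + exact: js_pi_is_cond_exp.
- split.
  + by rewrite (js_cov_score n2 hp); exact: js_info_unit.
  + by rewrite (js_Lambda n2 hp) -(js_fisher_info n2 hp).
  + exact: exists_js_cond_cov.
  + move=> V hV; rewrite /I_js (js_fisher_info n2 hp); apply/matrixP => i j.
    rewrite mxE [RHS]mxE [X in _ = _ + X]mxE (js_cond_cov_expect n2 i j hV).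
    by rewrite [X in X - _]mxE opprB addrC subrK.
- move=> V hV; apply/eqP => /matrixP /(_ ord0 ord0).
  rewrite (js_cond_cov_expect n2 _ _ hV) mxE eqxx => /eqP.
  by rewrite subr_eq0 gt_eqF// js_info_diag_lt1.
- exact: js_efficiency_lt1.
Qed.
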